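(* Let $\mu$ be a strict partition that is not of the form $(k+1,k,\ldots,2,1)$, written as $$\mu=(k+1,k,k-1,\ldots,k-\ell+1,a_0,a_1,\ldots)$$ with $k\ge1$, $\ell\ge0$ and $k-\ell>a_0\ge0$ (so $k-\ell$ is the largest positive integer below $\mu_1=k+1$ that is not a part of $\mu$, and $a_0\ge a_1\ge\cdots$ are the remaining parts). Then $$|\mathrm{Av}_n(\mu)|=\frac{n^{k-1}\log^\ell n}{\ell!\,(k-1)!\prod_{j=0}^{k-\ell-1}\bigl(k-\ell-a_j-j\bigr)}\left(1+O\!\left(\frac1{\log n}\right)\right).$$
   Context: A partition is a weakly decreasing sequence of nonnegative integers with finitely many nonzero parts, identified with its Ferrers board. $\alpha$ contains $\mu$ if one can delete some rows and some columns of the Ferrers board of $\alpha$ so that after top/left-justifying one obtains $\mu$; otherwise $\alpha$ avoids $\mu$. $\mathrm{Av}_n(\mu)$ is the set of partitions of weight $n$ avoiding $\mu$. Strict: positive parts distinct. Implied constants may depend on $\mu$. *)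

(* Defs.v *)
From Stdlib Require Import Reals Lra Lia Arith List Sorted.
Import ListNotations.
Open Scope R_scope.

Definition is_partition (a : list nat) : Prop :=
  Forall (fun x => (0 < x)%nat) a /\ Sorted (fun x y => (y <= x)%nat) a.

Definition is_strict_partition (a : list nat) : Prop :=
  Forall (fun x => (0 < x)%nat) a /\ Sorted (fun x y => (y < x)%nat) a.

Definition weight (a : list nat) : nat := fold_right Nat.add 0%nat a.

(* alpha contains mu: choose rows (indices, increasing) and columns
   (indices, increasing) of the Ferrers board of alpha; row i keeps the
   cells in the chosen columns c with c < alpha_i; after justifying, the
   kept rows (dropping empty ones) must give exactly mu. *)
Definition contains (alpha mu : list nat) : Prop :=
  exists rows cols : list nat,
    StronglySorted lt rows /\ StronglySorted lt cols /\
    map (fun i => length (filter (fun c => Nat.ltb c (nth i alpha 0%nat)) cols)) rows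
      = mu.

Definition avoids (alpha mu : list nat) : Prop := ~ contains alpha mu.

Definition enumerates_Av (mu : list nat) (n : nat) (L : list (list nat)) : Prop :=
  NoDup L /\
  forall alpha, In alpha L <-> (is_partition alpha /\ weight alpha = n /\ avoids alpha mu).

Fixpoint prodR (m : nat) (f : nat -> R) : R :=
  match m with
  | O => 1
  | S m' => prodR m' f * f m'
  end.

(* Main.v *)
Require Import Defs.
From Stdlib Require Import Reals Lra Lia Arith List Sorted Permutation Classical.
Import ListNotations.
Open Scope R_scope.

(** Containment of a strict partition depends only on the set [D] of part sizes:
    [alpha] contains [mu] iff [D] has elements [p_1 > ... > p_r] with [p_r >= mu_r]
    and [p_i - p_(i+1) >= mu_i - mu_(i+1)].  Matching greedily from the smallest part
    shows that an avoiding [D] has at most [k] elements, and that for [|D| = k] it is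
    [{1, ..., mu_r - 1}] followed by runs of consecutive integers whose lengths are the
    gaps of [mu]; the last [l] runs are single integers, and the run before them has
    length at least 2 (or is absent, and then 1 belongs to [D]).

    The solutions of [sum_(d in D) c_d d = n] with all [c_d >= 1] number about
    [n^(k-1) / ((k-1)! prod D)].  Two consecutive elements, or the element 1, keep the
    error of this approximation under control.  Summing [1 / prod D] over the runs
    telescopes to the stated product, and the singletons contribute [(log n)^l / l!].
    Sets with fewer than [k] elements, and those whose long run starts beyond [sqrt n],
    contribute only [O(n^(k-3/2))] up to logarithms. *)

Open Scope nat_scope.

(** The obstacle is the base of the count. For a single part size [d] the number of solutions of
    [c d = m] is 0 or 1, and an error of that size propagates to [n^(k-1)], the order of the main
    term. A consecutive pair has error at most 1 already with two parts, which propagates only to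
    [n^(k-2)]; the part 1 alone has no error. The other parts are then added one at a time, each
    acting as an integration. The cut at [X = sqrt n] balances two losses, up to logarithms: a pair
    beyond [X] leaves [n / X] choices for the sum of its two multiplicities, while the bounded
    errors of the pairs below [X], no longer damped by the product of the pair, add up to order [X].
    The relative error [1 / log n] comes from the singletons. They start where the runs end, they
    have to be distinct, and their sum, by which [n] is shifted, can be of order [n]; each of these
    effects costs one logarithm on average. *)

Fixpoint inc (e : nat) (D : list nat) : Prop :=
  match D with [] => True | d :: D' => e <= d /\ inc (S d) D' end.

Fixpoint dec (D : list nat) : Prop :=
  match D with [] => True | d :: D' => (forall x, In x D' -> x < d) /\ dec D' end.

Lemma inc_weaken e e' D : e' <= e -> inc e D -> inc e' D.
Proof. destruct D; simpl; intuition lia. Qed.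

Lemma inc_ge e D x : inc e D -> In x D -> e <= x.
Proof.
  revert e; induction D as [|d D IH]; simpl; [tauto|].
  intros e [H1 H2] [->|H]; [lia|]. specialize (IH _ H2 H). lia.
Qed.

Lemma inc_app e D1 D2 : inc e (D1 ++ D2) <->
  inc e D1 /\ inc e D2 /\ (forall x y, In x D1 -> In y D2 -> x < y).
Proof.
  revert e; induction D1 as [|d D IH]; simpl; intros e.
  - intuition.
  - rewrite IH. split.
    + intros (H1 & H2 & H3 & H4). repeat split; auto.
      * eapply inc_weaken; [|exact H3]. lia.
      * intros x y [->|Hx] Hy; auto. apply (inc_ge _ _ y) in H3; auto.
    + intros ((H1 & H2) & H3 & H4). repeat split; auto.
      destruct D2 as [|y D2]; simpl in *; auto. destruct H3. split; auto.
      specialize (H4 d y (or_introl eq_refl) (or_introl eq_refl)). lia.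
Qed.

Lemma dec_inc_rev D : dec D -> (forall x, In x D -> 1 <= x) -> inc 1 (rev D).
Proof.
  induction D as [|d D IH]; simpl; auto. intros [H1 H2] H3.
  apply inc_app. simpl. repeat split; auto.
  intros x y Hx [<-|[]]. apply H1. now apply in_rev.
Qed.

Lemma inc_dec_rev e D : inc e D -> dec (rev D).
Proof.
  induction D as [|d D IH] using rev_ind; simpl; auto.
  rewrite inc_app, rev_app_distr. intros (H1 & H2 & H3). simpl. split; auto.
  intros x Hx. apply H3; [now apply in_rev|simpl; auto].
Qed.

Lemma inc_seq e m : inc e (seq e m).
Proof. revert e; induction m; simpl; auto. Qed.

(** * Avoidance in terms of the set of part sizes *)

(* Greedy matching of the pattern against the increasing list [D] of part
   sizes: [q] is the least admissible value for the next part and [bs] lists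
   the gaps still to be realised, from the smallest part of the pattern up. *)
Fixpoint av (q : nat) (bs D : list nat) : bool :=
  match D with
  | [] => true
  | d :: D' =>
      if d <? q then av q bs D'
      else match bs with [] => false | g :: bs' => av (d + g) bs' D' end
  end.

(** The non-greedy counterpart of [av]: some chain in [P] realises all gaps. A predicate replaces
    the list because neither order nor multiplicity of the parts matters, so the notion reads the
    same on [alpha] and on its set of part sizes. *)
Fixpoint has (P : nat -> Prop) (q : nat) (bs : list nat) : Prop :=
  exists p, P p /\ q <= p /\
    match bs with [] => True | g :: bs' => has P (p + g) bs' end.

Lemma has_mono (P P' : nat -> Prop) q q' bs :
  q' <= q -> (forall p, q <= p -> P p -> P' p) -> has P q bs -> has P' q' bs.
Proof.
  revert q q'; induction bs as [|g bs IH]; simpl; intros q q' Hq HP (p & Hp & Hqp & H);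
    exists p; repeat split; auto; try lia.
  eapply IH; [| |exact H]; [lia|]. intros; apply HP; auto; lia.
Qed.

(** Exchange argument: replacing the first element of a chain by the least admissible element of [D]
    only lowers the next bound, so the greedy matching succeeds whenever some matching does. Gaps of
    at least 1 keep the chosen element from being used again. *)
Lemma av_has D : forall e q bs, inc e D -> Forall (fun g => 1 <= g) bs ->
  (av q bs D = false <-> has (fun d => In d D) q bs).
Proof.
  induction D as [|d D IH]; simpl; intros e q bs Hinc Hbs.
  - split; [discriminate|]. destruct bs; simpl; intros (p & [] & _).
  - destruct Hinc as [_ Hinc]. destruct (Nat.ltb_spec d q) as [Hd|Hd].
    + rewrite (IH _ q bs Hinc Hbs). split; apply has_mono; auto.
      intros p Hp [->|]; auto; lia.
    + destruct bs as [|g bs].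
      * split; auto. intros _. exists d; auto.
      * inversion Hbs; subst. rewrite (IH _ (d + g) bs Hinc H2). split.
        -- intros H. simpl. exists d; repeat split; auto.
           revert H. apply has_mono; auto.
        -- simpl. intros (p & Hp & Hqp & H).
           assert (d <= p) by (destruct Hp as [->|Hp]; auto; apply (inc_ge _ _ _ Hinc) in Hp; lia).
           revert H. apply has_mono; [lia|]. intros x Hx [->|]; auto; lia.
Qed.

Fixpoint diffs (q : nat) (nu : list nat) : list nat :=
  match nu with [] => [] | m :: r => (m - q) :: diffs m r end.

(** The number of cells kept from a row of length [v]. It starts at 0 and grows by at most 1 when
    [v] does; extracting a chain of parts from a containment uses nothing else about the columns. *)
Definition below (cols : list nat) (v : nat) : nat :=
  length (filter (fun c => Nat.ltb c v) cols).

Lemma below_S cols v : inc 0 cols -> below cols v <= below cols (S v) <= S (below cols v).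
Proof.
  unfold below. generalize 0 as e. induction cols as [|c cols IH]; simpl; intros e; [lia|].
  intros [_ H]. specialize (IH _ H).
  destruct (Nat.ltb_spec c v), (Nat.ltb_spec c (S v)); simpl; try lia.
  assert (c = v) by lia; subst c.
  assert (E : forall w, w <= S v -> filter (fun c => c <? w) cols = []).
  { intros w Hw. assert (F : forall x, In x cols -> S v <= x) by (intros; eapply inc_ge; eauto).
    clear -F Hw. induction cols as [|c cols IH]; simpl; auto.
    destruct (Nat.ltb_spec c w); [specialize (F c (or_introl eq_refl)); lia|].
    apply IH. intros; apply F; simpl; auto. }
  rewrite !E by lia. simpl. lia.
Qed.

Lemma below_lip cols v w : inc 0 cols -> v <= w ->
  below cols v <= below cols w <= below cols v + (w - v).
Proof.
  intros H Hvw. induction Hvw; [lia|]. pose proof (below_S cols m H). lia.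
Qed.

Lemma below_0 cols : below cols 0 = 0.
Proof. unfold below. induction cols; simpl; auto. Qed.

Lemma StronglySorted_inc l : StronglySorted lt l <-> inc 0 l.
Proof.
  split.
  - intros H. assert (G : forall e, (forall x, In x l -> e <= x) -> inc e l).
    { induction H as [|a l H IH F]; simpl; intros e He; auto. split; auto.
      apply IH. intros x Hx. rewrite Forall_forall in F. apply F in Hx. lia. }
    apply G. intros; lia.
  - generalize 0. induction l as [|a l IH]; simpl; constructor.
    + destruct H; eauto.
    + apply Forall_forall. intros x Hx. destruct H as [_ H]. apply (inc_ge _ _ _ H) in Hx. lia.
Qed.

(** As [below cols] is 1-Lipschitz, rows keeping [q] and [m] cells come from parts at least [m - q]
    apart. The last hypothesis carries this lower bound to whichever row is met next. *)
Lemma chain_of_columns (P : nat -> Prop) cols : inc 0 cols -> forall nu q Q,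
  inc (S q) nu -> (forall m, In m (q :: nu) -> exists v, P v /\ below cols v = m) ->
  (forall v, below cols v = q -> Q <= v) -> has P Q (diffs q nu).
Proof.
  intros Hc. induction nu as [|m nu IH]; simpl; intros q Q Hi Hex HQ.
  - destruct (Hex q) as (v & Hv & E); auto. exists v; auto.
  - destruct (Hex q) as (v & Hv & E); auto. exists v; repeat split; auto.
    apply IH; try tauto.
    + intros; apply Hex; simpl in *; tauto.
    + intros w Hw. destruct (Nat.le_gt_cases v w) as [L|L].
      * pose proof (below_lip cols v w Hc L). lia.
      * assert (w <= v) by lia. pose proof (below_lip cols w v Hc H). lia.
Qed.

Lemma below_app c1 c2 v : below (c1 ++ c2) v = below c1 v + below c2 v.
Proof. unfold below. now rewrite filter_app, length_app. Qed.

Lemma below_all c v : (forall x, In x c -> x < v) -> below c v = length c.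
Proof.
  unfold below. induction c as [|a c IH]; simpl; intros H; auto.
  destruct (Nat.ltb_spec a v) as [|L]; [simpl; rewrite IH; auto|].
  specialize (H a (or_introl eq_refl)); lia.
Qed.

Lemma below_none c v : (forall x, In x c -> v <= x) -> below c v = 0.
Proof.
  unfold below. induction c as [|a c IH]; simpl; intros H; auto.
  destruct (Nat.ltb_spec a v) as [L|]; [|rewrite IH; auto].
  specialize (H a (or_introl eq_refl)); lia.
Qed.

(** The converse construction: after a chain element [p] the columns [p, ..., p + (m - q) - 1] are
    chosen, the first ones missing from a row of length [p]; the gap condition puts them all inside
    the next row. [cols0] holds the columns chosen so far, all below [Q], and [ext] the later ones,
    which no earlier row meets. *)
Lemma columns_of_chain (P : nat -> Prop) : forall nu q Q cols0,
  inc (S q) nu -> inc 0 cols0 -> (forall x, In x cols0 -> x < Q) -> length cols0 = q ->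
  has P Q (diffs q nu) ->
  exists ps ext, inc 0 (cols0 ++ ext) /\ inc Q ps /\ (forall x, In x ext -> Q <= x) /\
    (forall p, In p ps -> P p) /\ map (below (cols0 ++ ext)) ps = q :: nu.
Proof.
  induction nu as [|m nu IH]; simpl; intros q Q cols0 Hi Hc Hb Hl (p & Hp & HQ & Hh).
  - exists [p], []. rewrite app_nil_r. simpl. repeat split; auto; try tauto; try lia.
    + intros x [<-|[]]; auto.
    + rewrite below_all; [congruence|]. intros x Hx; specialize (Hb x Hx); lia.
  - destruct Hi as [Hm Hi].
    destruct (IH m (p + (m - q)) (cols0 ++ seq p (m - q))) as (ps & ext & H1 & H2 & H3 & H4 & H5); auto.
    + apply inc_app. repeat split; auto.
      * eapply inc_weaken; [|apply inc_seq]; lia.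
      * intros x y Hx Hy. specialize (Hb x Hx). apply in_seq in Hy. lia.
    + intros x Hx. apply in_app_iff in Hx. destruct Hx as [Hx|Hx].
      * specialize (Hb x Hx). lia.
      * apply in_seq in Hx. lia.
    + rewrite length_app, length_seq. lia.
    + exists (p :: ps), (seq p (m - q) ++ ext). rewrite app_assoc. split; [auto|].
      split; [|split; [|split]].
      * simpl. split; auto. eapply inc_weaken; [|exact H2]. lia.
      * intros x Hx. apply in_app_iff in Hx. destruct Hx as [Hx|Hx].
        -- apply in_seq in Hx. lia.
        -- apply H3 in Hx. lia.
      * simpl. intros x [<-|Hx]; auto.
      * simpl. rewrite H5. f_equal. rewrite !below_app, below_all, !below_none; try lia.
        -- intros x Hx. apply H3 in Hx. lia.
        -- intros x Hx. apply in_seq in Hx. lia.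
        -- intros x Hx. specialize (Hb x Hx). lia.
Qed.

Lemma sorted_nth_anti (a : list nat) i j : Sorted (fun x y => y <= x) a ->
  i <= j -> nth j a 0 <= nth i a 0.
Proof.
  intros H. apply Sorted_StronglySorted in H; [|intros ? ? ? ? ?; lia].
  revert i j. induction H as [|x a H IH F]; intros i j Hij.
  - destruct i, j; simpl; lia.
  - destruct i, j; simpl; try lia.
    + destruct (Nat.lt_ge_cases j (length a)) as [L|L].
      * rewrite Forall_forall in F. apply F. now apply nth_In.
      * rewrite nth_overflow; lia.
    + apply IH. lia.
Qed.

Lemma rows_of_values (a ps : list nat) : Sorted (fun x y => y <= x) a -> dec ps ->
  (forall p, In p ps -> In p a) ->
  exists rows, StronglySorted lt rows /\ map (fun i => nth i a 0) rows = ps.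
Proof.
  intros Ha. induction ps as [|p ps IH]; simpl; intros Hd Hin.
  - exists []. split; auto. constructor.
  - destruct Hd as [Hd1 Hd2]. destruct IH as (rows & H1 & H2); auto.
    destruct (In_nth a p 0 (Hin p (or_introl eq_refl))) as (i & Hi & E).
    exists (i :: rows). split; [|simpl; congruence]. constructor; auto.
    apply Forall_forall. intros j Hj.
    assert (nth j a 0 < p) by (apply Hd1; rewrite <- H2; apply in_map_iff; eauto).
    destruct (Nat.lt_ge_cases i j) as [|L]; auto.
    pose proof (sorted_nth_anti a j i Ha L). lia.
Qed.

Lemma contains_has alpha mu q nu : Sorted (fun x y => y <= x) alpha ->
  rev mu = q :: nu -> 1 <= q -> inc (S q) nu ->
  (contains alpha mu <-> has (fun p => In p alpha) q (diffs q nu)).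
Proof.
  intros Ha Hmu Hq Hnu. assert (Emu : mu = rev (q :: nu)) by (rewrite <- Hmu; now rewrite rev_involutive).
  split.
  - intros (rows & cols & Hr & Hc & E). apply StronglySorted_inc in Hc.
    apply chain_of_columns with (cols := cols); auto.
    + intros m Hm. assert (In m mu) as Hm' by (rewrite Emu; now rewrite <- in_rev).
      rewrite <- E in Hm'. apply in_map_iff in Hm'. destruct Hm' as (i & Hi & _).
      exists (nth i alpha 0). split; [|exact Hi].
      (* An index past the end of [alpha] reads the default 0 and keeps no cell, which is impossible
         because every part of [mu] is positive. *)
      destruct (Nat.lt_ge_cases i (length alpha)) as [L|L]; [now apply nth_In|].
      rewrite nth_overflow in Hi by auto. fold (below cols 0) in Hi. rewrite below_0 in Hi.
      simpl in Hm. destruct Hm as [Hm|Hm]; [lia|]. apply (inc_ge _ _ _ Hnu) in Hm. lia.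
    + intros v Hv. pose proof (below_lip cols 0 v Hc (Nat.le_0_l v)). rewrite below_0 in H. lia.
  (* The first [q] columns supply the smallest part of [mu]: every chain element is at least [q]. *)
  - intros H. destruct (columns_of_chain (fun p => In p alpha) nu q q (seq 0 q) Hnu) as (ps & ext & H1 & H2 & H3 & H4 & H5); auto.
    + apply inc_seq.
    + intros x Hx. apply in_seq in Hx. lia.
    + apply length_seq.
    + destruct (rows_of_values alpha (rev ps) Ha) as (rows & R1 & R2).
      * eapply inc_dec_rev; eauto.
      * intros p Hp. apply H4. now apply in_rev.
      * exists rows, (seq 0 q ++ ext). split; [auto|split; [now apply StronglySorted_inc|]].
        rewrite Emu, <- H5, <- map_rev, <- R2, map_map. reflexivity.
Qed.

(** * Run-length encoding *)

Definition dexp (c : list (nat * nat)) : list nat :=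
  flat_map (fun p => repeat (fst p) (snd p)) c.

Fixpoint rle (a : list nat) : list (nat * nat) :=
  match a with
  | [] => []
  | x :: a' =>
      match rle a' with
      | [] => [(x, 1)]
      | (d, c) :: r => if d =? x then (d, S c) :: r else (x, 1) :: (d, c) :: r
      end
  end.

Lemma dexp_rle a : dexp (rle a) = a.
Proof.
  induction a as [|x a IH]; simpl; auto.
  destruct (rle a) as [|[d c] r]; simpl in *; [now rewrite <- IH|].
  destruct (Nat.eqb_spec d x); simpl; rewrite <- IH; subst; auto.
Qed.

Lemma rle_dexp c : dec (map fst c) -> Forall (fun p => 1 <= snd p) c -> rle (dexp c) = c.
Proof.
  induction c as [|[d m] c IH]; simpl; intros Hd Hc; auto.
  destruct Hd as [Hd1 Hd2]. inversion Hc as [|? ? Hm Hc']; subst; simpl in *.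
  specialize (IH Hd2 Hc').
  destruct m as [|m]; [lia|]. clear Hm Hc.
  induction m as [|m IHm].
  - simpl. fold (dexp c). rewrite IH. destruct c as [|[d' c'] c]; auto.
    destruct (Nat.eqb_spec d' d); auto. specialize (Hd1 d' (or_introl eq_refl)). lia.
  - change (rle (d :: (repeat d (S m) ++ dexp c)) = (d, S (S m)) :: c).
    simpl rle at 1. simpl in IHm. fold (dexp c) in IHm. rewrite IHm. now rewrite Nat.eqb_refl.
Qed.

Lemma rle_fst a x : In x (map fst (rle a)) -> In x a.
Proof.
  induction a as [|y a IH]; simpl; auto.
  destruct (rle a) as [|[d c] r]; simpl in *; [tauto|].
  destruct (Nat.eqb_spec d y); simpl; tauto.
Qed.

Lemma rle_valid a : is_partition a ->
  dec (map fst (rle a)) /\ Forall (fun p => 1 <= snd p) (rle a) /\ (forall x, In x (map fst (rle a)) -> 1 <= x).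
Proof.
  intros [Hp Hs]. split; [|split].
  - apply Sorted_StronglySorted in Hs; [|intros ? ? ? ? ?; lia].
    induction Hs as [|x a Hs IH F]; simpl; auto.
    inversion Hp; subst. specialize (IH H2).
    rewrite Forall_forall in F. pose proof (rle_fst a) as Hf.
    destruct (rle a) as [|[d c] r] eqn:E; simpl in *; [tauto|].
    destruct IH as [I1 I2].
    destruct (Nat.eqb_spec d x); simpl; repeat split; auto.
    intros y Hy. assert (d <= x) by (apply F, Hf; auto).
    destruct Hy as [<-|Hy]; [lia|]. specialize (I1 y Hy). lia.
  - clear. induction a as [|x a IH]; simpl; auto.
    destruct (rle a) as [|[d c] r]; [repeat constructor|].
    inversion IH; subst. destruct (d =? x); repeat constructor; simpl in *; auto.
  - intros x Hx. apply rle_fst in Hx. rewrite Forall_forall in Hp. now apply Hp.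
Qed.

(** Codes list the part sizes increasingly, as the greedy matching reads them, whereas partitions
    decrease. *)
Definition expand (c : list (nat * nat)) : list nat := dexp (rev c).

Fixpoint W (c : list (nat * nat)) : nat :=
  match c with [] => 0 | (d, m) :: c' => m * d + W c' end.

Definition vcode (n : nat) (c : list (nat * nat)) : Prop :=
  inc 1 (map fst c) /\ Forall (fun p => 1 <= snd p) c /\ W c = n.

Lemma W_app c1 c2 : W (c1 ++ c2) = W c1 + W c2.
Proof. induction c1 as [|[d m] c1 IH]; simpl; lia. Qed.

Lemma weight_app a b : weight (a ++ b) = weight a + weight b.
Proof. unfold weight. induction a; simpl; lia. Qed.

Lemma weight_dexp c : weight (dexp c) = W c.
Proof.
  induction c as [|[d m] c IH]; simpl; auto.
  rewrite weight_app. fold (dexp c). rewrite IH. f_equal.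
  unfold weight. induction m; simpl; lia.
Qed.

Lemma W_rev c : W (rev c) = W c.
Proof. induction c as [|[d m] c IH]; simpl; auto. rewrite W_app. simpl. lia. Qed.

Lemma in_dexp c v : In v (dexp c) -> In v (map fst c).
Proof.
  unfold dexp. rewrite in_flat_map. intros ([d m] & H1 & H2). simpl in H2.
  apply repeat_spec in H2. subst. apply in_map_iff. exists (d, m); auto.
Qed.

Lemma in_dexp_iff c v : Forall (fun p => 1 <= snd p) c -> (In v (dexp c) <-> In v (map fst c)).
Proof.
  intros F. split; [apply in_dexp|]. rewrite in_map_iff. intros ([d m] & <- & H).
  unfold dexp. apply in_flat_map. exists (d, m). split; auto.
  rewrite Forall_forall in F. apply F in H. simpl in *. destruct m; [lia|]. simpl; auto.
Qed.

Lemma dexp_partition c : dec (map fst c) -> (forall x, In x (map fst c) -> 1 <= x) ->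
  is_partition (dexp c).
Proof.
  intros Hd H1. split.
  - apply Forall_forall. intros x Hx. apply H1. now apply in_dexp.
  - apply StronglySorted_Sorted. induction c as [|[d m] c IH]; simpl; [constructor|].
    simpl in Hd. destruct Hd as [Hd Hd'].
    assert (IH' := IH Hd' (fun x Hx => H1 x (or_intror Hx))). fold (dexp c).
    induction m as [|m IHm]; simpl; auto. constructor; auto.
    apply Forall_forall. intros x Hx. apply in_app_iff in Hx. destruct Hx as [Hx|Hx].
    + apply repeat_spec in Hx. lia.
    + apply in_dexp in Hx. apply Hd in Hx. lia.
Qed.

Lemma expand_partition n c : vcode n c -> is_partition (expand c) /\ weight (expand c) = n.
Proof.
  intros (H1 & H2 & H3). unfold expand. split.
  - apply dexp_partition; rewrite map_rev.
    + eapply inc_dec_rev; eauto.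
    + intros x Hx. apply in_rev in Hx. eapply inc_ge; eauto.
  - rewrite weight_dexp, W_rev. auto.
Qed.

Lemma expand_inj n c c' : vcode n c -> vcode n c' -> expand c = expand c' -> c = c'.
Proof.
  intros (H1 & H2 & _) (H1' & H2' & _) E. unfold expand in E.
  rewrite <- (rev_involutive c), <- (rev_involutive c'). f_equal.
  rewrite <- (rle_dexp (rev c)), <- (rle_dexp (rev c')).
  - now rewrite E.
  - rewrite map_rev. eapply inc_dec_rev; eauto.
  - now apply Forall_rev.
  - rewrite map_rev. eapply inc_dec_rev; eauto.
  - now apply Forall_rev.
Qed.

Lemma expand_surj a : is_partition a -> exists c, vcode (weight a) c /\ expand c = a.
Proof.
  intros H. destruct (rle_valid a H) as (H1 & H2 & H3). exists (rev (rle a)). unfold expand. rewrite rev_involutive, dexp_rle.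
  split; auto. split; [|split].
  - rewrite map_rev. now apply dec_inc_rev.
  - now apply Forall_rev.
  - rewrite W_rev, <- weight_dexp, dexp_rle. auto.
Qed.

Lemma diffs_pos q nu : inc (S q) nu -> Forall (fun g => 1 <= g) (diffs q nu).
Proof. revert q; induction nu; simpl; intros q H; constructor; [lia|]. apply IHnu. tauto. Qed.

Lemma avoids_av n c mu q nu : vcode n c -> rev mu = q :: nu -> 1 <= q -> inc (S q) nu ->
  (avoids (expand c) mu <-> av q (diffs q nu) (map fst c) = true).
Proof.
  intros Hc Hmu Hq Hnu. destruct (expand_partition n c Hc) as [[Hp1 Hp2] _]. destruct Hc as (H1 & H2 & H3).
  unfold avoids. rewrite (contains_has _ _ q nu); auto.
  assert (E : has (fun p => In p (expand c)) q (diffs q nu) <-> av q (diffs q nu) (map fst c) = false).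
  { rewrite (av_has _ _ _ _ H1 (diffs_pos q nu Hnu)).
    assert (E : forall p, In p (expand c) <-> In p (map fst c)).
    { intros p. unfold expand. rewrite in_dexp_iff by now apply Forall_rev. rewrite map_rev. now rewrite <- in_rev. }
    split; apply has_mono; auto; intros; now apply E. }
  rewrite E. destruct (av q (diffs q nu) (map fst c)); intuition congruence.
Qed.

(** * Avoiding sets of maximal size *)

(** The shape of an avoiding set on which the greedy matching wastes nothing: each gap [g] is filled
    by [g] consecutive elements. Neighbouring runs may touch. The end bound [q'] is exposed so that
    lists of runs can be concatenated. *)
Fixpoint Full (q : nat) (bs D : list nat) (q' : nat) : Prop :=
  match bs with
  | [] => D = [] /\ q' = q
  | g :: bs' => exists d D', q <= d /\ D = seq d g ++ D' /\ Full (d + g) bs' D' q'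
  end.

(** The quantity [q - e + list_sum bs] drops by at least one with each element read: either [e]
    moves past an element below [q], or a gap [g] is traded for a window of [g - 1] further
    values. *)
Lemma av_length D : forall e q bs, inc e D -> e <= q -> Forall (fun g => 1 <= g) bs ->
  av q bs D = true -> length D <= q - e + list_sum bs.
Proof.
  induction D as [|d D IH]; simpl; intros e q bs Hi He Hb Ha; [lia|].
  destruct Hi as [Hd Hi]. destruct (Nat.ltb_spec d q) as [L|L].
  - apply (IH (S d)) in Ha; auto. lia.
  - destruct bs as [|g bs]; [discriminate|]. inversion Hb; subst.
    apply (IH (S d)) in Ha; auto; [|lia]. simpl. lia.
Qed.

Lemma seq_cons d g : 1 <= g -> seq d g = d :: seq (S d) (g - 1).
Proof. destruct g; [lia|]. simpl. now rewrite Nat.sub_0_r. Qed.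

(** Equality in [av_length] allows no value of a window to be skipped, and no match before the
    window is used up; so every window becomes a run. *)
Lemma av_full D : forall e q bs, inc e D -> e <= q -> Forall (fun g => 1 <= g) bs ->
  av q bs D = true -> length D = q - e + list_sum bs ->
  exists D2 q', D = seq e (q - e) ++ D2 /\ Full q bs D2 q'.
Proof.
  induction D as [|d D IH]; simpl; intros e q bs Hi He Hb Ha Hl.
  - replace (q - e) with 0 by lia. exists [], q. split; auto.
    destruct bs as [|g bs]; simpl; auto. inversion Hb; subst. simpl in Hl. lia.
  - destruct Hi as [Hd Hi]. destruct (Nat.ltb_spec d q) as [L|L].
    + pose proof (av_length D (S d) q bs Hi ltac:(lia) Hb Ha).
      destruct (IH (S d) q bs) as (D2 & q' & E & HF); auto; [lia|].
      exists D2, q'. split; auto. rewrite (seq_cons e) by lia.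
      replace e with d by lia. replace (q - d - 1) with (q - S d) by lia. now rewrite E.
    + destruct bs as [|g bs]; [discriminate|]. inversion Hb; subst. simpl in Hl.
      pose proof (av_length D (S d) (d + g) bs Hi ltac:(lia) H2 Ha).
      destruct (IH (S d) (d + g) bs) as (D2 & q' & E & HF); auto; [lia|lia|].
      exists (d :: D), q'. split; [now replace (q - e) with 0 by lia|].
      simpl. exists d, D2. repeat split; auto. rewrite (seq_cons d) by lia.
      replace (d + g - S d) with (g - 1) in E by lia. now rewrite E.
Qed.

Lemma av_skip m : forall e q bs D, e + m <= q -> av q bs (seq e m ++ D) = av q bs D.
Proof.
  induction m as [|m IH]; simpl; intros e q bs D H; auto.
  destruct (Nat.ltb_spec e q); [|lia]. apply IH. lia.
Qed.

Lemma Full_av bs : forall q D q', Full q bs D q' -> Forall (fun g => 1 <= g) bs -> av q bs D = true.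
Proof.
  induction bs as [|g bs IH]; simpl; intros q D q' H Hb.
  - destruct H as [-> _]. reflexivity.
  - destruct H as (d & D' & Hd & -> & H). inversion Hb; subst.
    rewrite (seq_cons d) by lia. simpl. destruct (Nat.ltb_spec d q); [lia|].
    rewrite av_skip by lia. eapply IH; eauto.
Qed.

Lemma Full_inc bs : forall q D q', Full q bs D q' ->
  inc q D /\ (forall x, In x D -> x < q') /\ q + list_sum bs <= q' /\ length D = list_sum bs.
Proof.
  induction bs as [|g bs IH]; simpl; intros q D q' H.
  - destruct H as [-> ->]. simpl. repeat split; auto; [tauto|lia].
  - destruct H as (d & D' & Hd & -> & H). destruct (IH _ _ _ H) as (I1 & I2 & I3 & I4).
    split; [|split; [|split]].
    + apply inc_app. repeat split.
      * eapply inc_weaken; [|apply inc_seq]. lia.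
      * eapply inc_weaken; [|exact I1]. lia.
      * intros x y Hx Hy. apply in_seq in Hx. apply (inc_ge _ _ _ I1) in Hy. lia.
    + intros x Hx. apply in_app_iff in Hx. destruct Hx as [Hx|Hx]; auto.
      apply in_seq in Hx. lia.
    + lia.
    + rewrite length_app, length_seq. lia.
Qed.

Lemma Full_app b1 b2 : forall q D q'', Full q (b1 ++ b2) D q'' <->
  exists D1 D2 q', D = D1 ++ D2 /\ Full q b1 D1 q' /\ Full q' b2 D2 q''.
Proof.
  induction b1 as [|g b1 IH]; simpl; intros q D q''; split.
  - intros H. exists [], D, q. auto.
  - intros (D1 & D2 & q' & -> & [-> ->] & H). auto.
  - intros (d & D' & Hd & -> & H). apply IH in H. destruct H as (D1 & D2 & q' & -> & H1 & H2).
    exists (seq d g ++ D1), D2, q'. rewrite app_assoc. repeat split; auto. exists d, D1. auto.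
  - intros (D1 & D2 & q' & -> & (d & D' & Hd & -> & H1) & H2).
    exists d, (D' ++ D2). rewrite app_assoc. repeat split; auto. apply IH. exists D', D2, q'. auto.
Qed.

(** Runs of length 1 impose nothing but strict increase. This freedom of the top [l] elements is
    what produces the powers of the logarithm. *)
Lemma Full_singles l : forall q S, inc q S -> length S = l -> exists q', Full q (repeat 1 l) S q'.
Proof.
  induction l as [|l IH]; intros q [|d S]; simpl; intros Hi Hl; try discriminate; eauto.
  destruct Hi as [Hd Hi]. destruct (IH (d + 1) S) as (q' & H); [|lia|].
  - eapply inc_weaken; [|exact Hi]. lia.
  - exists q', d, S. auto.
Qed.

(** Exhibits the consecutive pair that serves both as the base of the count and as the handle for
    covering runs far out. *)
Lemma last_pair bs : forall q D q', Full q bs D q' -> bs <> [] -> 2 <= last bs 0 ->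
  exists D0, D = D0 ++ [q' - 2; q' - 1] /\ q <= q' - 2.
Proof.
  induction bs as [|g bs IH]; [tauto|]. intros q D q' (d & D' & Hd & -> & H) _ Hl.
  destruct bs as [|g' bs].
  - destruct H as [-> ->]. simpl in Hl. exists (seq d (g - 2)). rewrite app_nil_r. split; [|lia].
    replace g with (g - 2 + 2) at 1 by lia. rewrite seq_app. simpl.
    repeat (f_equal; try lia).
  - destruct (IH _ _ _ H) as (D0 & -> & Hq); [discriminate|exact Hl|].
    exists (seq d g ++ D0). rewrite app_assoc. split; auto. lia.
Qed.

(* The runs of lengths [bs] starting at or above [q], with starting points at
   most [N], paired with the least value available to the next run. *)
Fixpoint chains (N q : nat) (bs : list nat) : list (list nat * nat) :=
  match bs with
  | [] => [([], q)]
  | g :: bs' =>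
      flat_map (fun d => map (fun p => (seq d g ++ fst p, snd p)) (chains N (d + g) bs'))
               (seq q (N + 1 - q))
  end.

Fixpoint subs (n l q : nat) : list (list nat) :=
  match l with
  | 0 => [[]]
  | S l' => flat_map (fun d => map (cons d) (subs n l' (S d))) (seq q (n + 1 - q))
  end.

Lemma in_chains N bs : forall q D q', In (D, q') (chains N q bs) -> Full q bs D q'.
Proof.
  induction bs as [|g bs IH]; simpl; intros q D q' H.
  - destruct H as [[= <- <-]|[]]; auto.
  - apply in_flat_map in H. destruct H as (d & Hd & H). apply in_map_iff in H.
    destruct H as ([D1 q1] & [= <- <-] & H). apply in_seq in Hd.
    exists d, D1. repeat split; auto. lia.
Qed.

Lemma Full_in_chains N bs : forall q D q', Full q bs D q' -> Forall (fun g => 1 <= g) bs ->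
  (forall x, In x D -> x <= N) -> In (D, q') (chains N q bs).
Proof.
  induction bs as [|g bs IH]; simpl; intros q D q' H Hb HN.
  - destruct H as [-> ->]; auto.
  - destruct H as (d & D' & Hd & -> & H). inversion Hb; subst. apply in_flat_map. exists d. split.
    + apply in_seq. assert (d <= N); [|lia]. apply HN. rewrite seq_cons by auto. simpl; auto.
    + apply in_map_iff. exists (D', q'). split; auto. apply IH; auto.
      intros x Hx. apply HN. apply in_app_iff; auto.
Qed.

Lemma in_subs n l : forall q S, In S (subs n l q) <->
  inc q S /\ length S = l /\ (forall x, In x S -> x <= n).
Proof.
  induction l as [|l IH]; simpl; intros q S.
  - split.
    + intros [<-|[]]. simpl. tauto.
    + intros (_ & H & _). destruct S; [auto|discriminate].
  - rewrite in_flat_map. split.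
    + intros (d & Hd & H). apply in_map_iff in H. destruct H as (S' & <- & H).
      apply in_seq in Hd. apply IH in H. destruct H as (H1 & H2 & H3). simpl.
      repeat split; auto; [lia|]. intros x [<-|Hx]; [lia|auto].
    + destruct S as [|d S]; simpl; [intros (_ & H & _); discriminate|].
      intros ((H1 & H2) & H3 & H4).
      exists d. split; [apply in_seq; specialize (H4 d (or_introl eq_refl)); lia|].
      apply in_map. apply IH. repeat split; auto.
Qed.

Lemma NoDup_flat_map {A B} (f : A -> list B) l : NoDup l -> (forall x, In x l -> NoDup (f x)) ->
  (forall x y z, In x l -> In y l -> In z (f x) -> In z (f y) -> x = y) -> NoDup (flat_map f l).
Proof.
  induction 1 as [|a l Ha Hl IH]; simpl; intros Hf Hd; [constructor|].
  apply NoDup_app; auto.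
  - apply IH; auto. intros x y z Hx Hy; apply Hd; auto.
  - intros z Hz H. apply in_flat_map in H. destruct H as (y & Hy & Hzy).
    assert (a = y) by (apply (Hd a y z); auto). congruence.
Qed.

Lemma NoDup_map_inj {A B} (f : A -> B) l : NoDup l ->
  (forall x y, In x l -> In y l -> f x = f y -> x = y) -> NoDup (map f l).
Proof.
  induction 1 as [|a l Ha Hl IH]; simpl; intros Hf; constructor; auto.
  intros H. apply in_map_iff in H. destruct H as (x & E & Hx). apply Ha.
  rewrite (Hf a x); auto.
Qed.

Lemma chains_NoDup N bs : forall q, Forall (fun g => 1 <= g) bs -> NoDup (chains N q bs).
Proof.
  induction bs as [|g bs IH]; simpl; intros q Hb; [constructor; simpl; [tauto|constructor]|].
  inversion Hb; subst. apply NoDup_flat_map.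
  - apply seq_NoDup.
  - intros d Hd. apply NoDup_map_inj; auto. intros [D p] [D' p'] _ _. simpl.
    intros [= E ->]. apply app_inv_head in E. now subst.
  - intros d d' z _ _ H H'. apply in_map_iff in H, H'.
    destruct H as (p & <- & _), H' as (p' & E & _). rewrite !(seq_cons _ g) in E by auto.
    simpl in E. congruence.
Qed.

Lemma subs_NoDup n l : forall q, NoDup (subs n l q).
Proof.
  induction l as [|l IH]; simpl; intros q; [constructor; simpl; [tauto|constructor]|].
  apply NoDup_flat_map.
  - apply seq_NoDup.
  - intros d Hd. apply NoDup_map_inj; auto. congruence.
  - intros d d' z _ _ H H'. apply in_map_iff in H, H'.
    destruct H as (p & <- & _), H' as (p' & E & _). congruence.
Qed.

(** The sets of maximal size whose runs all start at or below [X]. Only the singletons range up to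
    [n], which bounds every part size of a partition of [n]. *)
Definition fulls (X n q : nat) (bs : list nat) (l : nat) : list (list nat) :=
  flat_map (fun p => map (fun S => seq 1 (q - 1) ++ fst p ++ S) (subs n l (snd p)))
           (chains X q bs).

Lemma Full_det bs : forall q D q1 q2, Full q bs D q1 -> Full q bs D q2 ->
  Forall (fun g => 1 <= g) bs -> q1 = q2.
Proof.
  induction bs as [|g bs IH]; simpl; intros q D q1 q2.
  - intros [_ ->] [_ ->]; auto.
  - intros (d & D' & _ & -> & H) (d' & D'' & _ & E & H') Hb. inversion Hb; subst.
    assert (d = d') by (rewrite !(seq_cons _ g) in E by auto; simpl in E; congruence). subst d'.
    apply app_inv_head in E. subst. eauto.
Qed.

Lemma app_inv_length {A} (a b c d : list A) : length a = length c -> a ++ b = c ++ d -> a = c /\ b = d.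
Proof.
  revert c; induction a as [|x a IH]; intros [|y c]; simpl; try discriminate; auto.
  intros [= H] [= -> E]. destruct (IH _ H E) as [-> ->]. auto.
Qed.

(** The run lengths are fixed, so the total length of the runs locates the split between runs and
    singletons. *)
Lemma fulls_NoDup X n q bs l : Forall (fun g => 1 <= g) bs -> NoDup (fulls X n q bs l).
Proof.
  intros Hb. apply NoDup_flat_map.
  - now apply chains_NoDup.
  - intros p _. apply NoDup_map_inj; [apply subs_NoDup|].
    intros x y _ _ E. apply app_inv_head in E. now apply app_inv_head in E.
  - intros [D p] [D' p'] z H H' Hz Hz'. apply in_map_iff in Hz, Hz'. simpl in *.
    destruct Hz as (S & <- & _), Hz' as (S' & E & _). apply app_inv_head in E.
    apply in_chains in H, H'. pose proof (Full_inc _ _ _ _ H). pose proof (Full_inc _ _ _ _ H').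
    apply app_inv_length in E; [|lia]. destruct E as [-> _]. f_equal. eapply Full_det; eauto.
Qed.

(** * Multiplicities *)

Fixpoint mults (D : list nat) (n : nat) : list (list nat) :=
  match D with
  | [] => if n =? 0 then [[]] else []
  | d :: D' => flat_map (fun c => map (cons c) (mults D' (n - c * d))) (seq 1 (n / d))
  end.

Lemma in_mults D : forall n m, Forall (fun d => 1 <= d) D -> (In m (mults D n) <->
  length m = length D /\ Forall (fun c => 1 <= c) m /\ W (combine D m) = n).
Proof.
  induction D as [|d D IH]; simpl; intros n m HD.
  - destruct (Nat.eqb_spec n 0).
    + split; [intros [<-|[]]; simpl; auto|]. intros (H & _). destruct m; [simpl; auto|discriminate].
    + split; [intros []|]. intros (H & _ & E). destruct m; [simpl in E; lia|discriminate].
  - inversion HD; subst. rewrite in_flat_map. split.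
    + intros (c & Hc & H). apply in_map_iff in H. destruct H as (m' & <- & H).
      apply IH in H; auto. destruct H as (I1 & I2 & I3). apply in_seq in Hc.
      assert (c * d <= n).
      { transitivity (d * (n / d)); [nia|]. apply Nat.Div0.mul_div_le. }
      simpl. repeat split; [lia| |lia]. constructor; auto; lia.
    + destruct m as [|c m]; simpl; intros (I1 & I2 & I3); [discriminate|].
      inversion I2; subst. exists c. split.
      * apply in_seq. assert (c <= (c * d + W (combine D m)) / d); [|lia].
        apply Nat.div_le_lower_bound; lia.
      * apply in_map. apply IH; auto. repeat split; auto; lia.
Qed.

Lemma mults_NoDup D : forall n, NoDup (mults D n).
Proof.
  induction D as [|d D IH]; simpl; intros n.
  - destruct (n =? 0); repeat constructor; simpl; tauto.
  - apply NoDup_flat_map; [apply seq_NoDup| |].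
    + intros c _. apply NoDup_map_inj; auto. congruence.
    + intros c c' z _ _ H H'. apply in_map_iff in H, H'.
      destruct H as (p & <- & _), H' as (p' & E & _). congruence.
Qed.

Lemma map_fst_combine (D m : list nat) : length m = length D -> map fst (combine D m) = D.
Proof. revert m; induction D; intros [|c m]; simpl; intros H; try discriminate; auto. rewrite IHD; auto. Qed.

Lemma map_snd_combine (D m : list nat) : length m = length D -> map snd (combine D m) = m.
Proof. revert m; induction D; intros [|c m]; simpl; intros H; try discriminate; auto. rewrite IHD; auto. Qed.

Definition codes (Ds : list (list nat)) (n : nat) : list (list (nat * nat)) :=
  flat_map (fun D => map (combine D) (mults D n)) Ds.

Lemma codes_NoDup Ds n : NoDup Ds -> (forall D, In D Ds -> Forall (fun d => 1 <= d) D) ->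
  NoDup (codes Ds n).
Proof.
  intros H HD. apply NoDup_flat_map; auto.
  - intros D HI. apply NoDup_map_inj; [apply mults_NoDup|]. intros x y Hx Hy E.
    apply in_mults in Hx; auto. apply in_mults in Hy; auto.
    rewrite <- (map_snd_combine D x), <- (map_snd_combine D y); try tauto. now rewrite E.
  - intros D D' z HI HI' Hz Hz'. apply in_map_iff in Hz, Hz'.
    destruct Hz as (x & <- & Hx), Hz' as (y & E & Hy).
    apply in_mults in Hx; auto. apply in_mults in Hy; auto.
    rewrite <- (map_fst_combine D x), <- (map_fst_combine D' y); try tauto. now rewrite E.
Qed.

Lemma in_codes Ds n c : (forall D, In D Ds -> Forall (fun d => 1 <= d) D) ->
  (In c (codes Ds n) <-> In (map fst c) Ds /\ Forall (fun p => 1 <= snd p) c /\ W c = n).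
Proof.
  intros HD. unfold codes. rewrite in_flat_map. split.
  - intros (D & HI & H). apply in_map_iff in H. destruct H as (m & <- & H).
    apply in_mults in H; auto. destruct H as (H1 & H2 & H3). rewrite map_fst_combine by auto.
    repeat split; auto. rewrite Forall_forall in *. intros p Hp. apply H2.
    rewrite <- (map_snd_combine D m) by auto. now apply in_map.
  - intros (H1 & H2 & H3). exists (map fst c). split; auto. apply in_map_iff. exists (map snd c).
    assert (E : combine (map fst c) (map snd c) = c).
    { clear. induction c as [|[d m] c IH]; simpl; congruence. }
    split; auto. apply in_mults; auto. rewrite E, !length_map. repeat split; auto.
    rewrite Forall_forall in *. intros x Hx. apply in_map_iff in Hx. destruct Hx as (p & <- & Hp). auto.
Qed.

Lemma inc_pos D : inc 1 D -> Forall (fun d => 1 <= d) D.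
Proof. intros H. apply Forall_forall. intros x. eapply inc_ge; eauto. Qed.

Lemma repeat_pos l : Forall (fun g => 1 <= g) (repeat 1 l).
Proof. apply Forall_forall. intros x Hx. apply repeat_spec in Hx. lia. Qed.

Lemma list_sum_repeat l : list_sum (repeat 1 l) = l.
Proof. induction l; simpl; auto. Qed.

Lemma fulls_spec X n q bs l D : 1 <= q -> Forall (fun g => 1 <= g) bs -> In D (fulls X n q bs l) ->
  inc 1 D /\ av q (bs ++ repeat 1 l) D = true /\ length D = q - 1 + list_sum bs + l.
Proof.
  intros Hq Hb H. unfold fulls in H. apply in_flat_map in H. destruct H as ([B q'] & HB & H).
  apply in_map_iff in H. destruct H as (S & <- & HS). simpl in *.
  apply in_chains in HB. apply in_subs in HS. destruct HS as (S1 & S2 & S3).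
  destruct (Full_singles l q' S S1 S2) as (q'' & HS).
  assert (HF : Full q (bs ++ repeat 1 l) (B ++ S) q'') by (apply Full_app; exists B, S, q'; auto).
  destruct (Full_inc _ _ _ _ HF) as (F1 & F2 & F3 & F4).
  split; [|split].
  - apply inc_app. repeat split; [apply inc_seq|eapply inc_weaken; [|exact F1]; lia|].
    intros x y Hx Hy. apply in_seq in Hx. apply (inc_ge _ _ _ F1) in Hy. lia.
  - rewrite av_skip by lia. eapply Full_av; eauto. apply Forall_app; split; auto. apply repeat_pos.
  - rewrite length_app, length_seq, F4, list_sum_app, list_sum_repeat. lia.
Qed.

(** If the runs end at or below [X], so do their starting points. Otherwise the last run, of length
    at least 2, reaches beyond [X], and its top two elements are a consecutive pair starting at [X]
    or later. *)
Lemma in_fulls X n q bs l D : 1 <= q -> Forall (fun g => 1 <= g) bs -> bs = [] \/ 2 <= last bs 0 ->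
  inc 1 D -> (forall x, In x D -> x <= n) -> av q (bs ++ repeat 1 l) D = true ->
  length D = q - 1 + list_sum bs + l ->
  In D (fulls X n q bs l) \/ exists pre x post, D = pre ++ x :: S x :: post /\ X <= x.
Proof.
  intros Hq Hb Hl Hi Hn Ha Hlen.
  assert (Hb' : Forall (fun g => 1 <= g) (bs ++ repeat 1 l)) by (apply Forall_app; split; auto; apply repeat_pos).
  destruct (av_full D 1 q _ Hi Hq Hb' Ha) as (D2 & q'' & -> & HF).
  { rewrite list_sum_app, list_sum_repeat. lia. }
  apply Full_app in HF. destruct HF as (B & S & q' & -> & HB & HS).
  destruct (Full_inc _ _ _ _ HB) as (B1 & B2 & B3 & B4).
  destruct (Full_inc _ _ _ _ HS) as (S1 & S2 & S3 & S4).
  assert (HIn : (forall x, In x B -> x <= X) -> In (seq 1 (q - 1) ++ B ++ S) (fulls X n q bs l)).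
  { intros HX. apply in_flat_map. exists (B, q'). split; [now apply Full_in_chains|].
    apply in_map_iff. exists S. split; auto. simpl. apply in_subs. split; [auto|split].
    - now rewrite S4, list_sum_repeat.
    - intros x Hx. apply Hn. rewrite !in_app_iff. auto. }
  destruct Hl as [->|Hl].
  - left. apply HIn. destruct HB as [-> _]. intros x [].
  - destruct (Nat.le_gt_cases q' (X + 1)) as [L|L].
    + left. apply HIn. intros x Hx. apply B2 in Hx. lia.
    + right. destruct (last_pair _ _ _ _ HB) as (D0 & -> & Hx); auto.
      { intros ->. simpl in Hl. lia. }
      exists (seq 1 (q - 1) ++ D0), (q' - 2), S. split; [|lia].
      replace (Datatypes.S (q' - 2)) with (q' - 1) by lia. now rewrite <- !app_assoc.
Qed.

(** * Crude covers for the negligible codes *)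

(** There are about [n log n] pairs of a part size and a multiplicity, so each unconstrained entry
    of a code costs one power of [n] up to a logarithm. *)
Definition pairs (n : nat) : list (nat * nat) :=
  flat_map (fun d => map (pair d) (seq 1 (n / d))) (seq 1 n).

Fixpoint lst {A} (P : list A) (j : nat) : list (list A) :=
  match j with
  | 0 => [[]]
  | S j' => lst P j' ++ flat_map (fun p => map (cons p) (lst P j')) P
  end.

Lemma flat_map_length_const {A B} (f : A -> list B) l m : (forall x, In x l -> length (f x) = m) ->
  length (flat_map f l) = length l * m.
Proof.
  induction l as [|a l IH]; simpl; intros H; auto.
  rewrite length_app, IH, H; auto.
Qed.

Lemma lst_length {A} (P : list A) j : length (lst P j) = (1 + length P) ^ j.
Proof.
  induction j as [|j IH]; simpl; auto.
  rewrite length_app, (flat_map_length_const _ _ (length (lst P j))).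
  - rewrite IH. simpl. lia.
  - intros; apply length_map.
Qed.

Lemma in_lst {A} (P : list A) j c : length c <= j -> (forall p, In p c -> In p P) -> In c (lst P j).
Proof.
  revert c; induction j as [|j IH]; intros c Hl HP; simpl.
  - destruct c; simpl in *; [auto|lia].
  - apply in_app_iff. destruct c as [|p c].
    + left. apply IH; simpl; [lia|tauto].
    + right. apply in_flat_map. exists p. split; [apply HP; simpl; auto|].
      apply in_map. apply IH; simpl in *; [lia|auto].
Qed.

Lemma in_pairs n d m : 1 <= d -> 1 <= m -> m * d <= n -> In (d, m) (pairs n).
Proof.
  intros Hd Hm H. apply in_flat_map. exists d. split; [apply in_seq; nia|].
  apply in_map, in_seq. assert (m <= n / d); [|lia]. apply Nat.div_le_lower_bound; lia.
Qed.

Lemma W_ge c p : In p c -> snd p * fst p <= W c.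
Proof.
  induction c as [|[d m] c IH]; simpl; [tauto|]. intros [<-|H]; simpl; [lia|].
  apply IH in H. lia.
Qed.

Lemma vcode_in_pairs n c p : vcode n c -> In p c -> In p (pairs n).
Proof.
  intros (H1 & H2 & H3) Hp. pose proof (W_ge _ _ Hp). rewrite Forall_forall in H2. pose proof (H2 _ Hp).
  destruct p as [d m]. simpl in *. apply in_pairs; auto; [|lia].
  apply (inc_ge _ _ _ H1), in_map_iff. exists (d, m); auto.
Qed.

(* One part size is recovered from the others, up to a number at most [sqrt n]:
   of two factors of a number at most [n], the smaller one is at most [sqrt n]. *)
Definition cov1 (n j : nat) : list (list (nat * nat)) :=
  flat_map (fun r => flat_map (fun s => [(s, (n - W r) / s) :: r; ((n - W r) / s, s) :: r])
                              (seq 1 (Nat.sqrt n)))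
           (lst (pairs n) j).

(* In [x c + (x + 1) c' = m], the value [C = c + c'] determines [x = m / C] and
   [c' = m mod C], and [C <= n / X] as soon as [x >= X]. *)
Definition cov2 (n X j : nat) : list (list (nat * nat)) :=
  flat_map (fun r => flat_map (fun i => map (fun C =>
      firstn i r ++ [((n - W r) / C, C - (n - W r) mod C); (S ((n - W r) / C), (n - W r) mod C)]
      ++ skipn i r) (seq 1 (n / X))) (seq 0 (S j)))
    (lst (pairs n) j).

Lemma cov1_length n j : length (cov1 n j) = (1 + length (pairs n)) ^ j * (2 * Nat.sqrt n).
Proof.
  unfold cov1. rewrite (flat_map_length_const _ _ (2 * Nat.sqrt n)), lst_length; auto.
  intros r _. rewrite (flat_map_length_const _ _ 2), length_seq; [lia|]. auto.
Qed.

Lemma cov2_length n X j : length (cov2 n X j) = (1 + length (pairs n)) ^ j * (S j * (n / X)).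
Proof.
  unfold cov2. rewrite (flat_map_length_const _ _ (S j * (n / X))), lst_length; auto.
  intros r _. rewrite (flat_map_length_const _ _ (n / X)), length_seq; [lia|].
  intros i _. now rewrite length_map, length_seq.
Qed.

Lemma in_cov1 n k c : 1 <= n -> vcode n c -> length c < k -> In c (cov1 n (k - 2)).
Proof.
  intros Hn Hc Hl. destruct c as [|[d m] c].
  - destruct Hc as (_ & _ & H). simpl in H. lia.
  - apply in_flat_map. exists c. split.
    + apply in_lst; [simpl in Hl; lia|]. intros p Hp. eapply vcode_in_pairs; eauto. simpl; auto.
    + destruct Hc as (H1 & H2 & H3). simpl in *. inversion H2; subst; simpl in *.
      replace (m * d + W c - W c) with (m * d) by lia.
      apply in_flat_map. set (n := m * d + W c) in *.
      assert (Nat.min m d <= Nat.sqrt n) by (apply Nat.sqrt_le_square; nia).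
      destruct (Nat.le_gt_cases m d).
      * exists m. split; [apply in_seq; lia|]. right; left. rewrite Nat.mul_comm, Nat.div_mul by lia. auto.
      * exists d. split; [apply in_seq; lia|]. left. rewrite Nat.div_mul by lia. auto.
Qed.

Lemma in_cov2 n k X c : 1 <= X -> vcode n c -> length c = k ->
  (exists pre x post, map fst c = pre ++ x :: S x :: post /\ X <= x) -> In c (cov2 n X (k - 2)).
Proof.
  intros HX Hc Hl (pre & x & post & E & Hx).
  apply map_eq_app in E. destruct E as (c1 & c2 & -> & E1 & E2).
  apply map_eq_cons in E2. destruct E2 as ([x1 m] & c3 & -> & E2 & E3). simpl in E2. subst x1.
  apply map_eq_cons in E3. destruct E3 as ([x1 m'] & c4 & -> & E3 & E4). simpl in E3. subst x1.
  rewrite length_app in Hl. simpl in Hl.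
  apply in_flat_map. exists (c1 ++ c4). split.
  - apply in_lst; [rewrite length_app; lia|]. intros p Hp. eapply vcode_in_pairs; eauto.
    rewrite in_app_iff in *. simpl. tauto.
  - apply in_flat_map. exists (length c1). split; [apply in_seq; lia|].
    apply in_map_iff. exists (m + m'). destruct Hc as (H1 & H2 & H3). rewrite W_app in H3. simpl in H3.
    apply Forall_app in H2. destruct H2 as [_ H2]. inversion H2; subst; simpl in *.
    inversion H5; subst; simpl in *.
    match goal with |- context [?M - W (c1 ++ c4)] =>
      replace (M - W (c1 ++ c4)) with ((m + m') * x + m') by (rewrite W_app; nia) end.
    rewrite firstn_app, firstn_all, Nat.sub_diag, app_nil_r, skipn_app, skipn_all, Nat.sub_diag. simpl.
    (* As [m >= 1], the number [m'] is smaller than the divisor [m + m']; so quotient and remainder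
       give back [x] and [m']. *)
    assert (Ed : ((m + m') * x + m') / (m + m') = x).
    { symmetry. apply (Nat.div_unique _ _ _ m'); lia. }
    assert (Em : ((m + m') * x + m') mod (m + m') = m').
    { symmetry. apply (Nat.mod_unique _ _ x m'); lia. }
    rewrite Ed, Em. split; [repeat (f_equal; try lia)|]. apply in_seq.
    match goal with |- context [?M / X] => assert (m + m' <= M / X) end; [|lia].
    apply Nat.div_le_lower_bound; [lia|]. nia.
Qed.

(** * Enumeration of the avoiders up to the covers *)

Lemma finite_filter {A} (P : A -> Prop) U : exists L, NoDup L /\ forall x, In x L <-> In x U /\ P x.
Proof.
  induction U as [|a U (L & H1 & H2)].
  - exists []. split; [constructor|]. simpl. tauto.
  - destruct (classic (P a)) as [Ha|Ha]; [destruct (classic (In a L)) as [Hi|Hi]|].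
    + exists L. split; auto. intros x. rewrite H2. simpl. split; [tauto|].
      intros [[<-|H] Hx]; auto. now apply H2.
    + exists (a :: L). split; [now constructor|]. intros x. simpl. rewrite H2. split; [|tauto].
      intros [<-|H]; tauto.
    + exists L. split; auto. intros x. rewrite H2. simpl. split; [tauto|].
      intros [[<-|H] Hx]; tauto.
Qed.

Lemma inc_length e D n : inc e D -> (forall x, In x D -> x <= n) -> length D <= n + 1 - e.
Proof.
  revert e; induction D as [|d D IH]; simpl; intros e H Hn; [lia|].
  destruct H as [H1 H2]. apply IH in H2; auto. specialize (Hn d (or_introl eq_refl)). lia.
Qed.

(* For [k = 1] no code is left over, while the covers would have size about [sqrt n]. *)
Theorem enumeration_bounds mu q nu bs l n X :
  rev mu = q :: nu -> 1 <= q -> inc (S q) nu -> diffs q nu = bs ++ repeat 1 l ->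
  bs = [] \/ 2 <= last bs 0 -> 1 <= n -> 1 <= X ->
  let k := q - 1 + list_sum bs + l in
  let F := codes (fulls X n q bs l) n in
  exists L, enumerates_Av mu n L /\ length F <= length L /\
    length L <= length F +
      (if k <=? 1 then 0 else length (cov1 n (k - 2)) + length (cov2 n X (k - 2))).
Proof.
  intros Hmu Hq Hnu Hbs Hlast Hn HX k F.
  assert (Hpos : Forall (fun g => 1 <= g) (bs ++ repeat 1 l)) by (rewrite <- Hbs; now apply diffs_pos).
  assert (Hb : Forall (fun g => 1 <= g) bs) by (now apply Forall_app in Hpos).
  assert (Hf : forall D, In D (fulls X n q bs l) -> Forall (fun d => 1 <= d) D).
  { intros D HD. apply inc_pos. apply (fulls_spec X n q bs l D Hq Hb HD). }
  (* Part sizes are distinct and at most [n], so a valid code has at most [n] entries and lies in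
     the finite universe [lst (pairs n) n]. *)
  destruct (finite_filter (fun c => vcode n c /\ av q (bs ++ repeat 1 l) (map fst c) = true)
             (lst (pairs n) n)) as (L0 & HN & HL0).
  assert (HL : forall c, In c L0 <-> vcode n c /\ av q (bs ++ repeat 1 l) (map fst c) = true).
  { intros c. rewrite HL0. split; [tauto|]. intros H. split; auto. destruct H as [H _].
    apply in_lst; [|intros; eapply vcode_in_pairs; eauto].
    rewrite <- (length_map fst). replace n with (n + 1 - 1) by lia. apply inc_length; [apply H|].
    intros x Hx. apply in_map_iff in Hx. destruct Hx as (p & <- & Hp).
    pose proof (W_ge _ _ Hp). destruct H as (_ & H2 & H3). rewrite Forall_forall in H2.
    specialize (H2 _ Hp). nia. }
  exists (map expand L0). rewrite length_map. split; [|split].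
  - split.
    + apply NoDup_map_inj; auto. intros x y Hx Hy. apply expand_inj with n; now apply HL.
    + intros a. rewrite in_map_iff. split.
      * intros (c & <- & Hc). apply HL in Hc. destruct Hc as [Hc Ha].
        destruct (expand_partition _ _ Hc). repeat split; auto; try apply H.
        apply (avoids_av n c mu q nu); auto. now rewrite Hbs.
      * intros (Hp & Hw & Ha). destruct (expand_surj a Hp) as (c & Hc & E). rewrite Hw in Hc.
        exists c. split; auto. apply HL. split; auto. rewrite <- Hbs. apply (avoids_av n c mu q nu); auto.
        now rewrite E.
  - apply NoDup_incl_length.
    + apply codes_NoDup; auto. now apply fulls_NoDup.
    + intros c Hc. apply in_codes in Hc; auto. destruct Hc as (H1 & H2 & H3).
      destruct (fulls_spec _ _ _ _ _ _ Hq Hb H1) as (F1 & F2 & _). apply HL. repeat split; auto.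
  - replace (if k <=? 1 then 0 else length (cov1 n (k - 2)) + length (cov2 n X (k - 2)))
      with (length (if k <=? 1 then [] else cov1 n (k - 2) ++ cov2 n X (k - 2)))
      by (destruct (k <=? 1); simpl; now rewrite ?length_app).
    rewrite <- !length_app. apply NoDup_incl_length; auto.
    intros c Hc. apply HL in Hc. destruct Hc as [Hc Ha]. rewrite in_app_iff.
    assert (length c <= k).
    { rewrite <- (length_map fst). pose proof (av_length _ 1 _ _ (proj1 Hc) Hq Hpos Ha).
      rewrite list_sum_app, list_sum_repeat in H. unfold k. lia. }
    destruct (Nat.eq_dec (length c) k) as [E|E].
    + destruct (in_fulls X n q bs l (map fst c)) as [H1|H1]; auto.
      * apply Hc.
      * intros x Hx. apply in_map_iff in Hx. destruct Hx as (p & <- & Hp).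
        pose proof (W_ge _ _ Hp). destruct Hc as (_ & H2 & H3). rewrite Forall_forall in H2.
        specialize (H2 _ Hp). nia.
      * rewrite length_map. exact E.
      * left. apply in_codes; auto. repeat split; auto; apply Hc.
      * right. destruct (Nat.leb_spec k 1) as [Hk|Hk].
        -- destruct H1 as (pre & x & post & E1 & _). rewrite <- (length_map fst), E1, length_app in E.
           simpl in E. lia.
        -- apply in_app_iff. right. apply in_cov2; auto.
    + right. destruct (Nat.leb_spec k 1) as [Hk|Hk].
      * destruct c; [|simpl in *; lia]. destruct Hc as (_ & _ & H3). simpl in H3. lia.
      * apply in_app_iff. left. apply in_cov1; auto. lia.
Qed.

Close Scope nat_scope.

(** * Sums over lists *)

Fixpoint sumL {A} (f : A -> R) (l : list A) : R :=
  match l with [] => 0 | x :: l' => f x + sumL f l' end.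

Lemma sumL_app {A} (f : A -> R) l1 l2 : sumL f (l1 ++ l2) = sumL f l1 + sumL f l2.
Proof. induction l1; simpl; lra. Qed.

Lemma sumL_ext {A} (f g : A -> R) l : (forall x, In x l -> f x = g x) -> sumL f l = sumL g l.
Proof. induction l as [|a l IH]; simpl; intros H; auto. rewrite H, IH; auto. Qed.

Lemma sumL_le {A} (f g : A -> R) l : (forall x, In x l -> f x <= g x) -> sumL f l <= sumL g l.
Proof.
  induction l as [|a l IH]; simpl; intros H; [lra|].
  pose proof (H a (or_introl eq_refl)). assert (sumL f l <= sumL g l) by auto. lra.
Qed.

Lemma sumL_scal {A} c (f : A -> R) l : sumL (fun x => c * f x) l = c * sumL f l.
Proof. induction l; simpl; lra. Qed.

Lemma sumL_plus {A} (f g : A -> R) l : sumL (fun x => f x + g x) l = sumL f l + sumL g l.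
Proof. induction l; simpl; lra. Qed.

Lemma sumL_minus {A} (f g : A -> R) l : sumL (fun x => f x - g x) l = sumL f l - sumL g l.
Proof. induction l; simpl; lra. Qed.

Lemma sumL_const {A} c (l : list A) : sumL (fun _ => c) l = INR (length l) * c.
Proof. induction l; [simpl; lra|]. cbn [sumL length]. rewrite S_INR, IHl. lra. Qed.

Lemma sumL_nonneg {A} (f : A -> R) l : (forall x, In x l -> 0 <= f x) -> 0 <= sumL f l.
Proof.
  intros H. replace 0 with (sumL (fun _ : A => 0) l) by (rewrite sumL_const; ring).
  now apply sumL_le.
Qed.

Lemma sumL_map {A B} (f : B -> R) (h : A -> B) l : sumL f (map h l) = sumL (fun x => f (h x)) l.
Proof. induction l; simpl; congruence. Qed.

Lemma sumL_flat_map {A B} (f : B -> R) (h : A -> list B) l :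
  sumL f (flat_map h l) = sumL (fun x => sumL f (h x)) l.
Proof. induction l; simpl; auto. now rewrite sumL_app, IHl. Qed.

Lemma length_flat_map_sumL {A B} (h : A -> list B) l :
  INR (length (flat_map h l)) = sumL (fun x => INR (length (h x))) l.
Proof. induction l; simpl; auto. now rewrite length_app, plus_INR, IHl. Qed.

Lemma sumL_swap {A B} (f : A -> B -> R) l1 l2 :
  sumL (fun x => sumL (f x) l2) l1 = sumL (fun y => sumL (fun x => f x y) l1) l2.
Proof.
  induction l1 as [|a l1 IH]; simpl.
  - rewrite sumL_const. ring.
  - rewrite IH, <- sumL_plus. reflexivity.
Qed.

Lemma sumL_abs_le {A} (f g : A -> R) l : (forall x, In x l -> Rabs (f x) <= g x) ->
  Rabs (sumL f l) <= sumL g l.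
Proof.
  induction l as [|a l IH]; simpl; intros H; [rewrite Rabs_R0; lra|].
  eapply Rle_trans; [apply Rabs_triang|]. apply Rplus_le_compat; auto.
Qed.

Lemma sumL_telescope (v : nat -> R) a m :
  sumL (fun i => v i - v (S i)) (seq a m) = v a - v (a + m)%nat.
Proof.
  revert a; induction m as [|m IH]; simpl; intros a; [rewrite Nat.add_0_r; ring|].
  rewrite IH. replace (S a + m)%nat with (a + S m)%nat by lia. ring.
Qed.

(** The mean value bounds for the power [S e] on the interval from [b] to [a]. *)
Lemma pow_diff a b e : 0 <= b <= a ->
  (INR e + 1) * b ^ e * (a - b) <= a ^ S e - b ^ S e <= (INR e + 1) * a ^ e * (a - b).
Proof.
  intros H. induction e as [|e IH]; [simpl; lra|].
  rewrite S_INR. change (a ^ S (S e)) with (a * a ^ S e). change (b ^ S (S e)) with (b * b ^ S e).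
  assert (Hb : 0 <= b ^ S e) by (apply pow_le; lra).
  assert (Hab : b ^ S e <= a ^ S e) by (apply pow_incr; lra).
  pose proof (pos_INR e).
  replace (a * a ^ S e - b * b ^ S e) with (a * (a ^ S e - b ^ S e) + b ^ S e * (a - b)) by ring.
  assert (He : 0 <= b ^ e) by (apply pow_le; lra).
  split.
  - assert (a * ((INR e + 1) * b ^ e * (a - b)) <= a * (a ^ S e - b ^ S e)) by (apply Rmult_le_compat_l; lra).
    assert (b * ((INR e + 1) * b ^ e * (a - b)) <= a * ((INR e + 1) * b ^ e * (a - b))).
    { apply Rmult_le_compat_r; [|lra]. repeat apply Rmult_le_pos; lra. }
    simpl (b ^ S e) in *. lra.
  - assert (a * (a ^ S e - b ^ S e) <= a * ((INR e + 1) * a ^ e * (a - b))) by (apply Rmult_le_compat_l; lra).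
    assert (b ^ S e * (a - b) <= a ^ S e * (a - b)) by (apply Rmult_le_compat_r; lra).
    simpl (a ^ S e) in *. lra.
Qed.

Lemma Rdiv_le_l x y c : 0 < c -> x <= y * c -> x / c <= y.
Proof.
  intros Hc H. apply Rmult_le_reg_r with c; auto. unfold Rdiv.
  rewrite Rmult_assoc, Rinv_l, Rmult_1_r by lra. exact H.
Qed.

Lemma Rle_div_r x y c : 0 < c -> x * c <= y -> x <= y / c.
Proof.
  intros Hc H. apply Rmult_le_reg_r with c; auto. unfold Rdiv.
  rewrite Rmult_assoc, Rinv_l, Rmult_1_r by lra. exact H.
Qed.

(* The discrete analogue of bounding a sum by the integral of [t^e dt]. *)
Lemma sum_pow_upper (y w : nat -> R) e a m :
  (forall i, (a <= i <= a + m)%nat -> 0 <= y i) ->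
  (forall i, (a <= i < a + m)%nat -> 0 <= w i /\ y i - y (S i) = w i) ->
  sumL (fun i => w i * y (S i) ^ e) (seq a m) <= y a ^ S e / (INR e + 1).
Proof.
  intros Hy Hw. pose proof (pos_INR e).
  apply Rle_trans with (sumL (fun i => y i ^ S e / (INR e + 1) - y (S i) ^ S e / (INR e + 1)) (seq a m)).
  - apply sumL_le. intros i Hi. apply in_seq in Hi. destruct (Hw i) as [W1 W2]; [lia|].
    rewrite <- W2. destruct (pow_diff (y i) (y (S i)) e) as [P _].
    { split; [apply Hy; lia|lra]. }
    unfold Rdiv. rewrite <- Rmult_minus_distr_r. apply Rle_div_r; lra.
  - rewrite (sumL_telescope (fun i => y i ^ S e / (INR e + 1))).
    assert (0 <= y (a + m)%nat ^ S e / (INR e + 1)); [|lra].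
    apply Rmult_le_pos; [apply pow_le, Hy; lia|]. left; apply Rinv_0_lt_compat; lra.
Qed.

(** The truncation [Rmax 0] keeps the primitive monotone when the points overshoot 0, so that the
    telescoped sum ends exactly at 0. *)
Lemma sum_pow_lower (y w : nat -> R) e a m :
  (forall i, (a <= i < a + m)%nat -> 0 <= y i - y (S i) <= w i) ->
  y (a + m)%nat <= 0 ->
  Rmax 0 (y a) ^ S e / (INR e + 1) <= sumL (fun i => w i * Rmax 0 (y i) ^ e) (seq a m).
Proof.
  intros Hw Hy. pose proof (pos_INR e).
  apply Rle_trans with (sumL (fun i => Rmax 0 (y i) ^ S e / (INR e + 1) - Rmax 0 (y (S i)) ^ S e / (INR e + 1)) (seq a m)).
  - rewrite (sumL_telescope (fun i => Rmax 0 (y i) ^ S e / (INR e + 1))).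
    rewrite (Rmax_left 0 (y (a + m)%nat)), pow_i by (auto; lia). lra.
  - apply sumL_le. intros i Hi. apply in_seq in Hi. specialize (Hw i ltac:(lia)).
    assert (Hz : 0 <= Rmax 0 (y (S i)) <= Rmax 0 (y i) /\ Rmax 0 (y i) - Rmax 0 (y (S i)) <= w i).
    { unfold Rmax. destruct (Rle_dec 0 (y (S i))), (Rle_dec 0 (y i)); lra. }
    destruct Hz as [Hz1 Hz2]. destruct (pow_diff _ _ e Hz1) as [_ P].
    unfold Rdiv. rewrite <- Rmult_minus_distr_r. apply Rdiv_le_l; [lra|].
    eapply Rle_trans; [exact P|].
    assert (Hz : 0 <= (INR e + 1) * Rmax 0 (y i) ^ e) by (apply Rmult_le_pos; [lra|apply pow_le; lra]). apply Rle_trans with ((INR e + 1) * Rmax 0 (y i) ^ e * w i); [now apply Rmult_le_compat_l|lra].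
Qed.

(** * Counting multiplicities for a fixed set of part sizes *)

Definition cnt (D : list nat) (n : nat) : R := INR (length (mults D n)).

Fixpoint iprod (D : list nat) : R := match D with [] => 1 | d :: D' => / INR d * iprod D' end.

Lemma iprod_app D1 D2 : iprod (D1 ++ D2) = iprod D1 * iprod D2.
Proof. induction D1; simpl; [ring|]. rewrite IHD1. ring. Qed.

Lemma inv_INR_bounds d : (1 <= d)%nat -> 0 < / INR d <= 1.
Proof.
  intros H. apply le_INR in H. simpl in H. split; [apply Rinv_0_lt_compat; lra|].
  rewrite <- Rinv_1. apply Rinv_le_contravar; lra.
Qed.

Lemma iprod_bounds D : Forall (fun d => (1 <= d)%nat) D -> 0 < iprod D <= 1.
Proof.
  induction 1 as [|d D Hd HD IH]; simpl; [lra|]. pose proof (inv_INR_bounds d Hd). nra.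
Qed.

Lemma cnt_cons d D n : cnt (d :: D) n = sumL (fun c => cnt D (n - c * d)) (seq 1 (n / d)).
Proof.
  unfold cnt. simpl. rewrite length_flat_map_sumL. apply sumL_ext. intros. now rewrite length_map.
Qed.

(** The common summation range [N] makes two such sums interchangeable, as [cnt_perm] requires. *)
Lemma cnt_cons_le d D n N : (1 <= d)%nat -> (n <= N)%nat ->
  cnt (d :: D) n = sumL (fun c => if (c * d <=? n)%nat then cnt D (n - c * d) else 0) (seq 1 N).
Proof.
  intros Hd HN. rewrite cnt_cons.
  assert (Hq : (n / d <= n)%nat) by (apply Nat.Div0.div_le_upper_bound; nia).
  replace N with (n / d + (N - n / d))%nat by lia. rewrite seq_app, sumL_app.
  rewrite (sumL_ext _ (fun _ => 0) (seq (1 + n / d) _)), sumL_const.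
  - rewrite Rmult_0_r, Rplus_0_r. apply sumL_ext. intros c Hc. apply in_seq in Hc.
    pose proof (Nat.Div0.mul_div_le n d). destruct (Nat.leb_spec (c * d) n); auto. nia.
  - intros c Hc. apply in_seq in Hc. destruct (Nat.leb_spec (c * d) n); auto.
    assert (c <= n / d)%nat; [|lia]. apply Nat.div_le_lower_bound; lia.
Qed.

(** Lets the base of the count, a consecutive pair or the part 1, be moved behind all other
    parts. *)
Lemma cnt_perm D D' : Permutation D D' -> Forall (fun d => (1 <= d)%nat) D -> forall n, cnt D n = cnt D' n.
Proof.
  induction 1 as [|d D D' HP IH|x y D|D1 D2 D3 P1 IH1 P2 IH2]; intros HD n; auto.
  - inversion HD; subst. rewrite !cnt_cons. apply sumL_ext; auto.
  - inversion HD as [|? ? Hy HD']; subst. inversion HD' as [|? ? Hx HD'']; subst.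
    assert (E : forall a b, (1 <= a)%nat -> (1 <= b)%nat -> cnt (a :: b :: D) n =
      sumL (fun c => sumL (fun c' => if (c * a + c' * b <=? n)%nat then cnt D (n - (c * a + c' * b)) else 0) (seq 1 n)) (seq 1 n)).
    { intros a b Ha Hb. rewrite (cnt_cons_le a _ n n) by lia. apply sumL_ext. intros c Hc.
      destruct (Nat.leb_spec (c * a) n).
      - rewrite (cnt_cons_le b _ _ n) by lia. apply sumL_ext. intros c' Hc'.
        replace (n - c * a - c' * b)%nat with (n - (c * a + c' * b))%nat by lia.
        destruct (Nat.leb_spec (c' * b) (n - c * a)), (Nat.leb_spec (c * a + c' * b) n); auto; lia.
      - rewrite (sumL_ext _ (fun _ => 0)); [rewrite sumL_const; ring|]. intros c' Hc'.
        destruct (Nat.leb_spec (c * a + c' * b) n); auto; lia. }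
    rewrite !E, sumL_swap by auto. apply sumL_ext. intros c _. apply sumL_ext. intros c' _.
    now rewrite Nat.add_comm.
  - rewrite IH1 by auto. apply IH2. eapply Permutation_Forall; eauto.
Qed.

Lemma cnt_one m : (1 <= m)%nat -> cnt [1%nat] m = 1.
Proof.
  intros Hm. rewrite cnt_cons, Nat.div_1_r. destruct m as [|m]; [lia|].
  rewrite seq_S, sumL_app, (sumL_ext _ (fun _ => 0) (seq 1 m)), sumL_const.
  - simpl. rewrite Nat.mul_1_r, Nat.sub_diag. unfold cnt. simpl. ring.
  - intros c Hc. apply in_seq in Hc. unfold cnt. cbn [mults].
    destruct (Nat.eqb_spec (S m - c * 1) 0); [lia|reflexivity].
Qed.

(* With [C = c + c'], the solutions of [c x + c' (x + 1) = m] in positive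
   integers correspond to the integers [C] in [[(m + 1) / (x + 1), (m - 1) / x]]. *)
Lemma cnt_pair_length x m : (1 <= x)%nat -> (1 <= m)%nat ->
  length (mults [x; S x] m) = ((m - 1) / x + 1 - (m + 1 + x) / (x + 1))%nat.
Proof.
  intros Hx Hm. set (hi := ((m - 1) / x)%nat). set (lo := ((m + 1 + x) / (x + 1))%nat).
  assert (Hhi : forall C, (C <= hi <-> C * x + 1 <= m)%nat).
  { intros C. unfold hi. split; intros H.
    - pose proof (Nat.Div0.mul_div_le (m - 1) x). nia.
    - apply Nat.div_le_lower_bound; lia. }
  assert (Hlo : forall C, (lo <= C <-> m + 1 <= C * (x + 1))%nat).
  { intros C. unfold lo. split; intros H.
    - pose proof (Nat.mul_succ_div_gt (m + 1 + x) (x + 1)). nia.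
    - apply Nat.lt_succ_r. apply Nat.Div0.div_lt_upper_bound. nia. }
  assert (Hpos : Forall (fun d => (1 <= d)%nat) [x; S x]) by (repeat constructor; lia).
  transitivity (length (map (fun C => [C - (m - C * x); m - C * x])%nat (seq lo (hi + 1 - lo))));
    [|now rewrite length_map, length_seq].
  apply Nat.le_antisymm; apply NoDup_incl_length.
  - apply mults_NoDup.
  - intros c Hc. apply in_mults in Hc; auto. destruct Hc as (H1 & H2 & H3).
    destruct c as [|c [|c' [|? ?]]]; try discriminate. simpl in H3.
    inversion H2 as [|? ? Hc H2']; subst. inversion H2' as [|? ? Hc' _]; subst.
    apply in_map_iff. exists (c + c')%nat. split; [repeat (f_equal; try nia)|].
    apply in_seq. pose proof (proj2 (Hhi (c + c')%nat)). pose proof (proj2 (Hlo (c + c')%nat)). nia.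
  - apply NoDup_map_inj; [apply seq_NoDup|]. intros C C' HC HC' E. apply in_seq in HC, HC'.
    pose proof (proj1 (Hhi C)). pose proof (proj1 (Hhi C')). injection E. nia.
  - intros c Hc. apply in_map_iff in Hc. destruct Hc as (C & <- & HC). apply in_seq in HC.
    pose proof (proj1 (Hhi C)). pose proof (proj1 (Hlo C)).
    apply in_mults; auto. split; [reflexivity|]. split; [|simpl; nia].
    repeat constructor; nia.
Qed.

(** The floor inequalities for [hi] and [lo], brought to the common denominator [x (x + 1)], combine
    to an error of 1 that is uniform in [x] and [m]. *)
Lemma cnt_pair x m : (1 <= x)%nat ->
  INR m * iprod [x; S x] - 1 <= cnt [x; S x] m <= INR m * iprod [x; S x] + 1.
Proof.
  intros Hx. assert (Hx' : 1 <= INR x) by (apply le_INR in Hx; simpl in Hx; lra).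
  destruct (Nat.eq_dec m 0) as [->|Hm].
  { rewrite cnt_cons. rewrite Nat.Div0.div_0_l. simpl. lra. }
  unfold cnt. rewrite cnt_pair_length by lia.
  set (hi := ((m - 1) / x)%nat). set (lo := ((m + 1 + x) / (x + 1))%nat).
  assert (H1 : (hi * x + 1 <= m)%nat) by (pose proof (Nat.Div0.mul_div_le (m - 1) x); unfold hi; nia).
  assert (H2 : (m <= (hi + 1) * x)%nat).
  { pose proof (Nat.mul_succ_div_gt (m - 1) x). unfold hi. nia. }
  assert (H3 : (lo * (x + 1) <= m + 1 + x)%nat) by (pose proof (Nat.Div0.mul_div_le (m + 1 + x) (x + 1)); unfold lo; nia).
  assert (H4 : (m + 1 <= lo * (x + 1))%nat).
  { pose proof (Nat.mul_succ_div_gt (m + 1 + x) (x + 1)). unfold lo. nia. }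
  assert (E : forall z : R, (z * INR x * (INR x + 1) <= INR m) <-> z <= INR m * iprod [x; S x]).
  { intros z. cbn [iprod]. rewrite S_INR, Rmult_1_r.
    assert (Ei : INR m * (/ INR x * / (INR x + 1)) * INR x * (INR x + 1) = INR m) by (field; lra).
    split; intros Hz.
    - apply Rmult_le_reg_r with (INR x * (INR x + 1)); [nra|]. rewrite <- !Rmult_assoc. lra.
    - apply (Rmult_le_compat_r (INR x * (INR x + 1))) in Hz; [|nra]. rewrite <- !Rmult_assoc in Hz. lra. }
  assert (E' : forall z : R, (INR m <= z * INR x * (INR x + 1)) <-> INR m * iprod [x; S x] <= z).
  { intros z. cbn [iprod]. rewrite S_INR, Rmult_1_r.
    assert (Ei : INR m * (/ INR x * / (INR x + 1)) * INR x * (INR x + 1) = INR m) by (field; lra).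
    split; intros Hz.
    - apply Rmult_le_reg_r with (INR x * (INR x + 1)); [nra|]. rewrite <- !Rmult_assoc. lra.
    - apply (Rmult_le_compat_r (INR x * (INR x + 1))) in Hz; [|nra]. rewrite <- !Rmult_assoc in Hz. lra. }
  apply le_INR in H1, H2, H3, H4. repeat rewrite ?plus_INR, ?mult_INR in H1; repeat rewrite ?plus_INR, ?mult_INR in H2. repeat rewrite ?plus_INR, ?mult_INR in H3; repeat rewrite ?plus_INR, ?mult_INR in H4. simpl INR in H1, H2, H3, H4.
  split.
  (* The subtraction in [nat] truncates at 0 when the interval is empty; this only helps the lower
     bound, and the upper bound treats that case apart. *)
  - assert (INR hi + 1 - INR lo <= INR (hi + 1 - lo)).
    { destruct (Nat.le_gt_cases lo (hi + 1)) as [L|L].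
      - rewrite minus_INR, plus_INR by auto. simpl. lra.
      - replace (hi + 1 - lo)%nat with 0%nat by lia. apply lt_INR in L. rewrite plus_INR in L. simpl in *. lra. }
    assert (INR m * iprod [x; S x] <= INR hi + 1 - INR lo + 1); [|lra].
    apply E'. apply (Rmult_le_compat_r (INR x + 1)) in H2; [|lra].
    apply (Rmult_le_compat_r (INR x)) in H3; [|lra]. lra.
  - destruct (Nat.le_gt_cases lo (hi + 1)) as [L|L].
    + rewrite minus_INR, plus_INR by auto. simpl INR at 2.
      assert (INR hi - INR lo <= INR m * iprod [x; S x]); [|lra]. apply E.
      apply (Rmult_le_compat_r (INR x + 1)) in H1; [|lra].
      apply (Rmult_le_compat_r (INR x)) in H4; [|lra]. lra.
    + replace (hi + 1 - lo)%nat with 0%nat by lia. simpl INR at 1.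
      assert (0 <= INR m * iprod [x; S x]); [|lra].
      apply E. pose proof (pos_INR m). lra.
Qed.

Lemma INR_pos_le n : (1 <= n)%nat -> 1 <= INR n.
Proof. intros H. apply le_INR in H. simpl in H. lra. Qed.

Lemma div_mul_le c n d : (c <= n / d)%nat -> (c * d <= n)%nat.
Proof. pose proof (Nat.Div0.mul_div_le n d). nia. Qed.

Lemma sum_multiples_upper d n e : (1 <= d)%nat ->
  sumL (fun c => INR (n - c * d) ^ e) (seq 1 (n / d)) <= / INR d * INR n ^ S e / (INR e + 1).
Proof.
  intros Hd. pose proof (INR_pos_le d Hd).
  assert (Hy : forall i, (i <= n / d)%nat -> INR n - INR i * INR d = INR (n - i * d)).
  { intros i Hi. apply div_mul_le in Hi. rewrite minus_INR, mult_INR by auto. ring. }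
  pose proof (sum_pow_upper (fun i => INR n - (INR i - 1) * INR d) (fun _ => INR d) e 1 (n / d)) as P.
  cbv beta in P. simpl (INR 1) in P. rewrite sumL_scal in P.
  replace (INR n - (1 - 1) * INR d) with (INR n) in P by ring.
  rewrite (sumL_ext _ (fun c => INR (n - c * d) ^ e)) in P.
  - apply Rmult_le_reg_l with (INR d); [lra|].
    eapply Rle_trans; [apply P|].
    + intros i Hi. replace (INR i - 1) with (INR (i - 1)) by (rewrite minus_INR by lia; simpl; ring).
      rewrite Hy by lia. apply pos_INR.
    + intros i Hi. rewrite S_INR. split; [lra|ring].
    + right. pose proof (pos_INR e). field. lra.
  - intros i Hi. apply in_seq in Hi. rewrite S_INR, <- Hy by lia. f_equal. ring.
Qed.

(** The range ends at [(n - 1) / d] to keep every remainder [n - c d] positive, since the lower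
    bounds on base counts are assumed only there: the part 1 has one solution for each positive
    number and none for 0. The shift [s] stands for the sum of the parts already included. *)
Lemma sum_multiples_lower d n e s : (1 <= d)%nat -> 0 <= s -> (1 <= n)%nat ->
  / INR d * Rmax 0 (INR n - (INR d + s)) ^ S e / (INR e + 1) <=
  sumL (fun c => Rmax 0 (INR (n - c * d) - s) ^ e) (seq 1 ((n - 1) / d)).
Proof.
  intros Hd Hs Hn. pose proof (INR_pos_le d Hd).
  pose proof (sum_pow_lower (fun i => INR n - INR i * INR d - s) (fun _ => INR d) e 1 ((n - 1) / d)) as P.
  cbv beta in P. simpl (INR 1) in P. rewrite sumL_scal in P.
  rewrite (sumL_ext _ (fun c => Rmax 0 (INR (n - c * d) - s) ^ e)) in P.
  - apply Rmult_le_reg_l with (INR d); [lra|].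
    eapply Rle_trans; [|apply P].
    + right. pose proof (pos_INR e).
      replace (INR n - 1 * INR d - s) with (INR n - (INR d + s)) by ring. field. lra.
    + intros i Hi. rewrite S_INR. lra.
    + assert (n <= (1 + (n - 1) / d) * d)%nat.
      { pose proof (Nat.mul_succ_div_gt (n - 1) d). nia. }
      apply le_INR in H0. rewrite mult_INR in H0. lra.
  - intros i Hi. apply in_seq in Hi. assert (i * d <= n - 1)%nat by (apply div_mul_le; lia).
    rewrite minus_INR, mult_INR by lia. auto.
Qed.

Lemma inv_fact_S e : / INR (fact (S e)) = / INR (fact e) / (INR e + 1).
Proof.
  rewrite fact_simpl, mult_INR, S_INR. pose proof (pos_INR e). pose proof (INR_fact_neq_0 e). field. lra.
Qed.

(** Each further part [d] integrates the main term once and divides it by [d], while the base error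
    [E] picks up a factor of at most [n / d]. No new error arises, because a sum of decreasing terms
    starting at multiplicity 1 lies below its integral. *)
Lemma cnt_extend_upper Q j A E : 0 <= A -> 0 <= E ->
  (forall m, cnt Q m <= A * / INR (fact j) * INR m ^ j + E) ->
  forall D, Forall (fun d => (1 <= d)%nat) D -> forall n,
  cnt (D ++ Q) n <= A * iprod D * / INR (fact (length D + j)) * INR n ^ (length D + j)
                    + E * iprod D * INR n ^ length D.
Proof.
  intros HA HE HQ D HD. induction HD as [|d D Hd HD IH]; intros n.
  - simpl. specialize (HQ n). lra.
  - simpl app. rewrite cnt_cons. pose proof (INR_pos_le d Hd). pose proof (iprod_bounds D HD).
    eapply Rle_trans; [apply sumL_le; intros c _; apply IH|].
    rewrite sumL_plus, !sumL_scal. simpl length. simpl iprod. rewrite Nat.add_succ_l, inv_fact_S.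
    set (e := (length D + j)%nat).
    pose proof (INR_fact_lt_0 e). pose proof (pos_INR e). pose proof (pos_INR (length D)).
    apply Rplus_le_compat.
    + apply Rle_trans with (A * iprod D * / INR (fact e) * (/ INR d * INR n ^ S e / (INR e + 1))).
      * apply Rmult_le_compat_l; [|now apply sum_multiples_upper].
        repeat apply Rmult_le_pos; try lra. left; now apply Rinv_0_lt_compat.
      * right. field. lra.
    + apply Rle_trans with (E * iprod D * (/ INR d * INR n ^ S (length D))).
      * apply Rmult_le_compat_l; [apply Rmult_le_pos; lra|].
        eapply Rle_trans; [now apply sum_multiples_upper|].
        apply Rdiv_le_l; [lra|].
        assert (0 <= / INR d * INR n ^ S (length D)); [|nra].
        apply Rmult_le_pos; [left; apply Rinv_0_lt_compat; lra|apply pow_le, pos_INR].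
      * right. ring.
Qed.

Lemma cnt_nonneg D n : 0 <= cnt D n.
Proof. apply pos_INR. Qed.

(** As all multiplicities are at least 1, [n] is in effect reduced by the sum of the added parts;
    this shift is the only loss besides the base error. *)
Lemma cnt_extend_lower Q j A E : 0 <= A -> 0 <= E ->
  (forall m, (1 <= m)%nat -> A * / INR (fact j) * INR m ^ j - E <= cnt Q m) ->
  forall D, Forall (fun d => (1 <= d)%nat) D -> forall n, (1 <= n)%nat ->
  A * iprod D * / INR (fact (length D + j)) * Rmax 0 (INR n - INR (list_sum D)) ^ (length D + j)
     - E * iprod D * INR n ^ length D <= cnt (D ++ Q) n.
Proof.
  intros HA HE HQ D HD. induction HD as [|d D Hd HD IH]; intros n Hn.
  - simpl. rewrite Rminus_0_r, Rmax_right by apply pos_INR. specialize (HQ n Hn). lra.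
  - simpl app. rewrite cnt_cons. pose proof (INR_pos_le d Hd). pose proof (iprod_bounds D HD).
    assert (Hq : ((n - 1) / d <= n / d)%nat) by (apply Nat.Div0.div_le_mono; lia).
    (* The term with [c d = n], if there is one, leaves the remainder 0 and is dropped. *)
    replace (n / d)%nat with ((n - 1) / d + (n / d - (n - 1) / d))%nat by lia.
    rewrite seq_app, sumL_app.
    match goal with |- _ <= _ + ?t => assert (0 <= t) by (apply sumL_nonneg; intros; apply cnt_nonneg) end.
    match goal with |- _ <= ?s + _ => enough (Hs : A * iprod (d :: D) * / INR (fact (length (d :: D) + j)) *
      Rmax 0 (INR n - INR (list_sum (d :: D))) ^ (length (d :: D) + j)
      - E * iprod (d :: D) * INR n ^ length (d :: D) <= s) by lra end.
    eapply Rle_trans; [|apply sumL_le; intros c Hc; apply IH].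
    2:{ apply in_seq in Hc. assert (c * d <= n - 1)%nat by (apply div_mul_le; lia). lia. }
    rewrite sumL_minus, !sumL_scal. simpl length. simpl iprod. rewrite Nat.add_succ_l, inv_fact_S.
    simpl list_sum. rewrite (plus_INR d (list_sum D)).
    set (e := (length D + j)%nat).
    pose proof (INR_fact_lt_0 e). pose proof (pos_INR e). pose proof (pos_INR (length D)).
    apply Rplus_le_compat.
    + apply Rle_trans with (A * iprod D * / INR (fact e) * (/ INR d * Rmax 0 (INR n - (INR d + INR (list_sum D))) ^ S e / (INR e + 1))).
      * right. field. lra.
      * apply Rmult_le_compat_l; [|apply sum_multiples_lower; auto; apply pos_INR].
        repeat apply Rmult_le_pos; try lra. left; now apply Rinv_0_lt_compat.
    + apply Ropp_le_contravar.
      apply Rle_trans with (E * iprod D * (/ INR d * INR n ^ S (length D))).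
      * apply Rmult_le_compat_l; [apply Rmult_le_pos; lra|].
        eapply Rle_trans; [|eapply Rle_trans; [apply (sum_multiples_upper d n (length D) Hd)|]].
        -- replace (n / d)%nat with ((n - 1) / d + (n / d - (n - 1) / d))%nat at 1 by lia.
           rewrite seq_app, sumL_app.
           match goal with |- _ <= _ + ?t => assert (0 <= t); [|lra] end.
           apply sumL_nonneg; intros; apply pow_le, pos_INR.
        -- apply Rdiv_le_l; [lra|].
           assert (0 <= / INR d * INR n ^ S (length D)); [|nra].
           apply Rmult_le_pos; [left; apply Rinv_0_lt_compat; lra|apply pow_le, pos_INR].
      * right. ring.
Qed.

(** * Harmonic sums *)

Definition harm (n : nat) : R := sumL (fun i => / INR i) (seq 1 n).

Lemma harm_S n : harm (S n) = harm n + / INR (S n).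
Proof. unfold harm. rewrite seq_S, sumL_app. cbn [sumL Nat.add]. ring. Qed.

Lemma harm_le m n : (m <= n)%nat -> harm m <= harm n.
Proof.
  induction 1 as [|n _ IH]; [lra|]. rewrite harm_S. pose proof (inv_INR_bounds (S n) ltac:(lia)). lra.
Qed.

Lemma harm_ge_1 n : (1 <= n)%nat -> 1 <= harm n.
Proof. intros Hn. pose proof (harm_le 1 n Hn) as P. unfold harm at 1 in P. simpl in P. lra. Qed.

Lemma harm_nonneg n : 0 <= harm n.
Proof. pose proof (harm_le 0 n (Nat.le_0_l n)) as P. unfold harm at 1 in P. simpl in P. lra. Qed.

Lemma ln_le_sub_1 y : 0 < y -> ln y <= y - 1.
Proof. intros Hy. pose proof (exp_ineq1_le (ln y)) as P. rewrite exp_ln in P by auto. lra. Qed.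

Lemma ln_step n : (1 <= n)%nat -> / INR (S n) <= ln (INR (S n)) - ln (INR n) <= / INR n.
Proof.
  intros Hn. apply INR_pos_le in Hn. rewrite S_INR. split.
  - pose proof (ln_le_sub_1 (INR n / (INR n + 1))) as P. unfold Rdiv in P.
    rewrite ln_mult, ln_Rinv in P; try lra; [|apply Rinv_0_lt_compat; lra].
    replace (INR n * / (INR n + 1) - 1) with (- / (INR n + 1)) in P by (field; lra).
    assert (0 < INR n * / (INR n + 1)) by (apply Rmult_lt_0_compat; [lra|apply Rinv_0_lt_compat; lra]).
    lra.
  - pose proof (ln_le_sub_1 ((INR n + 1) / INR n)) as P. unfold Rdiv in P.
    rewrite ln_mult, ln_Rinv in P; try lra; [|apply Rinv_0_lt_compat; lra].
    replace ((INR n + 1) * / INR n - 1) with (/ INR n) in P by (field; lra).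
    assert (0 < (INR n + 1) * / INR n) by (apply Rmult_lt_0_compat; [lra|apply Rinv_0_lt_compat; lra]).
    lra.
Qed.

Lemma harm_ln n : (1 <= n)%nat -> ln (INR n) <= harm n <= 1 + ln (INR n).
Proof.
  intros Hn.
  enough (ln (INR (S n)) <= harm n <= 1 + ln (INR n)).
  { pose proof (ln_step n Hn). pose proof (inv_INR_bounds (S n) ltac:(lia)). lra. }
  induction Hn as [|n Hn IH].
  - unfold harm. simpl. rewrite ln_1. pose proof (ln_le_sub_1 (1 + 1)). lra.
  - rewrite harm_S. pose proof (ln_step n Hn). pose proof (ln_step (S n) ltac:(lia)). lra.
Qed.

(** A crude trade of a logarithm for a square root, which can still be summed against the weight of
    a run of length at least 2. *)
Lemma harm_sqrt n : (1 <= n)%nat -> harm n <= 2 * sqrt (INR n).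
Proof.
  intros Hn. pose proof (harm_ln n Hn) as H0. apply INR_pos_le in Hn.
  assert (Hs : 0 < sqrt (INR n)) by (apply sqrt_lt_R0; lra).
  pose proof (ln_le_sub_1 _ Hs).
  rewrite <- (sqrt_sqrt (INR n)) in H0 at 2 by lra. rewrite ln_mult in H0 by auto. lra.
Qed.

Lemma sum_inv_harm q m : (1 <= q)%nat -> sumL (fun d => / INR d) (seq q m) <= harm (q + m - 1).
Proof.
  intros Hq. unfold harm. replace (q + m - 1)%nat with ((q - 1) + m)%nat by lia.
  rewrite seq_app, sumL_app. replace (1 + (q - 1))%nat with q by lia.
  assert (0 <= sumL (fun i => / INR i) (seq 1 (q - 1))); [|lra].
  apply sumL_nonneg. intros x Hx. apply in_seq in Hx. pose proof (inv_INR_bounds x ltac:(lia)). lra.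
Qed.

Lemma sum_inv_harm' q N : (1 <= q)%nat -> sumL (fun d => / INR d) (seq q (N + 1 - q)) <= harm N.
Proof.
  intros Hq. destruct (Nat.le_gt_cases q (N + 1)) as [L|L].
  - eapply Rle_trans; [apply sum_inv_harm; auto|]. right. f_equal. lia.
  - replace (N + 1 - q)%nat with 0%nat by lia. simpl. apply harm_nonneg.
Qed.

(** * The sum over the lower blocks *)

Definition Bs (N q : nat) (bs : list nat) (f : nat -> R) : R :=
  sumL (fun p => iprod (fst p) * f (snd p)) (chains N q bs).

Lemma Bs_nil N q f : Bs N q [] f = f q.
Proof. unfold Bs. simpl. ring. Qed.

Lemma Bs_cons N q g bs f : Bs N q (g :: bs) f =
  sumL (fun d => iprod (seq d g) * Bs N (d + g) bs f) (seq q (N + 1 - q)).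
Proof.
  unfold Bs. simpl. rewrite sumL_flat_map. apply sumL_ext. intros d _.
  rewrite sumL_map, <- sumL_scal. apply sumL_ext. intros p _. simpl. rewrite iprod_app. ring.
Qed.

(* Summing [1 / prod] over all runs of lengths [bs] placed at or above [q]
   telescopes to [kK bs * iprod (seq q (ks bs))], provided [valid bs]. *)
Fixpoint ks (bs : list nat) : nat := match bs with [] => 0 | g :: bs' => g + ks bs' - 1 end.

Fixpoint kK (bs : list nat) : R := match bs with [] => 1 | g :: bs' => kK bs' / INR (ks bs) end.

Fixpoint valid (bs : list nat) : Prop :=
  match bs with [] => True | g :: bs' => (1 <= g)%nat /\ (2 <= g + ks bs')%nat /\ valid bs' end.

Lemma kK_bounds bs : valid bs -> 0 < kK bs <= 1.
Proof.
  induction bs as [|g bs IH]; intros Hv; [simpl; lra|].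
  destruct Hv as (V1 & V2 & V3). specialize (IH V3). cbn [kK].
  assert (H0 : (1 <= ks (g :: bs))%nat) by (simpl; lia).
  pose proof (inv_INR_bounds _ H0). unfold Rdiv. split; [apply Rmult_lt_0_compat; lra|].
  rewrite <- (Rmult_1_r 1). apply Rmult_le_compat; lra.
Qed.

(** A partial fraction identity: the reciprocal of [d (d + 1) ... (d + s)] is a difference of two
    neighbouring shorter products divided by [s], so sums over the starting point of a run
    collapse. *)
Lemma iprod_telescope d s : (1 <= d)%nat -> (1 <= s)%nat ->
  iprod (seq d (S s)) = (iprod (seq d s) - iprod (seq (S d) s)) / INR s.
Proof.
  intros Hd Hs. destruct s as [|s]; [lia|].
  change (seq d (S (S s))) with (d :: seq (S d) (S s)).
  rewrite (seq_S s (S d)). change (seq d (S s)) with (d :: seq (S d) s).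
  cbn [iprod]. rewrite iprod_app. cbn [iprod]. rewrite plus_INR, !S_INR.
  apply INR_pos_le in Hd. pose proof (pos_INR s). field. lra.
Qed.

Lemma seq_pos q m : (1 <= q)%nat -> Forall (fun d => (1 <= d)%nat) (seq q m).
Proof. intros Hq. apply Forall_forall. intros x Hx. apply in_seq in Hx. lia. Qed.

Lemma iprod_seq_le q s : (1 <= q)%nat -> (1 <= s)%nat -> iprod (seq q s) <= / INR q.
Proof.
  intros Hq Hs. destruct s as [|s]; [lia|]. simpl.
  pose proof (iprod_bounds (seq (S q) s) (seq_pos (S q) s ltac:(lia))).
  pose proof (inv_INR_bounds q Hq). nra.
Qed.

(** A run at [d] and the telescoped rest at [d + g] join into one run of length [g + s], and summing
    over [d] shortens it by one. Hence the [- 1] for each run in [ks]. *)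
Lemma block_sum q m g s : (1 <= q)%nat -> (1 <= g)%nat -> (2 <= g + s)%nat ->
  sumL (fun d => iprod (seq d g) * iprod (seq (d + g) s)) (seq q m) =
  (iprod (seq q (g + s - 1)) - iprod (seq (q + m) (g + s - 1))) / INR (g + s - 1).
Proof.
  intros Hq Hg Hgs. unfold Rdiv. rewrite Rmult_comm, <- (sumL_telescope (fun d => iprod (seq d (g + s - 1)))), <- sumL_scal.
  apply sumL_ext. intros d Hd. apply in_seq in Hd. rewrite <- iprod_app, <- seq_app.
  replace (g + s)%nat with (S (g + s - 1)) at 1 by lia. rewrite iprod_telescope by lia.
  unfold Rdiv. ring.
Qed.

Lemma iprod_seq_pos q s : (1 <= q)%nat -> 0 < iprod (seq q s) <= 1.
Proof. intros Hq. now apply iprod_bounds, seq_pos. Qed.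

Lemma Bs_upper N bs : valid bs -> forall q, (1 <= q)%nat ->
  Bs N q bs (fun _ => 1) <= kK bs * iprod (seq q (ks bs)).
Proof.
  induction bs as [|g bs IH]; intros Hv q Hq; [rewrite Bs_nil; simpl; lra|].
  pose proof Hv as Hv0. destruct Hv as (V1 & V2 & V3). rewrite Bs_cons.
  apply Rle_trans with (sumL (fun d => kK bs * (iprod (seq d g) * iprod (seq (d + g) (ks bs)))) (seq q (N + 1 - q))).
  - apply sumL_le. intros d Hd. apply in_seq in Hd. specialize (IH V3 (d + g)%nat ltac:(lia)).
    pose proof (iprod_seq_pos d g ltac:(lia)).
    apply Rle_trans with (iprod (seq d g) * (kK bs * iprod (seq (d + g) (ks bs)))); [apply Rmult_le_compat_l; lra|lra].
  - rewrite sumL_scal, block_sum by auto. cbn [kK]. change (ks (g :: bs)) with (g + ks bs - 1)%nat.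
    pose proof (iprod_seq_pos (q + (N + 1 - q)) (g + ks bs - 1) ltac:(lia)).
    pose proof (kK_bounds bs V3). pose proof (inv_INR_bounds (g + ks bs - 1) ltac:(lia)).
    unfold Rdiv. rewrite Rmult_assoc. apply Rmult_le_compat_l; [lra|].
    rewrite (Rmult_comm (/ _)). apply Rmult_le_compat_r; lra.
Qed.

(** Stopping a run at [N] loses the boundary term of the telescoping, at most [1 / (N + 1)];
    carrying this loss through the sum over each lower run costs a factor [1 + harm N]. *)
Lemma Bs_lower N bs : valid bs -> forall q, (1 <= q)%nat ->
  kK bs * iprod (seq q (ks bs)) - INR (length bs) * (1 + harm N) ^ length bs / INR (N + 1)
  <= Bs N q bs (fun _ => 1).
Proof.
  induction bs as [|g bs IH]; intros Hv q Hq; [rewrite Bs_nil; simpl; lra|].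
  pose proof Hv as Hv0. destruct Hv as (V1 & V2 & V3). rewrite Bs_cons.
  pose proof (harm_nonneg N) as HH. pose proof (inv_INR_bounds (N + 1) ltac:(lia)) as HN.
  set (t := length bs) in *. set (err := INR t * (1 + harm N) ^ t / INR (N + 1)) in *.
  assert (Ht : 1 <= (1 + harm N) ^ t) by (apply pow_R1_Rle; lra).
  assert (Herr : 0 <= err).
  { unfold err, Rdiv. pose proof (pos_INR t). repeat apply Rmult_le_pos; lra. }
  apply Rle_trans with (sumL (fun d => kK bs * (iprod (seq d g) * iprod (seq (d + g) (ks bs))) - err * / INR d) (seq q (N + 1 - q))).
  - rewrite sumL_minus, !sumL_scal, block_sum by auto.
    pose proof (sum_inv_harm' q N Hq) as HS.
    cbn [kK length]. change (ks (g :: bs)) with (g + ks bs - 1)%nat.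
    set (s := (g + ks bs - 1)%nat) in *. fold t. rewrite S_INR. simpl pow.
    assert (Hs : iprod (seq (q + (N + 1 - q)) s) <= / INR (N + 1)).
    { eapply Rle_trans; [apply iprod_seq_le; unfold s; lia|].
      apply Rinv_le_contravar; [apply lt_0_INR; lia|apply le_INR; lia]. }
    pose proof (kK_bounds bs V3) as Hk. pose proof (inv_INR_bounds s ltac:(unfold s; lia)) as His.
    assert (Hc : kK bs * / INR s * iprod (seq (q + (N + 1 - q)) s) <= / INR (N + 1)).
    { rewrite <- (Rmult_1_l (/ INR (N + 1))).
      assert (kK bs * / INR s <= 1) by (rewrite <- (Rmult_1_r 1); apply Rmult_le_compat; lra).
      apply Rmult_le_compat; auto.
      - apply Rmult_le_pos; lra.
      - pose proof (iprod_seq_pos (q + (N + 1 - q)) s ltac:(lia)). lra. }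
    assert (Hd : err * sumL (fun d => / INR d) (seq q (N + 1 - q)) <= err * harm N) by (apply Rmult_le_compat_l; auto).
    assert (He : (INR t + 1) * ((1 + harm N) * (1 + harm N) ^ t) / INR (N + 1) = err * (1 + harm N) + (1 + harm N) ^ t * (1 + harm N) * / INR (N + 1)).
    { unfold err, Rdiv. ring. }
    assert (Ht1 : 1 <= (1 + harm N) ^ t * (1 + harm N)) by nra.
    assert (/ INR (N + 1) <= (1 + harm N) ^ t * (1 + harm N) * / INR (N + 1)).
    { rewrite <- (Rmult_1_l (/ INR (N + 1))) at 1. apply Rmult_le_compat_r; lra. }
    rewrite He. unfold Rdiv in *. lra.
  - apply sumL_le. intros d Hd. apply in_seq in Hd. specialize (IH V3 (d + g)%nat ltac:(lia)).
    fold err in IH.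
    pose proof (iprod_seq_pos d g ltac:(lia)). pose proof (iprod_seq_le d g ltac:(lia) V1).
    apply Rle_trans with (iprod (seq d g) * (kK bs * iprod (seq (d + g) (ks bs)) - err)); [nra|].
    apply Rmult_le_compat_l; lra.
Qed.

(** Telescoping against [6 / sqrt d]. With [a] and [b] the square roots of [d] and [d + 1], the
    bound [b <= 2 a] gives [b (a + b) <= 6 a^2], whence the constant. *)
Lemma sum_inv_three_halves q m : (1 <= q)%nat ->
  sumL (fun d => / INR d * / sqrt (INR d)) (seq q m) <= 6 * / sqrt (INR q).
Proof.
  intros Hq.
  apply Rle_trans with (sumL (fun d => 6 * / sqrt (INR d) - 6 * / sqrt (INR (S d))) (seq q m)).
  - apply sumL_le. intros d Hd. apply in_seq in Hd. pose proof (INR_pos_le d ltac:(lia)) as Hd1.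
    rewrite S_INR. set (a := sqrt (INR d)). set (b := sqrt (INR d + 1)).
    assert (Ha : 1 <= a) by (rewrite <- sqrt_1; apply sqrt_le_1_alt; lra).
    assert (Ea : a * a = INR d) by (apply sqrt_sqrt; lra).
    assert (Eb : b * b = INR d + 1) by (apply sqrt_sqrt; lra).
    assert (Hb : 0 <= b) by apply sqrt_pos.
    assert (Hab : a <= b) by (apply sqrt_le_1_alt; lra).
    assert (Hb2 : b <= 2 * a) by nra.
    rewrite <- Ea. replace (/ (a * a) * / a) with (/ (a * a * a)) by (field; lra).
    replace (6 * / a - 6 * / b) with (6 * / (a * b * (a + b))).
    + apply Rmult_le_reg_r with (a * a * a * (a * b * (a + b))); [repeat apply Rmult_lt_0_compat; lra|].
      replace (/ (a * a * a) * (a * a * a * (a * b * (a + b)))) with (a * (b * (a + b))) by (field; lra).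
      replace (6 * / (a * b * (a + b)) * (a * a * a * (a * b * (a + b)))) with (a * (6 * (a * a))) by (field; lra).
      apply Rmult_le_compat_l; nra.
    + replace (6 * / a - 6 * / b) with (6 * (b * b - a * a) * / (a * b * (a + b))) by (field; lra).
      rewrite Ea, Eb. field. lra.
  - rewrite (sumL_telescope (fun d => 6 * / sqrt (INR d))).
    assert (0 < / sqrt (INR (q + m))); [|lra].
    apply Rinv_0_lt_compat, sqrt_lt_R0, lt_0_INR. lia.
Qed.

(** By [valid] the last run has length at least 2, so its weight is at most [1 / d^2] and the sum of
    [sqrt q'] converges uniformly in [N]. Each lower run has weight at most [1 / d] and reproduces a
    bound of the form [C / sqrt q]. *)
Lemma Bs_sqrt bs : valid bs -> bs <> [] -> exists C, 0 <= C /\ forall N q, (1 <= q)%nat ->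
  Bs N q bs (fun q' => sqrt (INR q')) <= C * / sqrt (INR q).
Proof.
  induction bs as [|g bs IH]; [tauto|]. intros (V1 & V2 & V3) _. destruct bs as [|g' bs].
  - simpl in V2. exists (6 * sqrt (1 + INR g)). split; [pose proof (sqrt_pos (1 + INR g)); lra|].
    intros N q Hq. rewrite Bs_cons.
    apply Rle_trans with (sumL (fun d => sqrt (1 + INR g) * (/ INR d * / sqrt (INR d))) (seq q (N + 1 - q))).
    + apply sumL_le. intros d Hd. apply in_seq in Hd. rewrite Bs_nil.
      pose proof (INR_pos_le d ltac:(lia)) as Hd1. pose proof (pos_INR g) as Hg.
      destruct g as [|[|g]]; try lia. set (G := S (S g)) in *.
      assert (Hi : iprod (seq d G) <= / INR d * / INR d).
      { unfold G. cbn [seq iprod]. pose proof (iprod_seq_pos (S (S d)) g ltac:(lia)).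
        pose proof (inv_INR_bounds (S d) ltac:(lia)). pose proof (inv_INR_bounds d ltac:(lia)).
        assert (/ INR (S d) <= / INR d) by (apply Rinv_le_contravar; [lra|apply le_INR; lia]).
        apply Rmult_le_compat_l; [lra|]. rewrite <- (Rmult_1_r (/ INR d)). apply Rmult_le_compat; lra. }
      assert (Hs : sqrt (INR (d + G)) <= sqrt (1 + INR G) * sqrt (INR d)).
      { rewrite <- sqrt_mult by lra. apply sqrt_le_1_alt. rewrite plus_INR. nra. }
      assert (0 < sqrt (INR d)) by (apply sqrt_lt_R0; lra).
      apply Rle_trans with (/ INR d * / INR d * (sqrt (1 + INR G) * sqrt (INR d))).
      * pose proof (iprod_seq_pos d G ltac:(lia)). apply Rmult_le_compat; try lra. apply sqrt_pos.
      * right. rewrite <- (sqrt_sqrt (INR d)) at 2 by lra. field. lra.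
    + rewrite sumL_scal. pose proof (sum_inv_three_halves q (N + 1 - q) Hq). pose proof (sqrt_pos (1 + INR g)). nra.
  - destruct (IH V3 ltac:(discriminate)) as (C & HC & HB). exists (6 * C). split; [lra|].
    intros N q Hq. rewrite Bs_cons.
    apply Rle_trans with (sumL (fun d => C * (/ INR d * / sqrt (INR d))) (seq q (N + 1 - q))).
    + apply sumL_le. intros d Hd. apply in_seq in Hd. specialize (HB N (d + g)%nat ltac:(lia)).
      pose proof (INR_pos_le d ltac:(lia)) as Hd1.
      pose proof (iprod_seq_pos d g ltac:(lia)). pose proof (iprod_seq_le d g ltac:(lia) V1).
      assert (Hss : 0 < sqrt (INR d)) by (apply sqrt_lt_R0; lra).
      assert (/ sqrt (INR (d + g)) <= / sqrt (INR d)).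
      { apply Rinv_le_contravar; auto. apply sqrt_le_1_alt, le_INR. lia. }
      apply Rinv_0_lt_compat in Hss.
      apply Rle_trans with (iprod (seq d g) * (C * / sqrt (INR d))).
      * apply Rmult_le_compat_l; [lra|]. eapply Rle_trans; [exact HB|]. apply Rmult_le_compat_l; lra.
      * assert (0 <= C * / sqrt (INR d)) by (apply Rmult_le_pos; lra). nra.
    + rewrite sumL_scal. pose proof (sum_inv_three_halves q (N + 1 - q) Hq). nra.
Qed.

(** The weight [1 / d^2] of the last run cancels the square and leaves a bounded term for each
    starting point up to [N]. The square compensates for the product of the base pair, which is
    missing from the propagated base error. *)
Lemma Bs_sqr bs : valid bs -> bs <> [] -> exists C, 0 <= C /\ forall N q, (1 <= N)%nat -> (1 <= q)%nat ->
  Bs N q bs (fun q' => INR q' ^ 2) <= C * INR N * (1 + harm N) ^ length bs.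
Proof.
  induction bs as [|g bs IH]; [tauto|]. intros (V1 & V2 & V3) _. destruct bs as [|g' bs].
  - simpl in V2. exists ((1 + INR g) ^ 2). split; [apply pow_le; pose proof (pos_INR g); lra|].
    intros N q HN Hq. rewrite Bs_cons. pose proof (pos_INR g) as Hg.
    apply Rle_trans with (sumL (fun d => (1 + INR g) ^ 2) (seq q (N + 1 - q))).
    + apply sumL_le. intros d Hd. apply in_seq in Hd. rewrite Bs_nil.
      pose proof (INR_pos_le d ltac:(lia)) as Hd1. 
      destruct g as [|[|g]]; try lia. set (G := S (S g)) in *.
      assert (Hi : iprod (seq d G) <= / INR d * / INR d).
      { unfold G. cbn [seq iprod]. pose proof (iprod_seq_pos (S (S d)) g ltac:(lia)).
        pose proof (inv_INR_bounds (S d) ltac:(lia)). pose proof (inv_INR_bounds d ltac:(lia)).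
        assert (/ INR (S d) <= / INR d) by (apply Rinv_le_contravar; [lra|apply le_INR; lia]).
        apply Rmult_le_compat_l; [lra|]. rewrite <- (Rmult_1_r (/ INR d)). apply Rmult_le_compat; lra. }
      assert (Hs : INR (d + G) <= (1 + INR G) * INR d) by (rewrite plus_INR; nra).
      apply Rle_trans with (/ INR d * / INR d * ((1 + INR G) * INR d) ^ 2).
      * pose proof (iprod_seq_pos d G ltac:(lia)). apply Rmult_le_compat; try lra.
        -- apply pow_le, pos_INR.
        -- apply pow_incr. split; [apply pos_INR|auto].
      * right. field. lra.
    + rewrite sumL_const, length_seq. pose proof (harm_nonneg N). simpl length. rewrite pow_1.
      assert (INR (N + 1 - q) <= INR N) by (apply le_INR; lia).
      assert (0 <= (1 + INR g) ^ 2) by (apply pow_le; lra).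
      pose proof (pos_INR N).
      assert (INR (N + 1 - q) * (1 + INR g) ^ 2 <= INR N * (1 + INR g) ^ 2) by (apply Rmult_le_compat_r; lra).
      assert (0 <= INR N * (1 + INR g) ^ 2 * harm N) by (apply Rmult_le_pos; [apply Rmult_le_pos|]; lra).
      lra.
  - destruct (IH V3 ltac:(discriminate)) as (C & HC & HB). exists C. split; [lra|].
    intros N q HN Hq. rewrite Bs_cons. set (t := length (g' :: bs)) in *. change (length (g :: g' :: bs)) with (S t).
    pose proof (harm_nonneg N). pose proof (pos_INR N).
    set (Y := C * INR N * (1 + harm N) ^ t) in *.
    assert (0 <= Y) by (unfold Y; apply Rmult_le_pos; [now apply Rmult_le_pos|apply pow_le; lra]).
    apply Rle_trans with (sumL (fun d => Y * / INR d) (seq q (N + 1 - q))).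
    + apply sumL_le. intros d Hd. apply in_seq in Hd. specialize (HB N (d + g)%nat HN ltac:(lia)). fold Y in HB.
      pose proof (iprod_seq_pos d g ltac:(lia)). pose proof (iprod_seq_le d g ltac:(lia) V1).
      apply Rle_trans with (iprod (seq d g) * Y); [apply Rmult_le_compat_l; lra|].
      rewrite Rmult_comm. apply Rmult_le_compat_l; lra.
    + rewrite sumL_scal. pose proof (sum_inv_harm' q N Hq).
      replace (C * INR N * (1 + harm N) ^ S t) with (Y * (1 + harm N)) by (unfold Y; simpl; ring).
      apply Rmult_le_compat_l; lra.
Qed.

(** * The sum over the upper singletons *)

(** The elementary symmetric function of degree [l] in the reciprocals of [q, ..., n]. *)
Definition Ss (n l q : nat) : R := sumL iprod (subs n l q).

Lemma Ss_S n l q : Ss n (S l) q = sumL (fun d => / INR d * Ss n l (S d)) (seq q (n + 1 - q)).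
Proof.
  unfold Ss. simpl. rewrite sumL_flat_map. apply sumL_ext. intros d _.
  rewrite sumL_map, <- sumL_scal. reflexivity.
Qed.

Lemma harm_pred d : (1 <= d)%nat -> harm d = harm (d - 1) + / INR d.
Proof. intros Hd. destruct d; [lia|]. rewrite harm_S. simpl (S d - 1)%nat. now rewrite Nat.sub_0_r. Qed.

(** An iterated integral with [harm] as the variable of integration, whose increments are the
    weights [1 / d]; this yields the factor [1 / l!]. *)
Lemma Ss_upper_aux n l : forall q, (1 <= q <= n + 1)%nat ->
  Ss n l q <= (harm n - harm (q - 1)) ^ l * / INR (fact l).
Proof.
  induction l as [|l IH]; intros q Hq; [unfold Ss; simpl; lra|].
  rewrite Ss_S, inv_fact_S. pose proof (INR_fact_lt_0 l) as Hf. apply Rinv_0_lt_compat in Hf.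
  apply Rle_trans with (sumL (fun d => / INR (fact l) * (/ INR d * (harm n - harm (S d - 1)) ^ l)) (seq q (n + 1 - q))).
  - apply sumL_le. intros d Hd. apply in_seq in Hd. specialize (IH (S d) ltac:(lia)).
    pose proof (inv_INR_bounds d ltac:(lia)).
    apply Rle_trans with (/ INR d * ((harm n - harm (S d - 1)) ^ l * / INR (fact l))); [apply Rmult_le_compat_l; lra|lra].
  - rewrite sumL_scal.
    pose proof (sum_pow_upper (fun i => harm n - harm (i - 1)) (fun d => / INR d) l q (n + 1 - q)) as P. cbv beta in P.
    assert (P' := P ltac:(intros i Hi; pose proof (harm_le (i - 1) n ltac:(lia)); lra)).
    assert (P'' := P' ltac:(intros i Hi; pose proof (inv_INR_bounds i ltac:(lia)); pose proof (harm_pred i ltac:(lia));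
      replace (S i - 1)%nat with i by lia; lra)). clear P P'.
    apply Rle_trans with (/ INR (fact l) * ((harm n - harm (q - 1)) ^ S l / (INR l + 1))); [apply Rmult_le_compat_l; lra|].
    right. unfold Rdiv. ring.
Qed.

Lemma Ss_upper n l q : (1 <= q)%nat -> Ss n l q <= harm n ^ l * / INR (fact l).
Proof.
  intros Hq. pose proof (harm_nonneg n) as Hn. pose proof (INR_fact_lt_0 l) as Hf. apply Rinv_0_lt_compat in Hf.
  destruct (Nat.le_gt_cases q (n + 1)) as [L|L].
  - eapply Rle_trans; [apply Ss_upper_aux; lia|]. apply Rmult_le_compat_r; [lra|].
    pose proof (harm_le (q - 1) n ltac:(lia)). pose proof (harm_nonneg (q - 1)). apply pow_incr. lra.
  - destruct l as [|l]; [unfold Ss; simpl; lra|]. rewrite Ss_S. replace (n + 1 - q)%nat with 0%nat by lia.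
    simpl sumL. apply Rmult_le_pos; [apply pow_le; lra|lra].
Qed.

(** Distinctness makes the next sum start at [d + 1] instead of [d]. Each of the [l] steps thus
    loses at most [1 / d <= 1] of the range of [harm], and [INR l] collects these losses. *)
Lemma Ss_lower_aux n l : forall q, (1 <= q)%nat ->
  Rmax 0 (harm n - harm (q - 1) - INR l) ^ l * / INR (fact l) <= Ss n l q.
Proof.
  induction l as [|l IH]; intros q Hq; [unfold Ss; simpl; lra|].
  rewrite Ss_S, inv_fact_S. pose proof (INR_fact_lt_0 l) as Hf. apply Rinv_0_lt_compat in Hf.
  apply Rle_trans with (sumL (fun d => / INR (fact l) * (/ INR d * Rmax 0 (harm n - harm (d - 1) - INR (S l)) ^ l)) (seq q (n + 1 - q))).
  - rewrite sumL_scal.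
    pose proof (sum_pow_lower (fun i => harm n - harm (i - 1) - INR (S l)) (fun d => / INR d) l q (n + 1 - q)) as P. cbv beta in P.
    assert (P' := P ltac:(intros i Hi; pose proof (inv_INR_bounds i ltac:(lia)); pose proof (harm_pred i ltac:(lia));
      replace (S i - 1)%nat with i by lia; lra)).
    assert (P'' := P' ltac:(pose proof (harm_le n (q + (n + 1 - q) - 1) ltac:(lia)); pose proof (pos_INR (S l)); lra)). clear P P'.
    apply Rle_trans with (/ INR (fact l) * (Rmax 0 (harm n - harm (q - 1) - INR (S l)) ^ S l / (INR l + 1))); [|apply Rmult_le_compat_l; lra].
    right. unfold Rdiv. ring.
  - apply sumL_le. intros d Hd. apply in_seq in Hd. specialize (IH (S d) ltac:(lia)).
    pose proof (inv_INR_bounds d ltac:(lia)). replace (S d - 1)%nat with d in IH by lia.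
    pose proof (harm_pred d ltac:(lia)).
    assert (Rmax 0 (harm n - harm (d - 1) - INR (S l)) ^ l <= Rmax 0 (harm n - harm d - INR l) ^ l).
    { apply pow_incr. split; [apply Rmax_l|]. apply Rle_max_compat_l. rewrite S_INR. lra. }
    apply Rle_trans with (/ INR d * (Rmax 0 (harm n - harm d - INR l) ^ l * / INR (fact l))); [|apply Rmult_le_compat_l; lra].
    replace (/ INR (fact l) * (/ INR d * Rmax 0 (harm n - harm (d - 1) - INR (S l)) ^ l))
      with (/ INR d * (Rmax 0 (harm n - harm (d - 1) - INR (S l)) ^ l * / INR (fact l))) by ring.
    apply Rmult_le_compat_l; [lra|]. apply Rmult_le_compat_r; lra.
Qed.

(** Bernoulli's inequality, also valid for [s > x], where the left side is nonpositive for [e >= 1].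
    Writing [x ^ e / x] for the power [e - 1] avoids a truncated exponent at [e = 0], where the
    factor [INR e] removes the term. *)
Lemma Rmax_bernoulli x s e : 0 < x -> 0 <= s -> x ^ e - INR e * s * (x ^ e / x) <= Rmax 0 (x - s) ^ e.
Proof.
  intros Hx Hs. destruct e as [|e]; [simpl; lra|].
  replace (x ^ S e / x) with (x ^ e) by (simpl; field; lra). rewrite S_INR. pose proof (pos_INR e).
  assert (Hp : 0 < x ^ e) by (apply pow_lt; lra).
  destruct (Rle_dec s x) as [L|L].
  - rewrite Rmax_right by lra. destruct (pow_diff x (x - s) e) as [_ P]; lra.
  - rewrite Rmax_left, pow_i by (try lra; lia). simpl.
    assert (x * x ^ e <= (INR e + 1) * s * x ^ e); [|lra]. apply Rmult_le_compat_r; nra.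
Qed.

Lemma Ss_lower n l q : (1 <= n)%nat -> (1 <= q)%nat ->
  (harm n ^ l - INR l * (harm (q - 1) + INR l) * (harm n ^ l / harm n)) * / INR (fact l) <= Ss n l q.
Proof.
  intros Hn Hq. eapply Rle_trans; [|apply Ss_lower_aux; auto].
  pose proof (INR_fact_lt_0 l) as Hf. apply Rinv_0_lt_compat in Hf. apply Rmult_le_compat_r; [lra|].
  replace (harm n - harm (q - 1) - INR l) with (harm n - (harm (q - 1) + INR l)) by ring.
  apply Rmax_bernoulli; [pose proof (harm_ge_1 n Hn); lra|]. pose proof (harm_nonneg (q - 1)). pose proof (pos_INR l). lra.
Qed.

(** A part size times its own reciprocal is 1, so in each term a factor at most [n] replaces a
    harmonic sum. On average the singletons therefore sum to [O(n / log n)], which makes the shift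
    of [n] by the parts affordable. *)
Lemma Ss_weight n l : (1 <= n)%nat -> forall q, (1 <= q)%nat ->
  sumL (fun S => INR (list_sum S) * iprod S) (subs n l q) * harm n <= INR l * INR n * harm n ^ l.
Proof.
  intros Hn. pose proof (harm_ge_1 n Hn) as HH. induction l as [|l IH]; intros q Hq; [simpl; lra|].
  simpl subs. rewrite sumL_flat_map.
  rewrite (sumL_ext _ (fun d => Ss n l (S d) + / INR d * sumL (fun S => INR (list_sum S) * iprod S) (subs n l (S d)))).
  2:{ intros d Hd. apply in_seq in Hd. pose proof (INR_pos_le d ltac:(lia)). rewrite sumL_map. unfold Ss. rewrite <- sumL_scal, <- sumL_plus.
      apply sumL_ext. intros S _. change (list_sum (d :: S)) with (d + list_sum S)%nat. cbn [iprod].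
      rewrite plus_INR. field. lra. }
  rewrite sumL_plus, Rmult_plus_distr_r.
  assert (Hl : 0 <= harm n ^ l) by (apply pow_le; lra).
  assert (H1 : sumL (fun d => Ss n l (S d)) (seq q (n + 1 - q)) <= INR n * harm n ^ l).
  { eapply Rle_trans; [apply sumL_le; intros d Hd; apply Ss_upper; lia|].
    rewrite sumL_const, length_seq.
    assert (INR (n + 1 - q) <= INR n) by (apply le_INR; lia). pose proof (pos_INR (n + 1 - q)).
    assert (0 < / INR (fact l) <= 1) by (apply inv_INR_bounds, lt_O_fact).
    apply Rmult_le_compat; auto; nra. }
  assert (H2 : sumL (fun d => / INR d * sumL (fun S => INR (list_sum S) * iprod S) (subs n l (S d))) (seq q (n + 1 - q)) * harm n
          <= INR l * INR n * harm n ^ l * harm n).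
  { rewrite Rmult_comm, <- sumL_scal.
    apply Rle_trans with (sumL (fun d => (INR l * INR n * harm n ^ l) * / INR d) (seq q (n + 1 - q))).
    - apply sumL_le. intros d Hd. apply in_seq in Hd. specialize (IH (S d) ltac:(lia)).
      pose proof (inv_INR_bounds d ltac:(lia)). nra.
    - rewrite sumL_scal. apply Rmult_le_compat_l; [|now apply sum_inv_harm'].
      repeat apply Rmult_le_pos; auto; apply pos_INR. }
  rewrite S_INR. simpl pow. nra.
Qed.

(** * Counting the codes of maximal size *)

(** [Q] is the base and [O] holds the other parts. The error is the shift of [n] by the sum of [O],
    linearised by Bernoulli's inequality, plus the propagated base error. *)
Lemma cnt_error O Q j E n : (1 <= n)%nat -> 0 <= E ->
  Forall (fun d => (1 <= d)%nat) O -> Forall (fun d => (1 <= d)%nat) Q ->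
  (forall m, cnt Q m <= iprod Q * / INR (fact j) * INR m ^ j + E) ->
  (forall m, (1 <= m)%nat -> iprod Q * / INR (fact j) * INR m ^ j - E <= cnt Q m) ->
  let e := (length O + j)%nat in
  Rabs (cnt (O ++ Q) n - iprod (O ++ Q) * (/ INR (fact e) * INR n ^ e)) <=
  iprod (O ++ Q) * (INR e * INR (list_sum O)) * (INR n ^ e / INR n) + E * iprod O * INR n ^ length O.
Proof.
  intros Hn HE HO HQ HU HL e.
  pose proof (iprod_bounds O HO) as PO. pose proof (iprod_bounds Q HQ) as PQ.
  pose proof (INR_pos_le n Hn) as Hn1.
  pose proof (cnt_extend_upper Q j (iprod Q) E ltac:(lra) HE HU O HO n) as U.
  pose proof (cnt_extend_lower Q j (iprod Q) E ltac:(lra) HE HL O HO n Hn) as L.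
  fold e in U, L. rewrite iprod_app.
  pose proof (Rmax_bernoulli (INR n) (INR (list_sum O)) e ltac:(lra) (pos_INR _)) as B.
  assert (F : 0 < / INR (fact e) <= 1) by (apply inv_INR_bounds, lt_O_fact).
  assert (Hw : 0 <= INR e * INR (list_sum O) * (INR n ^ e / INR n)).
  { repeat apply Rmult_le_pos; try apply pos_INR; [apply pow_le, pos_INR|].
    left; apply Rinv_0_lt_compat; lra. }
  assert (Hc : 0 < iprod O * iprod Q) by nra.
  assert (HB : iprod O * iprod Q * / INR (fact e) * (INR n ^ e - INR e * INR (list_sum O) * (INR n ^ e / INR n))
    <= iprod O * iprod Q * / INR (fact e) * Rmax 0 (INR n - INR (list_sum O)) ^ e).
  { apply Rmult_le_compat_l; [apply Rmult_le_pos|]; lra. }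
  assert (HW : iprod O * iprod Q * / INR (fact e) * (INR e * INR (list_sum O) * (INR n ^ e / INR n))
    <= iprod O * iprod Q * (INR e * INR (list_sum O) * (INR n ^ e / INR n))).
  { apply Rmult_le_compat_r; auto. rewrite <- (Rmult_1_r (iprod O * iprod Q)) at 2.
    apply Rmult_le_compat_l; lra. }
  assert (0 <= iprod O * iprod Q * (INR e * INR (list_sum O) * (INR n ^ e / INR n))) by (apply Rmult_le_pos; lra).
  apply Rabs_le. split; lra.
Qed.

Lemma list_sum_bound l m : (forall x, In x l -> (x <= m)%nat) -> (list_sum l <= length l * m)%nat.
Proof.
  induction l as [|a l IH]; simpl; intros Hl; auto.
  assert (a <= m)%nat by auto. assert (list_sum l <= length l * m)%nat by auto. lia.
Qed.

Lemma list_sum_perm l l' : Permutation l l' -> list_sum l = list_sum l'.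
Proof. induction 1; simpl; lia. Qed.

Lemma iprod_perm l l' : Permutation l l' -> iprod l = iprod l'.
Proof. induction 1; simpl; try congruence; ring. Qed.

(** The base is the pair at the top of the runs or, without runs, the part 1. The base error of a
    pair [x], [x + 1] lacks the factor [1 / (x (x + 1))]; as [q' = x + 2], the factor [q' ^ 2] makes
    up for it and leaves a bound in terms of [iprod B] and [iprod S]. *)
Lemma cnt_full q bs l X n B q' S :
  (1 <= n)%nat -> (1 <= q)%nat -> valid bs ->
  (bs = [] /\ (2 <= q)%nat \/ bs <> [] /\ (2 <= last bs 0)%nat) ->
  In (B, q') (chains X q bs) -> In S (subs n l q') ->
  let D := seq 1 (q - 1) ++ B ++ S in
  let k := (q - 1 + list_sum bs + l)%nat in
  Rabs (cnt D n - iprod D * (/ INR (fact (k - 1)) * INR n ^ (k - 1))) <=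
  INR n ^ (k - 1) / INR n *
    (iprod B * iprod S * (INR k * INR (list_sum S) + (INR k ^ 2 + 1) * INR q' ^ 2)).
Proof.
  intros Hn Hq Hv Hbs HB HS D k.
  apply in_chains in HB. apply in_subs in HS. destruct HS as (S1 & S2 & S3).
  destruct (Full_inc _ _ _ _ HB) as (B1 & B2 & B3 & B4).
  assert (PA : Forall (fun d => (1 <= d)%nat) (seq 1 (q - 1))) by (now apply seq_pos).
  assert (PB : Forall (fun d => (1 <= d)%nat) B) by (apply inc_pos; eapply inc_weaken; eauto).
  assert (PS : Forall (fun d => (1 <= d)%nat) S) by (apply inc_pos; eapply inc_weaken; [|eauto]; lia).
  pose proof (iprod_bounds _ PA) as IA. pose proof (iprod_bounds _ PB) as IB. pose proof (iprod_bounds _ PS) as IS.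
  pose proof (INR_pos_le n Hn) as Hn1. pose proof (INR_pos_le q' ltac:(lia)) as Hq1.
  assert (HD : iprod D = iprod (seq 1 (q - 1)) * (iprod B * iprod S)) by (unfold D; now rewrite !iprod_app).
  assert (HBS : 0 < iprod B * iprod S) by nra.
  assert (HD1 : 0 < iprod D <= iprod B * iprod S) by nra.
  assert (Hsum : (list_sum D <= k * q' + list_sum S)%nat).
  { unfold D. rewrite !list_sum_app.
    pose proof (list_sum_bound (seq 1 (q - 1)) q' ltac:(intros x Hx; apply in_seq in Hx; lia)) as L1.
    pose proof (list_sum_bound B q' ltac:(intros x Hx; apply B2 in Hx; lia)) as L2.
    rewrite length_seq in L1. rewrite B4 in L2. unfold k. nia. }
  assert (PD : Forall (fun d => (1 <= d)%nat) D) by (unfold D; rewrite !Forall_app; auto).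
  assert (Hlen : length D = k) by (unfold D; rewrite !length_app, length_seq; unfold k; lia).
  assert (HM : 0 < INR n ^ (k - 1) / INR n).
  { apply Rmult_lt_0_compat; [apply pow_lt; lra|apply Rinv_0_lt_compat; lra]. }
  (* Both bases fit one scheme: [j] is the degree of the base count, and the last premise says that
     the propagated base error fits into the stated bound. *)
  assert (Main : forall O Q j E, Permutation D (O ++ Q) -> (length O + j = k - 1)%nat -> 0 <= E ->
    (forall m, cnt Q m <= iprod Q * / INR (fact j) * INR m ^ j + E) ->
    (forall m, (1 <= m)%nat -> iprod Q * / INR (fact j) * INR m ^ j - E <= cnt Q m) ->
    E * iprod O * INR n ^ length O <= INR n ^ (k - 1) / INR n * (iprod B * iprod S * INR q' ^ 2) ->
    Rabs (cnt D n - iprod D * (/ INR (fact (k - 1)) * INR n ^ (k - 1))) <=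
    INR n ^ (k - 1) / INR n *
      (iprod B * iprod S * (INR k * INR (list_sum S) + (INR k ^ 2 + 1) * INR q' ^ 2))).
  { intros O Q j E HP Hj HE HU HL Herr.
    assert (POQ : Forall (fun d => (1 <= d)%nat) (O ++ Q)) by (eapply Permutation_Forall; eauto).
    apply Forall_app in POQ. destruct POQ as [PO PQ].
    pose proof (cnt_error O Q j E n Hn HE PO PQ HU HL) as C. cbv zeta in C. rewrite Hj in C.
    rewrite <- (cnt_perm _ _ HP PD), <- (iprod_perm _ _ HP) in C.
    eapply Rle_trans; [exact C|].
    assert (Ho : INR (list_sum O) <= INR k * INR q' ^ 2 + INR (list_sum S)).
    { apply list_sum_perm in HP. rewrite list_sum_app in HP.
      assert (Ho : (list_sum O <= k * q' + list_sum S)%nat) by lia.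
      apply le_INR in Ho. rewrite plus_INR, mult_INR in Ho. pose proof (pos_INR k).
      assert (INR q' <= INR q' ^ 2) by nra. nra. }
    assert (Hk : INR (k - 1) <= INR k) by (apply le_INR; lia).
    assert (Hw : INR (k - 1) * INR (list_sum O) <= INR k * (INR k * INR q' ^ 2 + INR (list_sum S))).
    { apply Rmult_le_compat; auto; apply pos_INR. }
    assert (Hw0 : 0 <= INR (k - 1) * INR (list_sum O)) by (apply Rmult_le_pos; apply pos_INR).
    assert (Hz : iprod D * (INR (k - 1) * INR (list_sum O)) <=
      (iprod B * iprod S) * (INR k * (INR k * INR q' ^ 2 + INR (list_sum S)))).
    { apply Rmult_le_compat; lra. }
    apply (Rmult_le_compat_r (INR n ^ (k - 1) / INR n)) in Hz; [|lra]. lra. }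
  destruct Hbs as [[-> Hq2]|[Hne Hl]].
  - destruct HB as [-> ->]. simpl in k.
    apply (Main (seq 2 (q - 2) ++ S) [1%nat] 0%nat 0).
    + unfold D. simpl. rewrite (seq_cons 1) by lia. replace (q - 1 - 1)%nat with (q - 2)%nat by lia.
      simpl. apply Permutation_cons_append.
    + rewrite length_app, length_seq. unfold k. lia.
    + lra.
    + intros m. simpl. rewrite Rinv_1. destruct m as [|m]; [unfold cnt; simpl; lra|].
      rewrite cnt_one by lia. lra.
    + intros m Hm. simpl. rewrite Rinv_1, cnt_one by lia. lra.
    + rewrite !Rmult_0_l. apply Rmult_le_pos; [lra|]. apply Rmult_le_pos; [lra|]. apply pow_le; lra.
  - destruct (last_pair _ _ _ _ HB Hne Hl) as (B0 & EB & Hx). 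
    set (x := (q' - 2)%nat) in *. replace (q' - 1)%nat with (Datatypes.S x) in EB by lia.
    assert (Hkl : (2 <= k)%nat).
    { rewrite EB, length_app in B4. simpl in B4. unfold k. lia. }
    apply (Main (seq 1 (q - 1) ++ B0 ++ S) [x; Datatypes.S x] 1%nat 1).
    + unfold D. rewrite EB, <- !app_assoc. apply Permutation_app_head, Permutation_app_head.
      apply Permutation_app_comm.
    + assert (Hl2 : length D = k) by auto. unfold D in Hl2. rewrite EB in Hl2.
      rewrite !length_app in *. simpl in Hl2. lia.
    + lra.
    + intros m. pose proof (cnt_pair x m ltac:(lia)). change (INR (fact 1)) with 1. rewrite Rinv_1. lra.
    + intros m _. pose proof (cnt_pair x m ltac:(lia)). change (INR (fact 1)) with 1. rewrite Rinv_1. lra.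
    + assert (EL : length (seq 1 (q - 1) ++ B0 ++ S) = (k - 2)%nat).
      { assert (Hl2 : length D = k) by auto. unfold D in Hl2. rewrite EB in Hl2.
        rewrite !length_app in *. simpl in Hl2. lia. }
      rewrite EL. replace (INR n ^ (k - 1) / INR n) with (INR n ^ (k - 2)).
      2:{ replace (k - 1)%nat with (Datatypes.S (k - 2)) by lia. simpl. field. lra. }
      rewrite EB, !iprod_app, Rmult_1_l, Rmult_comm.
      apply Rmult_le_compat_l; [apply pow_le; lra|].
      pose proof (INR_pos_le x ltac:(lia)) as Hx1.
      assert (PB0 : 0 < iprod B0 <= 1) by (apply iprod_bounds; rewrite EB in PB; apply Forall_app in PB; tauto).
      assert (H1 : 1 <= iprod [x; Datatypes.S x] * INR q' ^ 2).
      { replace q' with (x + 2)%nat by lia. cbn [iprod]. rewrite S_INR, plus_INR. simpl (INR 2).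
        replace (/ INR x * (/ (INR x + 1) * 1) * (INR x + (1 + 1)) ^ 2) with ((INR x + 2) ^ 2 / (INR x * (INR x + 1))) by (field; lra).
        apply Rle_div_r; nra. }
      assert (0 < iprod B0 * iprod S) by (apply Rmult_lt_0_compat; lra).
      apply Rle_trans with (iprod B0 * iprod S); [nra|].
      replace (iprod B0 * iprod [x; Datatypes.S x] * iprod S * INR q' ^ 2)
        with (iprod B0 * iprod S * (iprod [x; Datatypes.S x] * INR q' ^ 2)) by ring. nra.
Qed.

Lemma codes_fulls_length X n q bs l :
  INR (length (codes (fulls X n q bs l) n)) =
  sumL (fun p => sumL (fun S => cnt (seq 1 (q - 1) ++ fst p ++ S) n) (subs n l (snd p))) (chains X q bs).
Proof.
  unfold codes. rewrite length_flat_map_sumL. unfold fulls. rewrite sumL_flat_map.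
  apply sumL_ext. intros p _. rewrite sumL_map. apply sumL_ext. intros S _. now rewrite length_map.
Qed.

Lemma chains_ge X q bs p : In p (chains X q bs) -> (q <= snd p)%nat /\ Forall (fun d => (1 <= d)%nat) (fst p) \/ q = 0%nat.
Proof.
  destruct p as [B q']. intros HB. apply in_chains in HB. destruct (Full_inc _ _ _ _ HB) as (B1 & B2 & B3 & B4).
  destruct (Nat.eq_dec q 0) as [|Hq]; auto. left. split; [simpl; lia|].
  apply inc_pos. eapply inc_weaken; [|exact B1]. lia.
Qed.

Lemma Bs_nonneg N q bs f : (1 <= q)%nat -> (forall x, 0 <= f x) -> 0 <= Bs N q bs f.
Proof.
  intros Hq Hf. apply sumL_nonneg. intros p Hp. apply chains_ge in Hp. destruct Hp as [[_ Hp]|]; [|lia].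
  pose proof (iprod_bounds _ Hp). specialize (Hf (snd p)). apply Rmult_le_pos; lra.
Qed.

Lemma Bs_le_one N q bs : valid bs -> (1 <= q)%nat -> Bs N q bs (fun _ => 1) <= 1.
Proof.
  intros Hv Hq. eapply Rle_trans; [apply Bs_upper; auto|]. pose proof (kK_bounds bs Hv).
  pose proof (iprod_seq_pos q (ks bs) Hq). rewrite <- (Rmult_1_r 1). apply Rmult_le_compat; lra.
Qed.

(** Summing [cnt_full] over all sets: [Ss_weight] handles the sum of the singletons and loses a
    logarithm, [Bs_sqr] handles [q' ^ 2] and gives order [X] up to logarithms. *)
Lemma full_codes_count q bs l : (1 <= q)%nat -> valid bs ->
  (bs = [] /\ (2 <= q)%nat \/ bs <> [] /\ (2 <= last bs 0)%nat) ->
  let k := (q - 1 + list_sum bs + l)%nat in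
  exists C, 0 <= C /\ forall n X, (1 <= X <= n)%nat ->
  Rabs (INR (length (codes (fulls X n q bs l) n)) -
        iprod (seq 1 (q - 1)) * (/ INR (fact (k - 1)) * INR n ^ (k - 1)) * Bs X q bs (Ss n l)) <=
  INR n ^ (k - 1) / INR n *
    (INR k * (INR l * INR n * (harm n ^ l / harm n)) + C * INR X * (1 + harm n) ^ length bs * harm n ^ l).
Proof.
  intros Hq Hv Hbs k.
  assert (HC : exists C, 0 <= C /\ forall X, (1 <= X)%nat ->
    Bs X q bs (fun q' => INR q' ^ 2) <= C * INR X * (1 + harm X) ^ length bs).
  { destruct Hbs as [[-> _]|[Hne _]].
    - exists (INR q ^ 2). split; [apply pow_le, pos_INR|]. intros X HX. rewrite Bs_nil. simpl.
      apply INR_pos_le in HX. pose proof (pos_INR q). nra.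
    - destruct (Bs_sqr bs Hv Hne) as (C & HC & HB). exists C. auto. }
  destruct HC as (C & HC & HB). exists ((INR k ^ 2 + 1) * C).
  split; [pose proof (pos_INR k); apply Rmult_le_pos; nra|].
  intros n X HX. specialize (HB X ltac:(lia)).
  assert (Hn : (1 <= n)%nat) by lia. pose proof (harm_ge_1 n Hn) as HH. pose proof (INR_pos_le n Hn) as Hn1.
  set (M := INR n ^ (k - 1)) in *.
  assert (HM : 0 < M / INR n).
  { apply Rmult_lt_0_compat; [apply pow_lt; lra|apply Rinv_0_lt_compat; lra]. }
  rewrite codes_fulls_length. unfold Bs, Ss. rewrite <- sumL_scal, <- sumL_minus.
  set (W2 := INR k * (INR l * INR n * (harm n ^ l / harm n))).
  apply Rle_trans with (sumL (fun p => M / INR n * (iprod (fst p) * W2 +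
    (INR k ^ 2 + 1) * harm n ^ l * (iprod (fst p) * INR (snd p) ^ 2))) (chains X q bs)).
  - apply sumL_abs_le. intros p Hp. pose proof (chains_ge _ _ _ _ Hp) as Hp'.
    destruct Hp' as [[Hp1 Hp2]|]; [|lia]. pose proof (iprod_bounds _ Hp2) as Ip.
    rewrite <- !sumL_scal, <- sumL_minus.
    eapply Rle_trans; [apply (sumL_abs_le _ (fun S => M / INR n * iprod (fst p) * (INR k * (INR (list_sum S) * iprod S) + (INR k ^ 2 + 1) * INR (snd p) ^ 2 * iprod S)))|].
    + intros S HS. destruct p as [B q']. pose proof (cnt_full q bs l X n B q' S Hn Hq Hv Hbs Hp HS) as P.
      cbv zeta in P. fold k in P. fold M in P. simpl fst. simpl snd.
      rewrite !iprod_app in P.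
      match goal with |- Rabs ?a <= _ => match type of P with Rabs ?b <= _ => replace a with b by ring end end.
      eapply Rle_trans; [exact P|]. right. ring.
    + rewrite sumL_scal, sumL_plus, !sumL_scal. rewrite Rmult_assoc. apply Rmult_le_compat_l; [lra|].
      rewrite Rmult_plus_distr_l. apply Rplus_le_compat.
      * apply Rmult_le_compat_l; [lra|]. unfold W2. apply Rmult_le_compat_l; [apply pos_INR|].
        unfold Rdiv. rewrite <- Rmult_assoc. apply Rle_div_r; [lra|]. apply Ss_weight; lia.
      * fold (Ss n l (snd p)).
        assert (HS : Ss n l (snd p) <= harm n ^ l).
        { eapply Rle_trans; [apply Ss_upper; lia|].
          assert (0 < / INR (fact l) <= 1) by (apply inv_INR_bounds, lt_O_fact).
          assert (0 <= harm n ^ l) by (apply pow_le; lra). nra. }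
        assert (0 <= (INR k ^ 2 + 1) * (iprod (fst p) * INR (snd p) ^ 2)).
        { apply Rmult_le_pos; [nra|]. apply Rmult_le_pos; [lra|]. apply pow_le, pos_INR. }
        apply (Rmult_le_compat_l ((INR k ^ 2 + 1) * (iprod (fst p) * INR (snd p) ^ 2))) in HS; [|auto]. lra.
  - rewrite sumL_scal, sumL_plus, sumL_scal. apply Rmult_le_compat_l; [lra|]. apply Rplus_le_compat.
    + fold W2. assert (0 <= W2).
      { unfold W2. repeat apply Rmult_le_pos; try apply pos_INR; [apply pow_le; lra|left; apply Rinv_0_lt_compat; lra]. }
      pose proof (Bs_le_one X q bs Hv Hq) as P. unfold Bs in P.
      rewrite (sumL_ext _ (fun p => W2 * (iprod (fst p) * 1))) by (intros; ring). rewrite sumL_scal. nra.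
    + change (sumL (fun p => iprod (fst p) * INR (snd p) ^ 2) (chains X q bs)) with (Bs X q bs (fun q' => INR q' ^ 2)).
      assert (Hl : 0 <= (INR k ^ 2 + 1) * harm n ^ l) by (apply Rmult_le_pos; [nra|apply pow_le; lra]).
      apply Rle_trans with ((INR k ^ 2 + 1) * harm n ^ l * (C * INR X * (1 + harm n) ^ length bs)); [|right; ring].
      apply Rmult_le_compat_l; auto. eapply Rle_trans; [exact HB|].
      apply Rmult_le_compat_l; [apply Rmult_le_pos; auto; apply pos_INR|].
      apply pow_incr. pose proof (harm_nonneg X). pose proof (harm_le X n ltac:(lia)). lra.
Qed.

(** The singletons start at the end [q'] of the runs, which removes [harm (q' - 1)] from the
    harmonic sum. By [Bs_sqrt] the weighted sum of these losses stays bounded, so one logarithm is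
    lost; the first error term is the price of stopping the runs at [X]. *)
Lemma density_sum q bs l : (1 <= q)%nat -> valid bs ->
  exists C, 0 <= C /\ forall n X, (1 <= X <= n)%nat ->
  Rabs (Bs X q bs (Ss n l) - kK bs * iprod (seq q (ks bs)) * (/ INR (fact l) * harm n ^ l)) <=
  C * (harm n ^ l * (1 + harm n) ^ length bs / INR (X + 1) + INR l * (harm n ^ l / harm n)).
Proof.
  intros Hq Hv.
  assert (HC : exists C, 0 <= C /\ forall X, Bs X q bs (fun q' => sqrt (INR q')) <= C).
  { destruct bs as [|g bs].
    - exists (sqrt (INR q)). split; [apply sqrt_pos|]. intros X. rewrite Bs_nil. lra.
    - destruct (Bs_sqrt (g :: bs) Hv ltac:(discriminate)) as (C & HC & HB).
      exists (C * / sqrt (INR q)). split; [|intros; auto]. apply Rmult_le_pos; auto.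
      left. apply Rinv_0_lt_compat, sqrt_lt_R0, lt_0_INR. lia. }
  destruct HC as (C & HC & HB). exists (INR (length bs) + (2 * C + INR l)).
  pose proof (pos_INR (length bs)) as Ht. pose proof (pos_INR l) as Hl.
  split; [lra|]. intros n X HX. assert (Hn : (1 <= n)%nat) by lia.
  pose proof (harm_ge_1 n Hn) as HH. set (y := harm n ^ l) in *. set (c := kK bs * iprod (seq q (ks bs))).
  assert (Hy : 0 < y) by (apply pow_lt; lra).
  assert (Hf : 0 < / INR (fact l) <= 1) by (apply inv_INR_bounds, lt_O_fact).
  pose proof (Bs_upper X bs Hv q Hq) as BU. pose proof (Bs_lower X bs Hv q Hq) as BL. fold c in BU, BL.
  pose proof (Bs_nonneg X q bs (fun _ => 1) Hq ltac:(intros; lra)) as B0.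
  pose proof (Bs_le_one X q bs Hv Hq) as B1.
  assert (Hyd : 0 < y / harm n) by (apply Rmult_lt_0_compat; [lra|apply Rinv_0_lt_compat; lra]).
  assert (U : Bs X q bs (Ss n l) <= / INR (fact l) * y * Bs X q bs (fun _ => 1)).
  { unfold Bs. rewrite <- sumL_scal. apply sumL_le. intros p Hp. apply chains_ge in Hp.
    destruct Hp as [[Hp1 Hp2]|]; [|lia]. pose proof (iprod_bounds _ Hp2).
    apply Rle_trans with (iprod (fst p) * (harm n ^ l * / INR (fact l))); [|right; unfold y; ring].
    apply Rmult_le_compat_l; [lra|]. apply Ss_upper. lia. }
  assert (L : / INR (fact l) * (y * Bs X q bs (fun _ => 1) - INR l * (y / harm n) * (2 * Bs X q bs (fun q' => sqrt (INR q')) + INR l * Bs X q bs (fun _ => 1)))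
     <= Bs X q bs (Ss n l)).
  { unfold Bs. rewrite <- !sumL_scal, <- sumL_plus, <- !sumL_scal, <- sumL_minus, <- sumL_scal.
    apply sumL_le. intros p Hp. apply chains_ge in Hp.
    destruct Hp as [[Hp1 Hp2]|]; [|lia]. pose proof (iprod_bounds _ Hp2) as Ip.
    assert (Hs : harm (snd p - 1) <= 2 * sqrt (INR (snd p))).
    { eapply Rle_trans; [apply (harm_le _ (snd p)); lia|]. apply harm_sqrt. lia. }
    apply Rle_trans with (iprod (fst p) * ((harm n ^ l - INR l * (harm (snd p - 1) + INR l) * (harm n ^ l / harm n)) * / INR (fact l))).
    - fold y.
      assert (INR l * (y / harm n) * (iprod (fst p) * harm (snd p - 1)) <= INR l * (y / harm n) * (iprod (fst p) * (2 * sqrt (INR (snd p))))).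
      { apply Rmult_le_compat_l; [apply Rmult_le_pos; lra|]. apply Rmult_le_compat_l; lra. }
      match goal with |- / ?f * ?a <= ?b => apply Rle_trans with (/ f * (iprod (fst p) * (y - INR l * (harm (snd p - 1) + INR l) * (y / harm n)))) end;
        [|right; ring].
      apply Rmult_le_compat_l; lra.
    - apply Rmult_le_compat_l; [lra|]. apply Ss_lower; lia. }
  specialize (HB X).
  assert (Hx : 0 < / INR (X + 1)) by (apply Rinv_0_lt_compat, lt_0_INR; lia).
  assert (Hp : (1 + harm X) ^ length bs <= (1 + harm n) ^ length bs).
  { apply pow_incr. pose proof (harm_nonneg X). pose proof (harm_le X n ltac:(lia)). lra. }
  set (P := (1 + harm n) ^ length bs) in *.
  assert (HPp : 0 < P) by (apply pow_lt; lra).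
  assert (Hlow : c - INR (length bs) * P * / INR (X + 1) <= Bs X q bs (fun _ => 1)).
  { eapply Rle_trans; [|exact BL]. unfold Rdiv. apply Rplus_le_compat_l, Ropp_le_contravar.
    apply Rmult_le_compat_r; [lra|]. apply Rmult_le_compat_l; lra. }
  set (b1 := Bs X q bs (fun _ => 1)) in *. set (b2 := Bs X q bs (fun q' => sqrt (INR q'))) in *.
  assert (HR1 : 0 <= y * P / INR (X + 1)) by (unfold Rdiv; repeat apply Rmult_le_pos; lra).
  assert (HR2 : 0 <= INR l * (y / harm n)) by (apply Rmult_le_pos; lra).
  apply Rabs_le. split.
  - assert (E1 : / INR (fact l) * (y * (c - INR (length bs) * P * / INR (X + 1))) <= / INR (fact l) * (y * b1)).
    { apply Rmult_le_compat_l; [lra|]. apply Rmult_le_compat_l; lra. }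
    assert (E2 : INR l * (y / harm n) * (2 * b2 + INR l * b1) <= INR l * (y / harm n) * (2 * C + INR l)).
    { apply Rmult_le_compat_l; auto. nra. }
    assert (E3 : / INR (fact l) * (INR l * (y / harm n) * (2 * b2 + INR l * b1)) <= INR l * (y / harm n) * (2 * C + INR l)).
    { assert (0 <= INR l * (y / harm n) * (2 * C + INR l)) by (apply Rmult_le_pos; lra).
      apply Rle_trans with (/ INR (fact l) * (INR l * (y / harm n) * (2 * C + INR l))); [apply Rmult_le_compat_l; lra|nra]. }
    assert (E4 : / INR (fact l) * (INR (length bs) * (y * P / INR (X + 1))) <= INR (length bs) * (y * P / INR (X + 1))).
    { assert (0 <= INR (length bs) * (y * P / INR (X + 1))) by (apply Rmult_le_pos; lra). nra. }
    assert (0 <= INR (length bs) * (INR l * (y / harm n))) by (apply Rmult_le_pos; lra).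
    assert (0 <= (2 * C + INR l) * (y * P / INR (X + 1))) by (apply Rmult_le_pos; lra).
    unfold Rdiv in *. lra.
  - assert (/ INR (fact l) * y * b1 <= / INR (fact l) * y * c).
    { apply Rmult_le_compat_l; [apply Rmult_le_pos; lra|]. lra. }
    assert (0 <= (INR (length bs) + (2 * C + INR l)) * (y * P / INR (X + 1) + INR l * (y / harm n))) by (apply Rmult_le_pos; lra).
    lra.
Qed.

(** * Error terms *)

Lemma ln_INR_nonneg n : (1 <= n)%nat -> 0 <= ln (INR n).
Proof.
  intros Hn. apply INR_pos_le in Hn. rewrite <- ln_1.
  destruct Hn as [Hn|Hn]; [left; apply ln_increasing; lra|rewrite <- Hn; lra].
Qed.

(** With [m = j + 1] and [y = ln n], [sqrt n] is the power [m] of [exp (y / (2 m))], and [4 m exp (y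
    / (2 m)) >= 4 m + 2 y >= 2 + y]. *)
Lemma polylog_le_sqrt j : exists C, 0 <= C /\ forall n, (1 <= n)%nat -> (2 + ln (INR n)) ^ j <= C * sqrt (INR n).
Proof.
  set (m := INR (S j)). assert (Hm : 1 <= m) by (apply INR_pos_le; lia).
  exists ((4 * m) ^ S j). split; [apply pow_le; lra|]. intros n Hn.
  pose proof (ln_INR_nonneg n Hn) as Hy. apply INR_pos_le in Hn. set (y := ln (INR n)) in *.
  assert (Es : sqrt (INR n) = exp (y / (2 * m)) ^ S j).
  { rewrite <- Rpower_pow by apply exp_pos. rewrite <- Rpower_sqrt by lra.
    unfold Rpower. rewrite ln_exp. fold m. fold y. f_equal. field. lra. }
  rewrite Es, <- Rpow_mult_distr.
  apply Rle_trans with ((2 + y) ^ S j).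
  - rewrite <- (Rmult_1_l ((2 + y) ^ j)). simpl. apply Rmult_le_compat_r; [apply pow_le; lra|lra].
  - apply pow_incr. split; [lra|].
    pose proof (exp_ineq1_le (y / (2 * m))) as P.
    apply Rle_trans with (4 * m * (1 + y / (2 * m))); [|apply Rmult_le_compat_l; lra].
    replace (4 * m * (1 + y / (2 * m))) with (4 * m + 2 * y) by (field; lra). lra.
Qed.

Lemma pow_div_mono l x y : 1 <= x <= y -> INR l * (x ^ l / x) <= INR l * (y ^ l / y).
Proof.
  intros Hxy. destruct l as [|l]; [simpl; lra|].
  apply Rmult_le_compat_l; [apply pos_INR|].
  replace (x ^ S l / x) with (x ^ l) by (simpl; field; lra).
  replace (y ^ S l / y) with (y ^ l) by (simpl; field; lra). apply pow_incr. lra.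
Qed.

(** Pays for replacing [harm n] by [ln n]: a difference of at most 1 costs one power of the
    logarithm. *)
Lemma pow_near l x y : 1 <= y -> y - 1 <= x <= y -> 0 <= x -> y ^ l - x ^ l <= INR l * (y ^ l / y).
Proof.
  intros Hy Hxy Hx. destruct l as [|l]; [simpl; lra|].
  replace (y ^ S l / y) with (y ^ l) by (simpl; field; lra). rewrite S_INR.
  destruct (pow_diff y x l) as [_ P]; [lra|].
  eapply Rle_trans; [exact P|]. rewrite <- (Rmult_1_r ((INR l + 1) * y ^ l)) at 2.
  apply Rmult_le_compat_l; [|lra]. pose proof (pos_INR l). apply Rmult_le_pos; [lra|apply pow_le; lra].
Qed.

Lemma pairs_length n : INR (length (pairs n)) <= INR n * harm n.
Proof.
  unfold pairs. rewrite length_flat_map_sumL. unfold harm. rewrite <- sumL_scal.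
  apply sumL_le. intros d Hd. apply in_seq in Hd. rewrite length_map, length_seq.
  apply Rle_div_r; [apply lt_0_INR; lia|]. rewrite <- mult_INR. apply le_INR, div_mul_le. lia.
Qed.

(** With [X] the integer square root, both covers have [n^(k-2)] choices for the free entries, up to
    logarithms, times [O(sqrt n)]; this is a factor [sqrt n] below the main term. *)
Lemma cover_bound k n : (1 <= n)%nat -> (2 <= k)%nat ->
  INR (length (cov1 n (k - 2)) + length (cov2 n (Nat.sqrt n) (k - 2))) <=
  (2 + 2 * INR k) * (INR n ^ (k - 1) * ((2 + ln (INR n)) ^ k / sqrt (INR n))).
Proof.
  intros Hn Hk. pose proof (harm_ln n Hn) as HH. pose proof (harm_nonneg n) as H0.
  pose proof (ln_INR_nonneg n Hn) as Hy. pose proof (INR_pos_le n Hn) as Hn1.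
  set (y := ln (INR n)) in *. set (X := Nat.sqrt n).
  assert (HX : (1 <= X)%nat) by (apply Nat.sqrt_le_square; lia).
  destruct (Nat.sqrt_spec n ltac:(lia)) as [X1 X2]. fold X in X1, X2.
  set (s := sqrt (INR n)). assert (Hs : 1 <= s) by (rewrite <- sqrt_1; apply sqrt_le_1_alt; lra).
  assert (Ess : s * s = INR n) by (apply sqrt_sqrt; lra).
  apply le_INR in X1. rewrite mult_INR in X1. apply lt_INR in X2. rewrite mult_INR, S_INR in X2.
  pose proof (INR_pos_le X HX) as HX1.
  assert (HXs : INR X <= s) by nra. assert (HsX : s <= 2 * INR X) by nra.
  assert (Hq : INR (n / X) <= 2 * s).
  { pose proof (div_mul_le (n / X) n X ltac:(lia)) as Hd. apply le_INR in Hd. rewrite mult_INR in Hd.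
    pose proof (pos_INR (n / X)). nra. }
  rewrite plus_INR, cov1_length, cov2_length, !mult_INR, !pow_INR. rewrite plus_INR.
  fold X. simpl (INR 1). simpl (INR 2).
  pose proof (pairs_length n) as HP. pose proof (pos_INR (length (pairs n))) as HP0.
  set (Z := (1 + INR (length (pairs n))) ^ (k - 2)).
  assert (HZ : 0 <= Z) by (apply pow_le; lra).
  assert (HZ2 : Z <= INR n ^ (k - 2) * (2 + y) ^ k).
  { apply Rle_trans with ((INR n * (2 + y)) ^ (k - 2)).
    - apply pow_incr. nra.
    - rewrite Rpow_mult_distr. apply Rmult_le_compat_l; [apply pow_le; lra|]. apply Rle_pow; [lra|lia]. }
  assert (Hk2 : INR (S (k - 2)) <= INR k) by (apply le_INR; lia).
  pose proof (pos_INR (S (k - 2))) as Hk0.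
  apply Rle_trans with (Z * ((2 + 2 * INR k) * s)).
  - assert (INR (S (k - 2)) * INR (n / X) <= INR k * (2 * s)) by (apply Rmult_le_compat; auto; apply pos_INR).
    replace (Z * ((1 + 1) * INR X) + Z * (INR (S (k - 2)) * INR (n / X)))
      with (Z * ((1 + 1) * INR X + INR (S (k - 2)) * INR (n / X))) by ring.
    apply Rmult_le_compat_l; auto. lra.
  - replace (k - 1)%nat with (S (k - 2)) by lia. rewrite <- tech_pow_Rmult, <- Ess.
    replace ((2 + 2 * INR k) * (s * s * (s * s) ^ (k - 2) * ((2 + y) ^ k / s)))
      with ((s * s) ^ (k - 2) * (2 + y) ^ k * ((2 + 2 * INR k) * s)) by (field; lra).
    rewrite Ess. apply Rmult_le_compat_r; auto. pose proof (pos_INR k). apply Rmult_le_pos; lra.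
Qed.

(** The error is stated with [1 + ln n], so that the division makes sense already at [n = 1]. *)
Lemma avoiders_asymptotics mu q nu bs l :
  rev mu = q :: nu -> (1 <= q)%nat -> inc (S q) nu -> diffs q nu = bs ++ repeat 1%nat l -> valid bs ->
  (bs = [] /\ (2 <= q)%nat \/ bs <> [] /\ (2 <= last bs 0)%nat) ->
  let k := (q - 1 + list_sum bs + l)%nat in
  let c := iprod (seq 1 (q - 1)) * / INR (fact (k - 1)) * (kK bs * iprod (seq q (ks bs))) * / INR (fact l) in
  exists C, 0 <= C /\ forall n, (1 <= n)%nat -> exists L, enumerates_Av mu n L /\
    Rabs (INR (length L) - c * (INR n ^ (k - 1) * ln (INR n) ^ l)) <=
    C * (INR n ^ (k - 1) * ((1 + ln (INR n)) ^ l / (1 + ln (INR n)))).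
Proof.
  intros Hmu Hq Hnu Hd Hv Hbs k c.
  destruct (full_codes_count q bs l Hq Hv Hbs) as (C1 & HC1 & B1). fold k in B1.
  destruct (density_sum q bs l Hq Hv) as (C2 & HC2 & B2).
  destruct (polylog_le_sqrt (S (length bs))) as (C3 & HC3 & B3).
  destruct (polylog_le_sqrt (S k)) as (C4 & HC4 & B4).
  pose proof (pos_INR k) as Hk0. pose proof (pos_INR l) as Hl0.
  exists ((2 + 2 * INR k) * C4 + (INR k * INR l + C1 * C3) + C2 * (C3 + INR l) + INR l).
  split.
  { assert (0 <= (2 + 2 * INR k) * C4) by (apply Rmult_le_pos; lra).
    assert (0 <= INR k * INR l) by (apply Rmult_le_pos; lra).
    assert (0 <= C1 * C3) by (apply Rmult_le_pos; lra).
    assert (0 <= C2 * (C3 + INR l)) by (apply Rmult_le_pos; lra). lra. }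
  intros n Hn. set (X := Nat.sqrt n).
  assert (HX : (1 <= X)%nat) by (apply Nat.sqrt_le_square; lia).
  assert (HXn : (1 <= X <= n)%nat) by (split; auto; apply Nat.sqrt_le_lin).
  destruct (enumeration_bounds mu q nu bs l n X Hmu Hq Hnu Hd ltac:(tauto) Hn HX) as (L & HL & L1 & L2).
  fold k in L2. exists L. split; auto.
  specialize (B1 n X HXn). specialize (B2 n X HXn). specialize (B3 n Hn). specialize (B4 n Hn).
  pose proof (harm_ln n Hn) as HH. pose proof (harm_ge_1 n Hn) as HH1.
  pose proof (ln_INR_nonneg n Hn) as Hy. pose proof (INR_pos_le n Hn) as Hn1.
  set (y := ln (INR n)) in *. set (h := harm n) in *. set (M := INR n ^ (k - 1)) in *.
  set (s := sqrt (INR n)) in *.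
  assert (Hs : 1 <= s) by (unfold s; rewrite <- sqrt_1; apply sqrt_le_1_alt; lra).
  assert (Ess : s * s = INR n) by (apply sqrt_sqrt; lra).
  assert (HXs : INR X <= s /\ / INR (X + 1) <= / s).
  { destruct (Nat.sqrt_spec n ltac:(lia)) as [X1 X2]. fold X in X1, X2.
    apply le_INR in X1. rewrite mult_INR in X1. apply lt_INR in X2. rewrite mult_INR, S_INR in X2.
    pose proof (INR_pos_le X HX). split; [nra|]. apply Rinv_le_contravar; [lra|].
    rewrite plus_INR. simpl. nra. }
  destruct HXs as [HXs HXi].
  assert (HM : 0 < M) by (apply pow_lt; lra).
  set (T := (1 + y) ^ l / (1 + y)).
  assert (Hyl : 1 <= (1 + y) ^ l) by (apply pow_R1_Rle; lra).
  assert (HT : 0 < T) by (apply Rmult_lt_0_compat; [lra|apply Rinv_0_lt_compat; lra]).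
  (* A factor [1 / sqrt n] absorbs any power of the logarithm. *)
  assert (Absorb : forall j C, (2 + y) ^ S j <= C * s -> (2 + y) ^ j * (1 + y) ^ l / s <= C * T).
  { intros j C HC. apply Rdiv_le_l; [lra|]. unfold T.
    replace (C * ((1 + y) ^ l / (1 + y)) * s) with ((1 + y) ^ l * (C * s / (1 + y))) by (field; lra).
    rewrite (Rmult_comm ((2 + y) ^ j)). apply Rmult_le_compat_l; [lra|]. apply Rle_div_r; [lra|].
    eapply Rle_trans; [|exact HC]. simpl. rewrite Rmult_comm. apply Rmult_le_compat_r; [apply pow_le|]; lra. }
  apply Absorb in B3. apply Absorb in B4.
  assert (Hhl : h ^ l <= (1 + y) ^ l) by (apply pow_incr; lra).
  assert (Hhl0 : 0 < h ^ l) by (apply pow_lt; lra).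
  assert (Hhb : (1 + h) ^ length bs <= (2 + y) ^ length bs) by (apply pow_incr; lra).
  assert (Hhb0 : 0 < (1 + h) ^ length bs) by (apply pow_lt; lra).
  assert (Hlog : (1 + h) ^ length bs * h ^ l / s <= C3 * T).
  { eapply Rle_trans; [|exact B3]. apply Rmult_le_compat_r; [left; apply Rinv_0_lt_compat; lra|].
    apply Rmult_le_compat; lra. }
  assert (HlT : INR l * (h ^ l / h) <= INR l * T) by (apply pow_div_mono; lra).
  assert (Hcov : 0 <= INR (length L) - INR (length (codes (fulls X n q bs l) n)) <= (2 + 2 * INR k) * C4 * (M * T)).
  { apply le_INR in L1. apply le_INR in L2. split; [lra|].
    assert (0 <= (2 + 2 * INR k) * C4 * (M * T)).
    { apply Rmult_le_pos; apply Rmult_le_pos; lra. }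
    rewrite plus_INR in L2. destruct (Nat.leb_spec k 1) as [Hk|Hk]; [simpl in L2; lra|].
    pose proof (cover_bound k n Hn ltac:(lia)) as P. fold X M y s in P.
    assert (Hb : (2 + y) ^ k / s <= C4 * T).
    { eapply Rle_trans; [|exact B4]. apply Rmult_le_compat_r; [left; apply Rinv_0_lt_compat; lra|].
      rewrite <- (Rmult_1_r ((2 + y) ^ k)) at 1. apply Rmult_le_compat_l; [apply pow_le|]; lra. }
    apply (Rmult_le_compat_l ((2 + 2 * INR k) * M)) in Hb; [|apply Rmult_le_pos; lra]. lra. }
  assert (Hfull : INR n ^ (k - 1) / INR n *
    (INR k * (INR l * INR n * (h ^ l / h)) + C1 * INR X * (1 + h) ^ length bs * h ^ l)
    <= (INR k * INR l + C1 * C3) * (M * T)).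
  { fold M. replace (M / INR n * (INR k * (INR l * INR n * (h ^ l / h)) + C1 * INR X * (1 + h) ^ length bs * h ^ l))
      with (M * (INR k * (INR l * (h ^ l / h))) + M * (C1 * ((1 + h) ^ length bs * h ^ l * (INR X / INR n)))) by (field; lra).
    assert (Hxn : INR X / INR n <= / s).
    { apply Rdiv_le_l; [lra|]. rewrite <- Ess. replace (/ s * (s * s)) with s by (field; lra). lra. }
    assert (E1 : (1 + h) ^ length bs * h ^ l * (INR X / INR n) <= C3 * T).
    { eapply Rle_trans; [|exact Hlog]. apply Rmult_le_compat_l; [apply Rmult_le_pos; lra|exact Hxn]. }
    assert (E2 : C1 * ((1 + h) ^ length bs * h ^ l * (INR X / INR n)) <= C1 * (C3 * T)) by (apply Rmult_le_compat_l; lra).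
    assert (E3 : INR k * (INR l * (h ^ l / h)) <= INR k * (INR l * T)) by (apply Rmult_le_compat_l; lra).
    assert (E4 := Rmult_le_compat_l M _ _ ltac:(lra) E2). assert (E5 := Rmult_le_compat_l M _ _ ltac:(lra) E3). lra. }
  set (d := kK bs * iprod (seq q (ks bs))) in *.
  assert (Hdens : C2 * (h ^ l * (1 + h) ^ length bs / INR (X + 1) + INR l * (h ^ l / h)) <= C2 * (C3 + INR l) * T).
  { rewrite Rmult_assoc. apply Rmult_le_compat_l; auto. rewrite Rmult_plus_distr_r. apply Rplus_le_compat; auto.
    eapply Rle_trans; [|exact Hlog]. unfold Rdiv. rewrite (Rmult_comm (h ^ l)).
    apply Rmult_le_compat_l; [apply Rmult_le_pos; lra|exact HXi]. }
  assert (Hpow : Rabs (h ^ l - y ^ l) <= INR l * T).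
  { apply Rle_trans with ((1 + y) ^ l - y ^ l); [|apply pow_near; lra].
    assert (y ^ l <= h ^ l) by (apply pow_incr; lra). rewrite Rabs_right; lra. }
  assert (Ip := iprod_seq_pos 1 (q - 1) ltac:(lia)). set (ip := iprod (seq 1 (q - 1))) in *.
  assert (If : 0 < / INR (fact (k - 1)) <= 1) by (apply inv_INR_bounds, lt_O_fact).
  assert (Il : 0 < / INR (fact l) <= 1) by (apply inv_INR_bounds, lt_O_fact).
  assert (Id : 0 < d <= 1).
  { pose proof (kK_bounds bs Hv). pose proof (iprod_seq_pos q (ks bs) Hq). unfold d. split; [nra|].
    rewrite <- (Rmult_1_r 1). apply Rmult_le_compat; lra. }
  set (f1 := / INR (fact (k - 1))) in *. set (f2 := / INR (fact l)) in *.
  assert (Hw : 0 < ip * f1 <= 1).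
  { split; [nra|]. rewrite <- (Rmult_1_r 1). apply Rmult_le_compat; lra. }
  assert (Hw2 : 0 < ip * f1 * (d * f2) <= 1).
  { assert (0 < d * f2 <= 1) by (split; [nra|rewrite <- (Rmult_1_r 1); apply Rmult_le_compat; lra]).
    split; [nra|]. rewrite <- (Rmult_1_r 1). apply Rmult_le_compat; lra. }
  set (F := INR (length (codes (fulls X n q bs l) n))) in *. set (b := Bs X q bs (Ss n l)) in *.
  (* Four errors: the leftover codes, the counts of multiplicities, the density of the maximal sets,
     and [harm n] against [ln n]. *)
  replace (INR (length L) - c * (M * y ^ l)) with
    ((INR (length L) - F) + (F - ip * (f1 * M) * b) + ip * f1 * M * (b - d * (f2 * h ^ l))
      + ip * f1 * (d * f2) * M * (h ^ l - y ^ l)) by (unfold c; ring).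
  assert (R1 : Rabs (INR (length L) - F) <= (2 + 2 * INR k) * C4 * (M * T)) by (apply Rabs_le; lra).
  assert (R2 : Rabs (F - ip * (f1 * M) * b) <= (INR k * INR l + C1 * C3) * (M * T)) by (eapply Rle_trans; [exact B1|exact Hfull]).
  assert (R3 : Rabs (ip * f1 * M * (b - d * (f2 * h ^ l))) <= C2 * (C3 + INR l) * (M * T)).
  { rewrite Rabs_mult, (Rabs_right (ip * f1 * M)) by (apply Rle_ge, Rmult_le_pos; lra).
    apply Rle_trans with (M * (C2 * (C3 + INR l) * T)); [|right; ring].
    apply Rmult_le_compat; [apply Rmult_le_pos; lra|apply Rabs_pos| |lra].
    rewrite <- (Rmult_1_l M) at 2. apply Rmult_le_compat_r; lra. }
  assert (R4 : Rabs (ip * f1 * (d * f2) * M * (h ^ l - y ^ l)) <= INR l * (M * T)).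
  { rewrite Rabs_mult, (Rabs_right (ip * f1 * (d * f2) * M)) by (apply Rle_ge, Rmult_le_pos; lra).
    apply Rle_trans with (M * (INR l * T)); [|right; ring].
    apply Rmult_le_compat; [apply Rmult_le_pos; lra|apply Rabs_pos| |lra].
    rewrite <- (Rmult_1_l M) at 2. apply Rmult_le_compat_r; lra. }
  eapply Rle_trans; [apply Rabs_triang|]. eapply Rle_trans; [apply Rplus_le_compat_r, Rabs_triang|].
  eapply Rle_trans; [apply Rplus_le_compat_r, Rplus_le_compat_r, Rabs_triang|]. lra.
Qed.

(** * The gaps of the pattern *)

Lemma prodR_ext m f g : (forall i, (i < m)%nat -> f i = g i) -> prodR m f = prodR m g.
Proof. induction m as [|m IH]; simpl; intros E; auto. rewrite IH, E; auto. Qed.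

Lemma prodR_S m f : prodR (S m) f = prodR m f * f m.
Proof. reflexivity. Qed.

Lemma prodR_split t m f : prodR (t + m) f = prodR t f * prodR m (fun i => f (t + i)%nat).
Proof.
  induction m as [|m IH]; [rewrite Nat.add_0_r; simpl; ring|].
  rewrite Nat.add_succ_r. simpl. rewrite IH. ring.
Qed.

Lemma prodR_fact m : prodR m (fun i => INR m - INR i) = INR (fact m).
Proof.
  induction m as [|m IH]; [reflexivity|].
  change (S m) with (1 + m)%nat at 1. rewrite prodR_split, fact_simpl, mult_INR, <- IH. simpl prodR at 1.
  rewrite Rminus_0_r, Rmult_1_l. f_equal. apply prodR_ext. intros i _. rewrite plus_INR, S_INR. simpl. ring.
Qed.

Lemma iprod_fact m : iprod (seq 1 m) = / INR (fact m).
Proof.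
  induction m as [|m IH]; [simpl; lra|]. rewrite seq_S, iprod_app, IH, fact_simpl, mult_INR, Rinv_mult.
  cbn [iprod Nat.add]. ring.
Qed.

Lemma diffs_app nu1 : forall q nu2, diffs q (nu1 ++ nu2) = diffs q nu1 ++ diffs (last (q :: nu1) 0%nat) nu2.
Proof.
  induction nu1 as [|m nu1 IH]; intros q nu2; [reflexivity|].
  simpl app. simpl diffs. rewrite IH. destruct nu1; reflexivity.
Qed.

Lemma diffs_seq l : forall a, diffs a (seq (S a) l) = repeat 1%nat l.
Proof. induction l as [|l IH]; intros a; simpl; auto. rewrite IH. f_equal. destruct a; lia. Qed.

(** Here [z] is the least of the leading consecutive parts, and [x + 2 <= z] says that [z - 1] is
    skipped, which makes the last gap at least 2. Adding a smallest part [q] divides [kK] by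
    [ks = z - q - 1 - length nu0]. In decreasing order [q] has index [length nu0], so this is
    exactly its factor in the product. *)
Lemma gaps_telescope z nu0 : forall q, inc (S q) nu0 -> (forall x, In x (q :: nu0) -> (x + 2 <= z)%nat) ->
  valid (diffs q (nu0 ++ [z])) /\
  (ks (diffs q (nu0 ++ [z])) + q + S (length nu0) = z)%nat /\
  (q + list_sum (diffs q (nu0 ++ [z])) = z)%nat /\
  kK (diffs q (nu0 ++ [z])) * prodR (S (length nu0))
    (fun j => INR z - 1 - INR (nth j (rev (q :: nu0)) 0%nat) - INR j) = 1.
Proof.
  induction nu0 as [|m nu0 IH]; intros q Hi Hz.
  - specialize (Hz q (or_introl eq_refl)). simpl app. cbn [diffs valid ks list_sum fold_right length].
    split; [lia|]. split; [lia|]. split; [simpl; lia|].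
    cbn [kK ks prodR rev app nth]. rewrite Nat.add_0_r, !minus_INR by lia. simpl (INR 1). simpl (INR 0).
    apply le_INR in Hz. rewrite plus_INR in Hz. simpl in Hz. field. lra.
  - destruct Hi as [Hm Hi]. destruct (IH m Hi) as (I1 & I2 & I3 & I4).
    { intros x Hx. apply Hz. simpl in *; tauto. }
    simpl app. cbn [diffs valid list_sum fold_right]. fold (list_sum (diffs m (nu0 ++ [z]))).
    set (ds := diffs m (nu0 ++ [z])) in *.
    assert (Hlow : (m + length nu0 + 2 <= z)%nat).
    { clear -Hi Hz Hm. revert m q Hi Hz Hm. induction nu0 as [|m' nu0 IH]; intros m q Hi Hz Hm.
      - specialize (Hz m). simpl in *. lia.
      - destruct Hi as [Hm' Hi]. specialize (IH m' m Hi). simpl.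
        enough (m' + length nu0 + 2 <= z)%nat by lia. apply IH; auto. intros x Hx. apply Hz. simpl in *; tauto. }
    assert (Hks : (ks ((m - q)%nat :: ds) + q + S (S (length nu0)) = z)%nat) by (simpl; lia).
    split; [repeat split; auto; lia|]. split; [exact Hks|]. split; [lia|].
    cbn [kK length]. set (s := ks ((m - q)%nat :: ds)) in *.
    rewrite (prodR_S (S (length nu0))).
    rewrite (prodR_ext (S (length nu0)) _ (fun j => INR z - 1 - INR (nth j (rev (m :: nu0)) 0%nat) - INR j)).
    2:{ intros i Hi'. change (rev (q :: m :: nu0)) with (rev (m :: nu0) ++ [q]).
        rewrite app_nth1; auto. rewrite length_rev. simpl. lia. }
    change (rev (q :: m :: nu0)) with (rev (m :: nu0) ++ [q]).
    rewrite app_nth2 by (rewrite length_rev; simpl; lia).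
    replace (S (length nu0) - length (rev (m :: nu0)))%nat with 0%nat by (rewrite length_rev; simpl; lia).
    cbn [nth].
    set (p := prodR (S (length nu0)) (fun j => INR z - 1 - INR (nth j (rev (m :: nu0)) 0%nat) - INR j)) in *.
    assert (Es : INR z - 1 - INR q - INR (S (length nu0)) = INR s).
    { rewrite <- Hks, !plus_INR, !S_INR. ring. }
    assert (Hs1 : 1 <= INR s) by (apply INR_pos_le; unfold s; simpl; lia).
    fold p. rewrite Es. replace (kK ds / INR s * (p * INR s)) with (kK ds * p) by (field; lra). exact I4.
Qed.

(** The initial segment [1, ..., q - 1] and the telescoped run from [q] join into
    [1, ..., z - 1 - t], with reciprocal product [1 / (z - 1 - t)!]. The indices [j >= t], where
    [nth] returns the default 0, contribute precisely this factorial. *)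
Lemma density_constant q nu0 z : (1 <= q)%nat ->
  valid (diffs q (nu0 ++ [z])) ->
  (ks (diffs q (nu0 ++ [z])) + q + S (length nu0) = z)%nat ->
  kK (diffs q (nu0 ++ [z])) * prodR (S (length nu0))
    (fun j => INR z - 1 - INR (nth j (rev (q :: nu0)) 0%nat) - INR j) = 1 ->
  let bs := diffs q (nu0 ++ [z]) in
  iprod (seq 1 (q - 1)) * (kK bs * iprod (seq q (ks bs))) *
    prodR (z - 1) (fun j => INR (z - 1) - INR (nth j (rev (q :: nu0)) 0%nat) - INR j) = 1.
Proof.
  intros Hq Hv Hks HK bs. fold bs in Hv, Hks, HK. set (t := S (length nu0)) in *.
  assert (E : iprod (seq 1 (q - 1)) * iprod (seq q (ks bs)) = / INR (fact (z - 1 - t))).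
  { rewrite <- iprod_fact, <- iprod_app. f_equal. replace q with (1 + (q - 1))%nat at 2 by lia.
    rewrite <- seq_app. f_equal. lia. }
  replace (z - 1)%nat with (t + (z - 1 - t))%nat at 1 by lia. rewrite prodR_split.
  assert (Et : forall j, INR (z - 1) - INR (nth j (rev (q :: nu0)) 0%nat) - INR j =
                         INR z - 1 - INR (nth j (rev (q :: nu0)) 0%nat) - INR j).
  { intros j. rewrite minus_INR by lia. simpl. ring. }
  rewrite (prodR_ext t _ _ (fun j _ => Et j)).
  rewrite (prodR_ext (z - 1 - t) _ (fun i => INR (z - 1 - t) - INR i)), prodR_fact.
  2:{ intros i _. rewrite nth_overflow by (rewrite length_rev; simpl; unfold t; lia).
      rewrite plus_INR. rewrite (minus_INR (z - 1) t) by lia. simpl (INR 0). ring. }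
  set (p := prodR t _) in *.
  replace (iprod (seq 1 (q - 1)) * (kK bs * iprod (seq q (ks bs))) * (p * INR (fact (z - 1 - t))))
    with (iprod (seq 1 (q - 1)) * iprod (seq q (ks bs)) * (kK bs * p) * INR (fact (z - 1 - t))) by ring.
  rewrite E, HK. field. apply INR_fact_neq_0.
Qed.

(** * From the shape of the pattern to the asymptotics *)

Lemma strict_partition_inc mu : is_strict_partition mu -> inc 1 (rev mu).
Proof.
  intros [H1 H2]. apply dec_inc_rev.
  - apply Sorted_StronglySorted in H2; [|intros ? ? ? ? ?; lia].
    induction H2 as [|a mu H2 IH F]; simpl; auto. inversion H1; subst.
    split; auto. rewrite Forall_forall in F. auto.
  - rewrite Forall_forall in H1. auto.
Qed.

(** Read increasingly, the [l + 1] leading parts are consecutive and yield the final [l] gaps of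
    size 1. *)
Lemma top_segment (mu : list nat) k l : (l < k)%nat ->
  (forall i, (i <= l)%nat -> nth i mu 0%nat = (k + 1 - i)%nat) ->
  rev mu = rev (skipn (l + 1) mu) ++ (k + 1 - l)%nat :: seq (S (k + 1 - l)) l.
Proof.
  intros Hl Hm.
  assert (HL : (l + 1 <= length mu)%nat).
  { destruct (Nat.le_gt_cases (l + 1) (length mu)); auto.
    specialize (Hm l ltac:(lia)). rewrite nth_overflow in Hm; lia. }
  rewrite <- (firstn_skipn (l + 1) mu) at 1. rewrite rev_app_distr. f_equal.
  change ((k + 1 - l)%nat :: seq (S (k + 1 - l)) l) with (seq (k + 1 - l) (S l)).
  apply nth_ext with (d := 0%nat) (d' := 0%nat).
  - rewrite length_rev, length_firstn, length_seq. lia.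
  - intros i Hi. rewrite length_rev, length_firstn in Hi.
    rewrite rev_nth by (rewrite length_firstn; lia). rewrite length_firstn, seq_nth by lia.
    rewrite nth_firstn. destruct (Nat.ltb_spec (Nat.min (l + 1) (length mu) - S i) (l + 1)); [|lia].
    rewrite Hm by lia. lia.
Qed.

Lemma nth_skipn_shift (mu : list nat) m j : nth (m + j) mu 0%nat = nth j (skipn m mu) 0%nat.
Proof. now rewrite nth_skipn. Qed.

Theorem mainTheorem19 (mu : list nat) (k l : nat) :
  is_strict_partition mu ->
  (1 <= k)%nat ->
  (forall i, (i <= l)%nat -> nth i mu 0%nat = (k + 1 - i)%nat) ->
  (nth (l + 1) mu 0%nat < k - l)%nat ->
  let a := fun j => nth (l + 1 + j) mu 0%nat in
  let main := fun n : nat =>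
    INR n ^ (k - 1) * ln (INR n) ^ l /
    (INR (fact l) * INR (fact (k - 1)) *
     prodR (k - l) (fun j => INR (k - l) - INR (a j) - INR j)) in
  exists C : R, exists N : nat, forall n : nat, (N <= n)%nat ->
    exists L : list (list nat), enumerates_Av mu n L /\
      Rabs (INR (length L) - main n) <= C * main n / ln (INR n).
Proof.
  intros Hmu Hk Htop Ha a main.
  assert (Hl : (l < k)%nat) by lia.
  pose proof (top_segment mu k l Hl Htop) as Erev.
  pose proof (strict_partition_inc mu Hmu) as Hinc. rewrite Erev in Hinc.
  set (z := (k + 1 - l)%nat) in *. set (al := skipn (l + 1) mu) in *.
  assert (Hnth : forall j, a j = nth j al 0%nat) by (intros j; apply nth_skipn_shift).
  set (p := prodR (k - l) (fun j => INR (k - l) - INR (a j) - INR j)) in *.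
  assert (Struct : exists q nu bs, rev mu = q :: nu /\ (1 <= q)%nat /\ inc (S q) nu /\
    diffs q nu = bs ++ repeat 1%nat l /\ valid bs /\
    (bs = [] /\ (2 <= q)%nat \/ bs <> [] /\ (2 <= last bs 0)%nat) /\
    (q - 1 + list_sum bs + l = k)%nat /\
    iprod (seq 1 (q - 1)) * (kK bs * iprod (seq q (ks bs))) * p = 1).
  { destruct (rev al) as [|q nu0] eqn:Eal.
    (* No part lies below [z]: all [a j] vanish, the product is [(k - l)!], and the part size 1 is
       available because [z >= 2]. *)
    - exists z, (seq (S z) l), []. simpl in Hinc. simpl app in *.
      split; [exact Erev|]. split; [lia|]. split; [tauto|]. split; [apply diffs_seq|].
      split; [exact I|]. split; [left; split; auto; unfold z; lia|]. split; [simpl; unfold z; lia|].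
      cbn [kK ks seq iprod]. rewrite iprod_fact. unfold p.
      rewrite (prodR_ext _ _ (fun j => INR (k - l) - INR j)), prodR_fact.
      + replace (z - 1)%nat with (k - l)%nat by (unfold z; lia). field. apply INR_fact_neq_0.
      + intros i _. rewrite Hnth. replace al with (@nil nat).
        * destruct i; simpl; ring.
        * rewrite <- (rev_involutive al), Eal. reflexivity.
    - assert (El : al = rev (q :: nu0)) by (rewrite <- Eal; now rewrite rev_involutive).
      (* The gap that ends at [z] closes [bs]; it is at least 2 because the parts below [z] are at
         most [z - 2]. *)
      exists q, (nu0 ++ z :: seq (S z) l), (diffs q (nu0 ++ [z])).
      apply inc_app in Hinc. destruct Hinc as (I1 & I2 & I3). destruct I1 as [Hq I1]. destruct I2 as [Hz I2].
      assert (Hlast : (last (q :: nu0) 0 < k - l)%nat).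
      { rewrite <- (Nat.add_0_r (l + 1)) in Ha. rewrite nth_skipn_shift in Ha. fold al in Ha.
        rewrite El in Ha. destruct (exists_last (l := q :: nu0)) as (l' & x & E); [discriminate|].
        rewrite E in *. rewrite rev_app_distr in Ha. rewrite last_last. exact Ha. }
      assert (Hbelow : forall x, In x (q :: nu0) -> (x + 2 <= z)%nat).
      { intros x Hx. destruct (exists_last (l := q :: nu0)) as (l' & y & E); [discriminate|].
        assert (I1' : inc 1 (q :: nu0)) by (simpl; auto).
        rewrite E in Hx, Hlast, I1'. rewrite last_last in Hlast. apply inc_app in I1'.
        destruct I1' as (_ & _ & I1'). apply in_app_iff in Hx. destruct Hx as [Hx|[<-|[]]]; [|unfold z; lia].
        specialize (I1' x y Hx ltac:(simpl; auto)). unfold z. lia. }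
      destruct (gaps_telescope z nu0 q I1 Hbelow) as (G1 & G2 & G3 & G4).
      split; [exact Erev|]. split; [lia|]. split.
      { apply inc_app. split; [exact I1|]. split.
        - specialize (Hbelow q (or_introl eq_refl)). simpl. split; [lia|exact I2].
        - intros x y Hx Hy. apply I3; simpl; auto. }
      split.
      { change (z :: seq (S z) l) with ([z] ++ seq (S z) l). rewrite app_assoc, diffs_app. f_equal.
        rewrite app_comm_cons, last_last. apply diffs_seq. }
      split; [exact G1|]. split.
      { right. rewrite diffs_app. simpl (diffs _ [z]).
        split; [now destruct (diffs q nu0)|]. rewrite last_last. unfold z. 
        change (2 <= k + 1 - l - last (q :: nu0) 0)%nat. lia. }
      split; [unfold z in *; lia|].
      pose proof (density_constant q nu0 z Hq G1 G2 G4) as D. cbv zeta in D.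
      replace (z - 1)%nat with (k - l)%nat in D by (unfold z; lia).
      unfold p. rewrite (prodR_ext _ _ (fun j => INR (k - l) - INR (nth j (rev (q :: nu0)) 0%nat) - INR j)); [exact D|].
      intros i _. now rewrite Hnth, El. }
  destruct Struct as (q & nu & bs & Hrev & Hq & Hnu & Hd & Hv & Hbs & Hkk & Hp).
  destruct (avoiders_asymptotics mu q nu bs l Hrev Hq Hnu Hd Hv Hbs) as (C & HC & HA).
  rewrite Hkk in HA. set (d := kK bs * iprod (seq q (ks bs))) in *. set (ip := iprod (seq 1 (q - 1))) in *.
  assert (Hd0 : 0 < ip * d).
  { pose proof (kK_bounds bs Hv). pose proof (iprod_seq_pos q (ks bs) Hq). pose proof (iprod_seq_pos 1 (q - 1) ltac:(lia)).
    unfold d, ip. repeat apply Rmult_lt_0_compat; lra. }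
  assert (Hp0 : 0 < p) by nra.
  assert (Hidp : ip * d = / p) by (apply Rmult_eq_reg_r with p; [rewrite Rinv_l|]; lra).
  set (F := INR (fact l) * INR (fact (k - 1)) * p).
  pose proof (INR_fact_lt_0 l) as Hfl. pose proof (INR_fact_lt_0 (k - 1)) as Hfk.
  assert (HF : 0 < F) by (unfold F; repeat apply Rmult_lt_0_compat; lra).
  (* From [n >= 3 >= exp 1] follows [1 <= ln n], so [1 + ln n <= 2 ln n], which accounts for
     [2 ^ l]; [F] cancels the denominator of [main]. *)
  exists (C * 2 ^ l * F), 3%nat. intros n Hn. destruct (HA n ltac:(lia)) as (L & HL & HB).
  exists L. split; auto.
  assert (Hmain : main n = ip * / INR (fact (k - 1)) * d * / INR (fact l) * (INR n ^ (k - 1) * ln (INR n) ^ l)).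
  { replace (ip * / INR (fact (k - 1)) * d * / INR (fact l)) with (ip * d * / INR (fact (k - 1)) * / INR (fact l)) by ring.
    rewrite Hidp. unfold main. field. lra. }
  rewrite <- Hmain in HB. eapply Rle_trans; [exact HB|].
  assert (Hn3 : 3 <= INR n) by (apply le_INR in Hn; simpl in Hn; lra).
  assert (Hln : 1 <= ln (INR n)).
  { rewrite <- (ln_exp 1). pose proof exp_le_3.
    destruct (Req_dec (exp 1) (INR n)) as [->|E]; [lra|]. left. apply ln_increasing; [apply exp_pos|lra]. }
  set (y := ln (INR n)) in *. set (M := INR n ^ (k - 1)) in *.
  assert (HM : 0 < M) by (apply pow_lt; lra).
  replace (C * 2 ^ l * F * main n / y) with (C * (M * ((2 * y) ^ l / y))).
  2:{ rewrite Rpow_mult_distr. unfold main. fold F y M. field. lra. }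
  apply Rmult_le_compat_l; auto. apply Rmult_le_compat_l; [lra|].
  apply Rmult_le_compat; [apply pow_le; lra|left; apply Rinv_0_lt_compat; lra|apply pow_incr; lra|].
  apply Rinv_le_contravar; lra.
Qed.
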